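(* Let $\Psi: \mathrm{Conv}(U,\mathbb{R})\rightarrow\mathcal{M}(U)$ be a continuous, dually epi-translation invariant valuation. If $\Psi$ is dually simple and locally determined, then there exists a unique continuous function $\psi\in C(U)$ such that for every $f\in\mathrm{Conv}(U,\mathbb{R})$, \begin{align*} \Psi(f)[B]=\int_B \psi(x)d\mathrm{MA}(f)[x]\quad\text{for all relatively compact Borel sets}~B\subset U. \end{align*}
   Context: $U\subset\mathbb{R}^n$ is an open convex set, $\mathrm{Conv}(U,\mathbb{R})$ is the space of all finite-valued convex functions $f:U\to\mathbb{R}$ with the topology of uniform convergence on compact subsets, and $\mathcal{M}(U)=(C_c(U))'$ is the space of complex Radon measures on $U$ with the weak*-topology. $\mathrm{MA}(f)$ denotes the real Monge-Amp\`ere measure of $f$ (the continuous extension of $\det(D^2f(x))\,d\mathrm{vol}_n(x)$ from $C^2$ convex functions). $\Psi$ is a valuation if $\Psi(f)+\Psi(h)=\Psi(f\vee h)+\Psi(f\wedge h)$ whenever $f\vee h, f\wedge h\in\mathrm{Conv}(U,\mathbb{R})$. It is dually epi-translation invariant if $\Psi(f+l)=\Psi(f)$ for all affine $l:\mathbb{R}^n\to\mathbb{R}$; locally determined if $f\equiv h$ on an open $V\subset U$ implies $\Psi(f)[B\cap V]=\Psi(h)[B\cap V]$ for all relatively compact Borel $B\subset U$; dually simple if $\Psi(\pi_E^*f|_U)=0$ for all $f\in\mathrm{Conv}(E,\mathbb{R})$ and all proper subspaces $E\subset\mathbb{R}^n$, where $\pi_E$ is the orthogonal projection onto $E$. *)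

(* Defs.v *)
From HB Require Import structures.
From mathcomp Require Import all_boot all_order all_algebra.
From mathcomp Require Import all_classical all_reals all_analysis.
Set Implicit Arguments.
Unset Strict Implicit.
Unset Printing Implicit Defensive.
Import Order.TTheory GRing.Theory Num.Theory.
Import numFieldNormedType.Exports.
Local Open Scope classical_set_scope.
Local Open Scope ring_scope.

Section Defs.
Variables (R : realType) (n : nat).

Notation vec := 'rV[R]_n.

(* Convexity: the library notions [convex_set] and [convex_function]
   (mathcomp-analysis convex.v).  A finite-valued convex function on U is a
   function vec -> R that is convex on U; values outside U are irrelevant. *)
Definition convex_on (U : set vec) (f : vec -> R) : Prop :=
  convex_function (U : set (convex_lmodType vec)) (f : convex_lmodType vec -> R^o).

Definition affine (l : vec -> R) : Prop :=
  exists (a : vec) (c : R), forall x, l x = \sum_(i < n) a 0 i * x 0 i + c.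

Definition supported_in (K : set vec) (phi : vec -> R) : Prop :=
  forall x, ~ K x -> phi x = 0.

Definition testfun (U : set vec) (phi : vec -> R) : Prop :=
  continuous phi /\ exists K, compact K /\ K `<=` U /\ supported_in K phi.

Definition cvg_loc_unif (U : set vec) (F : nat -> vec -> R) (f : vec -> R) : Prop :=
  forall K, compact K -> K `<=` U -> forall eps : R, 0 < eps ->
    \forall k \near \oo, forall x, K x -> `|F k x - f x| < eps.

(* A complex Radon measure on U, seen (as in the paper, M(U) = C_c(U)') as a
   functional on test functions.  Complex numbers are pairs (Re, Im) and the
   functional is given on real-valued test functions (complex test functions
   are handled by C-linearity). *)
Definition cmeas := (vec -> R) -> R * R.

Definition radon (U : set vec) (mu : cmeas) : Prop :=
  (forall phi1 phi2 (a b : R), testfun U phi1 -> testfun U phi2 ->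
     mu (fun x => a * phi1 x + b * phi2 x) =
     ((a * (mu phi1).1 + b * (mu phi2).1), (a * (mu phi1).2 + b * (mu phi2).2)))
  /\ (forall K, compact K -> K `<=` U -> exists C : R, forall phi,
        testfun U phi -> supported_in K phi -> (forall x, `|phi x| <= 1) ->
        `|(mu phi).1| <= C /\ `|(mu phi).2| <= C).

(* Iterated integral over R^n (= Lebesgue integral for compactly supported
   continuous integrands). *)
Fixpoint iint (m : nat) : ('rV[R]_m -> R) -> R :=
  match m return ('rV[R]_m -> R) -> R with
  | 0 => fun g => g 0
  | m'.+1 => fun g =>
      Rintegral (@lebesgue_measure R) setT
        (fun t : R => iint (fun y : 'rV[R]_m' => g (row_mx (t%:M : 'rV[R]_1) y)))
  end.

Definition ebasis (i : 'I_n) : vec := delta_mx 0 i.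

Definition partial (i : 'I_n) (f : vec -> R) : vec -> R :=
  fun x => derive f x (ebasis i).

Definition C2_on (U : set vec) (f : vec -> R) : Prop :=
  forall i j x, U x ->
    derivable f x (ebasis i) /\ derivable (partial i f) x (ebasis j) /\
    {for x, continuous (partial j (partial i f))}.

Definition hessian (f : vec -> R) (x : vec) : 'M[R]_n :=
  \matrix_(i, j) partial j (partial i f) x.

(* The real Monge-Ampere operator on U: the (unique) map from Conv(U,R) to
   M(U) which is continuous (locally uniform convergence -> weak-* convergence)
   and equals det(D^2 f(x)) dvol(x) on C^2 convex functions.  Measures are
   again functionals on test functions. *)
Definition is_MongeAmpere (U : set vec) (MA : (vec -> R) -> (vec -> R) -> R) : Prop :=
  (forall f, convex_on U f -> C2_on U f -> forall phi, testfun U phi ->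
      MA f phi = iint (fun x => phi x * \det (hessian f x)))
  /\ (forall (F : nat -> vec -> R) f, (forall k, convex_on U (F k)) -> convex_on U f ->
      cvg_loc_unif U F f -> forall phi, testfun U phi ->
      (fun k => MA (F k) phi) @ \oo --> MA f phi).

Definition orthproj (E : 'M[R]_n) (x : vec) : vec :=
  x *m proj_mx E (kermx E^T).

Definition subspace_of (E : 'M[R]_n) : set vec := fun x => (x <= E)%MS.

Definition meas_eq (U : set vec) (mu nu : cmeas) : Prop :=
  forall phi, testfun U phi -> mu phi = nu phi.

Definition Psi_continuous (U : set vec) (Psi : (vec -> R) -> cmeas) : Prop :=
  forall (F : nat -> vec -> R) f, (forall k, convex_on U (F k)) -> convex_on U f ->
    cvg_loc_unif U F f -> forall phi, testfun U phi ->
    (fun k => Psi (F k) phi) @ \oo --> Psi f phi.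

Definition valuation (U : set vec) (Psi : (vec -> R) -> cmeas) : Prop :=
  forall f h, convex_on U f -> convex_on U h ->
    convex_on U (fun x => Num.min (f x) (h x)) ->
    forall phi, testfun U phi ->
      Psi f phi + Psi h phi =
      Psi (fun x => Num.max (f x) (h x)) phi + Psi (fun x => Num.min (f x) (h x)) phi.

Definition dually_epi_translation_invariant (U : set vec) (Psi : (vec -> R) -> cmeas) : Prop :=
  forall f l, convex_on U f -> affine l ->
    meas_eq U (Psi (fun x => f x + l x)) (Psi f).

(* Psi(f)[B cap V] = Psi(h)[B cap V] for all relatively compact Borel B is
   expressed as: Psi(f) and Psi(h) agree on test functions supported in V. *)
Definition locally_determined (U : set vec) (Psi : (vec -> R) -> cmeas) : Prop :=
  forall f h (V : set vec), convex_on U f -> convex_on U h -> open V -> V `<=` U ->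
    (forall x, V x -> f x = h x) ->
    forall phi, testfun V phi -> Psi f phi = Psi h phi.

Definition dually_simple (U : set vec) (Psi : (vec -> R) -> cmeas) : Prop :=
  forall (E : 'M[R]_n), (\rank E < n)%N ->
    forall f, convex_on (subspace_of E) f ->
    meas_eq U (Psi (fun x => f (orthproj E x))) (fun _ => (0, 0)).

End Defs.

(* Main.v *)
Require Import Defs.
From HB Require Import structures.
From mathcomp Require Import all_boot all_order all_algebra.
From mathcomp Require Import all_classical all_reals all_analysis.
From mathcomp Require Import ring lra.
Import Order.TTheory GRing.Theory Num.Theory.
Import numFieldNormedType.Exports.
Local Open Scope classical_set_scope.
Local Open Scope ring_scope.
Set Implicit Arguments.
Unset Strict Implicit.
Unset Printing Implicit Defensive.

(** By density it suffices to test the identity on a class of functions that is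
    dense for locally uniform convergence, one real component [P] of [Psi] at a time.

    Hinge sums: consider finite sums of functions [max(<v_j, x> - t_j, 0)].  If the [v_j] do not
    span, simplicity gives [0].  If they form a basis, then off the common zero [x0] of the
    [<v_j, .> - t_j] the function is locally, up to affine summands, a degenerate sum, so
    [P] is a multiple of the Dirac mass at [x0]; the valuation property gives invariance of the
    multiple under shears of [(v_j)], and it scales linearly in each [v_j], hence it is
    [|det(v_j)| psi(x0)].  This defines [psi].  With more hinges, perturb the [t_j] until they have
    no common zero, localize by a partition of unity, and drop a hinge that is affine there.
    The Monge-Ampere measure obeys the same rules, by smoothing the hinges with cubic splines.

    Exponential sums: ridge functions [c exp <w, x>] with [c >= 0] are limits of hinge sums.  Both [P] and
    [det D^2] are affine in [s] along [f + s exp <w, .>], which extends the identity to all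
    convex exponential sums, with coefficients of any sign.

    Density: a convex function is a locally uniform limit of maxima of finitely many affine
    functions, these are limits of log-sum-exp functions, and a log-sum-exp is a limit of
    convex polynomials in its exponential, which are exponential sums. *)

(** * Convex functions and locally uniform convergence *)

(** Sums of convex ridge functions are not dense when n is at least 2: max(0, x1, x2) has kinks
    along pieces of hyperplanes, whereas a ridge function is singular along whole ones. Negative
    coefficients are therefore unavoidable, yet [Psi] is controlled only on convex functions and
    cannot be extended by linearity. Exponentials resolve this: compensating a negative term adds a
    convex function, so the argument stays among convex functions, and the original value is
    extrapolated from the compensated ones. Products of exponentials are exponentials, so
    polynomials in an exponential sum remain in the class. [is_MongeAmpere] provides only sequential
    continuity and the values on C^2 functions. Linearity in the test function, locality and the
    Dirac masses are thus derived for hinge sums alone, from explicit determinants of smoothed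
    Hessians; exponential sums are C^2 and need no smoothing. How the iterated integral [iint]
    scales under a linear map is deduced from the uniqueness of positive translation-invariant
    functionals. *)

Section Convexity.
Variable (R : realType).
Implicit Types (g : R -> R).

Definition dotp n (v x : 'rV[R]_n) : R := \sum_(i < n) v 0 i * x 0 i.

Lemma dotpDr n (v x y : 'rV[R]_n) : dotp v (x + y) = dotp v x + dotp v y.
Proof. by rewrite /dotp -big_split; apply: eq_bigr => i _; rewrite !mxE mulrDr. Qed.
Lemma dotpZr n (v x : 'rV[R]_n) a : dotp v (a *: x) = a * dotp v x.
Proof. by rewrite /dotp mulr_sumr; apply: eq_bigr => i _; rewrite !mxE mulrCA. Qed.
Lemma dotpC n (v x : 'rV[R]_n) : dotp v x = dotp x v.
Proof. by apply: eq_bigr => i _; rewrite mulrC. Qed.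
Lemma dotpDl n (v w x : 'rV[R]_n) : dotp (v + w) x = dotp v x + dotp w x.
Proof. by rewrite dotpC dotpDr !(dotpC x). Qed.
Lemma dotpZl n (v x : 'rV[R]_n) a : dotp (a *: v) x = a * dotp v x.
Proof. by rewrite dotpC dotpZr (dotpC x). Qed.
Lemma dotp0l n (x : 'rV[R]_n) : dotp 0 x = 0.
Proof. by rewrite -[0](scale0r 0) dotpZl mul0r. Qed.
Lemma dotpNr n (v x : 'rV[R]_n) : dotp v (- x) = - dotp v x.
Proof. by rewrite -scaleN1r dotpZr mulN1r. Qed.
Lemma dotpBr n (v x y : 'rV[R]_n) : dotp v (x - y) = dotp v x - dotp v y.
Proof. by rewrite dotpDr dotpNr. Qed.
Lemma dotp_mulmx n (v x : 'rV[R]_n) : dotp v x = (x *m v^T) 0 0.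
Proof. by rewrite mxE; apply: eq_bigr => i _; rewrite mxE mulrC. Qed.
Lemma dotp_delta n (x : 'rV[R]_n) i : dotp (delta_mx 0 i) x = x 0 i.
Proof.
rewrite /dotp (bigD1 i)//= !mxE !eqxx mul1r big1 ?addr0// => j ji.
by rewrite mxE eqxx (negbTE ji) mul0r.
Qed.
Lemma normrow_le n (x : 'rV[R]_n) i : `|x 0 i| <= `|x|.
Proof.
rewrite [X in _ <= X]/Num.norm /= mx_normrE.
by apply/bigmax_geP; right => /=; exists (0, i).
Qed.
Lemma normrow_lt n (x : 'rV[R]_n) (e : R) : 0 < e -> (forall i, `|x 0 i| < e) -> `|x| < e.
Proof.
move=> e0 H; rewrite [X in X < _]/Num.norm /= mx_normrE.
by apply/bigmax_ltP; split => // -[i j] _ /=; rewrite ord1.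
Qed.
Lemma normrow_leP n (x : 'rV[R]_n) (e : R) : 0 <= e -> (forall i, `|x 0 i| <= e) -> `|x| <= e.
Proof.
move=> e0 H; rewrite [X in X <= _]/Num.norm /= mx_normrE.
by apply/bigmax_leP; split => // -[i j] _ /=; rewrite ord1.
Qed.
Lemma dotp_le n (v x : 'rV[R]_n) : `|dotp v x| <= (\sum_i `|v 0 i|) * `|x|.
Proof.
rewrite (le_trans (ler_norm_sum _ _ _))// mulr_suml ler_sum// => i _.
by rewrite normrM ler_wpM2l// normrow_le.
Qed.
Lemma rV_nbhsP n (x : 'rV[R]_n) (A : set 'rV[R]_n) :
  nbhs x A <-> exists2 d : R, 0 < d & forall y, `|x - y| < d -> A y.
Proof.
split=> [/nbhs_ballP[d d0 H]|[d d0 H]].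
  by exists d => // y xy; apply: H; rewrite mx_norm_ball.
by apply/nbhs_ballP; exists d => // y; rewrite mx_norm_ball; apply: H.
Qed.
Lemma rV_continuousP n (f : 'rV[R]_n -> R) x : {for x, continuous f} <->
  forall e : R, 0 < e -> exists2 d : R, 0 < d & forall y, `|x - y| < d -> `|f x - f y| < e.
Proof.
split=> [H e e0|H].
  have /rV_nbhsP[d d0 Hd] : nbhs x (f @^-1` ball (f x) e) by apply: H; exact: nbhsx_ballx.
  by exists d => // y /Hd.
move=> A /nbhs_ballP[e e0 He]; apply/rV_nbhsP.
by have [d d0 Hd] := H e e0; exists d => // y /Hd ?; exact: He.
Qed.
Lemma dotp_continuous n (v : 'rV[R]_n) : continuous (dotp v).
Proof.
move=> x; apply/rV_continuousP => e e0.
have S0 : 0 < 1 + \sum_i `|v 0 i| by rewrite ltr_pwDl// sumr_ge0.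
exists (e / (1 + \sum_i `|v 0 i|)); first exact: divr_gt0.
move=> y; rewrite ltr_pdivlMr// mulrC => H; rewrite -dotpBr.
by rewrite (le_lt_trans (dotp_le _ _))// (le_lt_trans _ H)// ler_wpM2r// lerDr.
Qed.

Definition cvx1 g := forall s t (a : R), 0 <= a -> a <= 1 ->
  g (a * s + (1 - a) * t) <= a * g s + (1 - a) * g t.

Variable (n : nat).
Implicit Types (f h : 'rV[R]_n -> R) (U : set 'rV[R]_n).
Lemma convex_onP U f : convex_on U f <-> forall x y (t : R), U x -> U y -> 0 <= t -> t <= 1 ->
  f (t *: x + (1 - t) *: y) <= t * f x + (1 - t) * f y.
Proof.
split=> [H x y t Ux Uy t0 t1|H t x y].
  exact: (H (Itv01 t0 t1) x y (mem_set Ux) (mem_set Uy)).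
rewrite !inE => Ux Uy. exact: H.
Qed.

Lemma convex_onD U f h : convex_on U f -> convex_on U h -> convex_on U (fun x => f x + h x).
Proof.
move=> /convex_onP cf /convex_onP ch; apply/convex_onP => x y t Ux Uy t0 t1.
by rewrite !mulrDr addrACA lerD ?cf ?ch.
Qed.
Lemma convex_onZ U f a : 0 <= a -> convex_on U f -> convex_on U (fun x => a * f x).
Proof.
move=> a0 /convex_onP cf; apply/convex_onP => x y t Ux Uy t0 t1.
by rewrite !(mulrCA _ a) -mulrDr ler_wpM2l ?cf.
Qed.
Lemma convex_on_max U f h : convex_on U f -> convex_on U h ->
  convex_on U (fun x => Num.max (f x) (h x)).
Proof.
move=> /convex_onP cf /convex_onP ch; apply/convex_onP => x y t Ux Uy t0 t1.
have t1' : 0 <= 1 - t by rewrite subr_ge0.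
rewrite ge_max; apply/andP; split.
  by rewrite (le_trans (cf _ _ _ Ux Uy t0 t1))// lerD// ler_wpM2l// le_max lexx.
by rewrite (le_trans (ch _ _ _ Ux Uy t0 t1))// lerD// ler_wpM2l// le_max lexx orbT.
Qed.
Lemma convex_on_cst U c : convex_on U (fun=> c).
Proof. by apply/convex_onP => x y t _ _ _ _; rewrite -mulrDl addrC subrK mul1r. Qed.
Lemma convex_on_sum U (I : Type) (r : seq I) (Q : pred I) (F : I -> 'rV[R]_n -> R) :
  (forall i, convex_on U (F i)) -> convex_on U (fun x => \sum_(i <- r | Q i) F i x).
Proof.
move=> H; elim: r => [|i r IH].
  by under eq_fun do rewrite big_nil; exact: convex_on_cst.
under eq_fun do rewrite big_cons; case: (Q i) => //; exact: convex_onD.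
Qed.
Lemma convex_on_ridge U g v : cvx1 g -> convex_on U (fun x => g (dotp v x)).
Proof.
by move=> cg; apply/convex_onP => x y t _ _ t0 t1; rewrite dotpDr !dotpZr; apply: cg.
Qed.
Lemma convex_on_affine U l : affine l -> convex_on U l.
Proof.
move=> [a [c H]]; apply/convex_onP => x y t _ _ t0 t1.
rewrite !H -!/(dotp _ _) dotpDr !dotpZr le_eqVlt; apply/orP; left; apply/eqP; ring.
Qed.
Lemma convex_onS U V f : V `<=` U -> convex_on U f -> convex_on V f.
Proof.
move=> VU /convex_onP cf; apply/convex_onP => x y t Vx Vy t0 t1; apply: cf => //; exact: VU.
Qed.
Lemma affine_dotp (a : 'rV[R]_n) c : affine (fun x => dotp a x + c).
Proof. by exists a, c. Qed.

Definition hinge (t : R) := Num.max t 0.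
Lemma cvx1_hinge tau b : 0 <= b -> cvx1 (fun t => b * hinge (t - tau)).
Proof.
move=> b0 s t a a0 a1; rewrite /hinge.
have a1' : 0 <= 1 - a by rewrite subr_ge0.
rewrite !(mulrCA _ b) -mulrDr ler_wpM2l//.
rewrite ge_max; apply/andP; split.
  apply: (@le_trans _ _ (a * (s - tau) + (1 - a) * (t - tau))); first by rewrite le_eqVlt; apply/orP; left; apply/eqP; ring.
  by rewrite lerD// ler_wpM2l// le_max lexx.
by rewrite addr_ge0// mulr_ge0// le_max lexx orbT.
Qed.
Lemma hinge_ge0 t : 0 <= hinge t.
Proof. by rewrite le_max lexx orbT. Qed.
Lemma hinge_pos t : 0 <= t -> hinge t = t.
Proof. by move=> t0; rewrite /hinge max_l. Qed.
Lemma hinge_neg t : t <= 0 -> hinge t = 0.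
Proof. by move=> t0; rewrite /hinge max_r. Qed.
Lemma hinge_lip s t : `|hinge s - hinge t| <= `|s - t|.
Proof.
rewrite /hinge; case: (leP s 0) => s0; case: (leP t 0) => t0; rewrite ?subrr ?normr0// ?subr0 ?sub0r.
- rewrite normrN gtr0_norm// ler0_norm; lra.
- rewrite gtr0_norm// ger0_norm; lra.
Qed.
Lemma hingeN t : hinge t = t + hinge (- t).
Proof. rewrite /hinge; case: (leP t 0) => t0; case: (leP (- t) 0) => ?; lra. Qed.
Lemma hingeM a t : 0 <= a -> hinge (a * t) = a * hinge t.
Proof.
move=> a0; rewrite /hinge; case: (leP t 0) => t0; first by rewrite max_r ?mulr0// mulr_ge0_le0.
by rewrite max_l// mulr_ge0// ltW.
Qed.

Lemma cvg_lu_cst U f : cvg_loc_unif U (fun=> f) f.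
Proof. by move=> K _ _ e e0; near=> k => x _; rewrite subrr normr0.
Unshelve. all: by end_near. Qed.
Lemma cvg_lu_eq U F f F' f' : (forall k x, U x -> F k x = F' k x) -> (forall x, U x -> f x = f' x) ->
  cvg_loc_unif U F f -> cvg_loc_unif U F' f'.
Proof.
move=> E E' H K cK KU e e0; apply: filterS (H K cK KU e e0) => k Hk x Kx.
by rewrite -E ?E'; [|exact: KU..]; rewrite -E' ?Hk//; exact: KU.
Qed.
Lemma cvg_luD U F G f h : cvg_loc_unif U F f -> cvg_loc_unif U G h ->
  cvg_loc_unif U (fun k x => F k x + G k x) (fun x => f x + h x).
Proof.
move=> HF HG K cK KU e e0.
have e2 : 0 < e / 2 by rewrite divr_gt0.
apply: filterS2 (HF K cK KU _ e2) (HG K cK KU _ e2) => k H1 H2 x Kx.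
rewrite opprD addrACA (le_lt_trans (ler_normD _ _))// [e]splitr ltrD ?H1 ?H2//.
Qed.
Lemma cvg_lu_sum U (I : Type) (r : seq I) (F : I -> nat -> 'rV[R]_n -> R) (f : I -> 'rV[R]_n -> R) :
  (forall i, cvg_loc_unif U (F i) (f i)) ->
  cvg_loc_unif U (fun k x => \sum_(i <- r) F i k x) (fun x => \sum_(i <- r) f i x).
Proof.
move=> H; elim: r => [|i r IH].
  by apply: cvg_lu_eq (@cvg_lu_cst U (fun=> 0)) => *; rewrite big_nil.
by apply: cvg_lu_eq (cvg_luD (H i) IH) => *; rewrite big_cons.
Qed.
Definition cvg_lu1 (G : nat -> R -> R) g := forall (M e : R), 0 < e ->
  \forall k \near \oo, forall t, `|t| <= M -> `|G k t - g t| < e.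
Lemma compact_norm_le (K : set 'rV[R]_n) : compact K -> exists M : R, 0 <= M /\ forall x, K x -> `|x| <= M.
Proof.
move=> /compact_bounded[M [_ H]]; exists (`|M| + 1); split; first by rewrite addr_ge0.
move=> x Kx; apply: H => //.
by rewrite (le_lt_trans (ler_norm M))// ltrDl.
Qed.
Lemma cvg_lu_ridge U G g v : cvg_lu1 G g ->
  cvg_loc_unif U (fun k x => G k (dotp v x)) (fun x => g (dotp v x)).
Proof.
move=> H K /compact_norm_le[M [M0 KM]] KU e e0.
apply: filterS (H ((\sum_i `|v 0 i|) * M) e e0) => k Hk x Kx; apply: Hk.
by rewrite (le_trans (dotp_le _ _))// ler_wpM2l ?KM// sumr_ge0.
Qed.
Lemma cvg_lu1Z G g (s : nat -> R) (a : R) : cvg_lu1 G g -> s @ \oo --> a ->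
  (forall M : R, exists C : R, forall t, `|t| <= M -> `|g t| <= C) ->
  cvg_lu1 (fun k t => s k * G k t) (fun t => a * g t).
Proof.
move=> HF Hs bf B e e0.
have [M HM] := bf B.
have M1 : 0 < `|M| + 1 by rewrite ltr_wpDl.
have a1 : 0 < `|a| + 1 by rewrite ltr_wpDl.
have d1 : 0 < e / 2 / (`|a| + 1) by rewrite !divr_gt0.
have d2 : 0 < e / 2 / (`|M| + 1) by rewrite !divr_gt0.
near=> k => x Kx.
have -> : s k * G k x - a * g x = s k * (G k x - g x) + (s k - a) * g x by ring.
rewrite (le_lt_trans (ler_normD _ _))// !normrM [e]splitr ltrD//.
  apply: (@le_lt_trans _ _ ((`|a| + 1) * `|G k x - g x|)).
    rewrite ler_wpM2r//; near: k.
    by apply: (cvgr_norm_le _ Hs); rewrite ltrDl.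
  rewrite mulrC -ltr_pdivlMr//.
  move: x Kx; near: k; exact: HF.
apply: (@le_lt_trans _ _ (`|s k - a| * (`|M| + 1))).
  by rewrite ler_wpM2l// (le_trans (HM _ Kx))// (le_trans (ler_norm M))// lerDl.
rewrite -ltr_pdivlMr//; near: k.
by move/cvgrPdistC_lt: Hs; apply.
Unshelve. all: by end_near. Qed.
End Convexity.

(** * Iterated integrals of compactly supported continuous functions *)

Section Integral1.
Variable R : realType.
Implicit Types (h : R -> R).
Definition int1 h : R := Rintegral (@lebesgue_measure R) setT h.
Definition vanish1 (B : R) h := forall t, B < `|t| -> h t = 0.

Lemma int1E h B : vanish1 B h -> int1 h = Rintegral (@lebesgue_measure R) `[- B, B] h.
Proof.
move=> hB; rewrite Rintegral_mkcond; congr Rintegral; apply/funext => t.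
rewrite patchE; case: ifPn => // /negP tB; apply: hB; rewrite ltNge ler_norml; apply/negP => H.
by apply: tB; rewrite inE /= in_itv.
Qed.
Lemma csupp_integrable h B : continuous h -> 
  (@lebesgue_measure R).-integrable `[- B, B] (EFin \o h).
Proof.
move=> ch; apply: continuous_compact_integrable; first exact: segment_compact.
exact: continuous_subspaceT.
Qed.
Lemma vanish1W (B B' : R) h : B <= B' -> vanish1 B h -> vanish1 B' h.
Proof. by move=> BB H t Bt; apply: H; exact: le_lt_trans Bt. Qed.
Lemma int1_lin B a b h k : continuous h -> continuous k -> vanish1 B h -> vanish1 B k ->
  int1 (fun t => a * h t + b * k t) = a * int1 h + b * int1 k.
Proof.
move=> ch ck hB kB.
rewrite (@int1E h B)// (@int1E k B)// (@int1E _ B); last by move=> t Bt; rewrite hB ?kB ?mulr0 ?addr0.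
rewrite RintegralD ?RintegralZl//.
- exact: csupp_integrable.
- exact: csupp_integrable.
- by apply: csupp_integrable => t; apply: cvgM; [exact: cvg_cst|exact: ch].
- by apply: csupp_integrable => t; apply: cvgM; [exact: cvg_cst|exact: ck].
Qed.
Lemma int1_ge0 h : (forall t, 0 <= h t) -> 0 <= int1 h.
Proof. by move=> H; apply: Rintegral_ge0. Qed.
Lemma int1_bound (B S : R) h : 0 <= B -> continuous h -> vanish1 B h -> (forall t, `|h t| <= S) ->
  `|int1 h| <= 2 * B * S.
Proof.
move=> B0 ch hB hS; rewrite (@int1E h B)//.
rewrite (le_trans (le_normr_Rintegral _ _))//; first exact: csupp_integrable.
apply: (@le_trans _ _ (Rintegral (@lebesgue_measure R) `[- B, B] (fun=> S))).
  apply: le_Rintegral => //.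
  - by apply: (@csupp_integrable (fun t => `|h t|)) => t; apply: cvg_norm; exact: ch.
  - by apply: (@csupp_integrable (fun t => S)) => t; exact: cvg_cst.
rewrite Rintegral_cst// (congr1 fine (@lebesgue_measure_itv R `[-B, B])) /= lte_fin.
case: ifPn => [|_] /=; last by rewrite mulr0 !mulr_ge0// (le_trans _ (hS 0)).
by move=> _; rewrite mulrC; apply: ler_wpM2r; [rewrite (le_trans _ (hS 0))| lra].
Qed.
Lemma int1_affine (B a b : R) h : 0 < a -> continuous h -> vanish1 B h ->
  int1 h = a * int1 (fun t => h (a * t + b)).
Proof.
move=> a0 ch hB.
(* With this [C], the image of [[- C, C]] under [F] contains [[- |B|, |B|]], hence all points where
   [h] is nonzero. *)
pose C := (`|B| + `|b|) / a.
have C0 : 0 <= C by rewrite divr_ge0// ?addr_ge0// ltW.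
pose F t := a * t + b.
have dF (t : R) : is_derive t 1 F a.
  rewrite /F; apply: is_derive_eq; last by rewrite addr0 scaler1.
have F'E : derive1 F = cst a by apply/funext => t; rewrite derive1E (@derive_val _ _ _ _ _ _ _ (dF t)).
have cF : continuous F by move=> t; apply/differentiable_continuous/derivable1_diffP; exact: (@ex_derive _ _ _ _ _ _ _ (dF t)).
rewrite (@int1E (fun t => h (a * t + b)) C); last first.
  move=> t Ct; apply: hB.
  have : a * C < `|a * t| by rewrite normrM gtr0_norm// ltr_pM2l.
  rewrite /C mulrC divfK ?gt_eqF// => H.
  have H1 := ler_normB (a * t + b) b; rewrite addrK in H1.
  have := ler_norm B; lra.
have -> : int1 h = Rintegral (@lebesgue_measure R) `[F (- C), F C] h.
  rewrite Rintegral_mkcond; congr Rintegral; apply/funext => t.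
  rewrite patchE; case: ifPn => // /negP tB; apply: hB; rewrite ltNge; apply/negP => H.
  have aC : a * C = `|B| + `|b| by rewrite /C mulrC divfK// gt_eqF.
  apply: tB; rewrite inE /= in_itv /= /F mulrN aC.
  have := ler_norm B; have := ler_norm b; have := ler_norm (- b); rewrite normrN.
  by move: H; rewrite ler_norml; lra.
rewrite /Rintegral (@integration_by_substitution_increasing R F h (- C) C); last 7 first.
- by lra.
- by move=> x y _ _ xy; rewrite /F ltrD2r ltr_pM2l.
- by rewrite F'E => x _; exact: cvg_cst.
- by rewrite F'E; exact: is_cvg_cst.
- by rewrite F'E; exact: is_cvg_cst.
- split; first by move=> x _; exact: (@ex_derive _ _ _ _ _ _ _ (dF x)).
    exact/cvg_at_right_filter/cF.
  exact/cvg_at_left_filter/cF.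
- exact: continuous_subspaceT.
rewrite F'E -!/(Rintegral _ _ _) -RintegralZl//.
  by congr fine; apply: eq_integral => t _ /=; rewrite mulrC.
apply: (@csupp_integrable (fun t => h (F t))) => t.
by apply: continuous_comp; [exact: cF|exact: ch].
Qed.
Lemma int1_FTC B h H : 0 < B -> continuous h -> vanish1 B h ->
  (forall t : R, is_derive t 1 H (h t)) -> int1 h = H B - H (- B).
Proof.
move=> B0 ch hB dH.
have cH : continuous H by move=> t; apply/differentiable_continuous/derivable1_diffP; exact: (@ex_derive _ _ _ _ _ _ _ (dH t)).
rewrite (@int1E h B)// /Rintegral (@continuous_FTC2 _ h H)//.
- by lra.
- exact: continuous_subspaceT.
- split; first by move=> x _; exact: (@ex_derive _ _ _ _ _ _ _ (dH x)).
    exact/cvg_at_right_filter/cH.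
  exact/cvg_at_left_filter/cH.
- by move=> t _; rewrite derive1E (@derive_val _ _ _ _ _ _ _ (dH t)).
Qed.
End Integral1.

Section IterInt.
Variable R : realType.
Lemma rV_contD n (f g : 'rV[R]_n -> R) : continuous f -> continuous g -> continuous (fun x => f x + g x).
Proof. by move=> cf cg y; exact: (@cvgD _ _ _ (nbhs y) _ f g _ _ (cf y) (cg y)). Qed.
Lemma rV_contM n (f g : 'rV[R]_n -> R) : continuous f -> continuous g -> continuous (fun x => f x * g x).
Proof. by move=> cf cg y; exact: (@cvgM _ _ (nbhs y) _ f g _ _ (cf y) (cg y)). Qed.
Lemma rV_contC n (g : R -> R) (f : 'rV[R]_n -> R) : continuous g -> continuous f -> continuous (fun x => g (f x)).
Proof. by move=> cg cf y; exact: (continuous_comp (cf y) (cg _)). Qed.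
Definition vanish m (B : R) (g : 'rV[R]_m -> R) := forall y, B < `|y| -> g y = 0.
Definition CC m (g : 'rV[R]_m -> R) := continuous g /\ exists2 B : R, 0 <= B & vanish B g.
Definition consv m (t : R) (y : 'rV[R]_m) : 'rV[R]_m.+1 := row_mx (t%:M : 'rV[R]_1) y.

Lemma consv0 m t (y : 'rV[R]_m) : consv t y 0 ord0 = t.
Proof.
have -> : ord0 = lshift m (ord0 : 'I_1) by apply/val_inj.
by rewrite /consv (row_mxEl (n1:=1)) mxE eqxx.
Qed.
Lemma consvS m t (y : 'rV[R]_m) i : consv t y 0 (lift ord0 i) = y 0 i.
Proof.
have -> : lift ord0 i = rshift 1 i by apply/val_inj.
by rewrite /consv (row_mxEr (n1:=1)).
Qed.
Lemma consv_norm m t (y : 'rV[R]_m) (M : R) : 0 <= M -> (`|consv t y| <= M) = (`|t| <= M) && (`|y| <= M).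
Proof.
move=> M0; apply/idP/andP => [H|[H1 H2]].
  split; first by rewrite -(consv0 t y) (le_trans (normrow_le _ _)).
  by apply: normrow_leP => // i; rewrite -(consvS t y) (le_trans (normrow_le _ _)).
apply: normrow_leP => // i; case: (unliftP ord0 i) => [j|] ->; rewrite ?consv0 ?consvS//.
exact: le_trans (normrow_le _ _) _.
Qed.
Lemma consvD m t s (y z : 'rV[R]_m) : consv t y + consv s z = consv (t + s) (y + z).
Proof. by rewrite /consv (add_row_mx (n1:=1)) raddfD. Qed.
Lemma consvB m t s (y z : 'rV[R]_m) : consv t y - consv s z = consv (t - s) (y - z).
Proof. by rewrite /consv (opp_row_mx (n1:=1)) (add_row_mx (n1:=1)) raddfB. Qed.
Lemma consvE m (z : 'rV[R]_m.+1) : exists t y, z = consv t y.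
Proof.
exists ((lsubmx (z : 'rV_(1 + m))) 0 0), (rsubmx (z : 'rV_(1 + m))).
by rewrite /consv -mx11_scalar hsubmxK.
Qed.
Lemma vanishW m (B B' : R) (h : 'rV[R]_m -> R) : B <= B' -> vanish B h -> vanish B' h.
Proof. by move=> BB H t Bt; apply: H; exact: le_lt_trans Bt. Qed.

Lemma CC_unif m (g : 'rV[R]_m -> R) (e : R) : CC g -> 0 < e ->
  exists2 d : R, 0 < d & forall x y, `|x - y| < d -> `|g x - g y| < e.
Proof.
move=> [cg [B B0 gB]] e0.
pose K : set 'rV[R]_m := [set y | `|y| <= B + 1].
have cK : compact K.
  apply: bounded_closed_compact.
    exists (B + 1); split => //; first by rewrite num_real.
    by move=> M BM y /= Ky; rewrite (le_trans Ky)// ltW.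
  rewrite /K; apply: (@preimage_closed _ _ (fun y : 'rV[R]_m => `|y|) [set t | t <= B + 1]); last exact: closed_le.
  by move=> y _; exact: norm_continuous.
(* The near-covering form of compactness, with the filter of small positive radii, turns the
   pointwise moduli into a uniform one. Two points outside [K] both give the value 0. *)
have := compact_near_coveringP K; case => /(_ cK) + _.
move=> /(_ R 0^'+ (fun d x => forall y, `|x - y| < d -> `|g x - g y| < e)) [].
  move=> x Kx.
  have e2 : 0 < e / 2 by rewrite divr_gt0.
  have /rV_continuousP/(_ _ e2)[d d0 Hd] := cg x.
  have d2 : 0 < d / 2 by rewrite divr_gt0.
  exists (ball x (d / 2), [set r | r < d / 2]) => /=.
    split; first exact: nbhsx_ballx.
    exact: nbhs_right_lt.
  move=> [x' r] /= []; rewrite mx_norm_ball /ball_ /= => xx' rd y xy.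
  have H1 : `|g x - g x'| < e / 2 by apply: Hd; lra.
  have H2 : `|g x - g y| < e / 2.
    apply: Hd; rewrite -(subrK x' x) -addrA (le_lt_trans (ler_normD _ _))//; lra.
  rewrite distrC in H1.
  by rewrite -(subrK (g x) (g x')) -addrA (le_lt_trans (ler_normD _ _))//; lra.
move=> d /= d0 H.
pose d' := Num.min (d / 2) 1.
have d'0 : 0 < d' by rewrite lt_min ltr01 divr_gt0.
exists d' => // x y xy.
have Kd z : K z -> forall w, `|z - w| < d' -> `|g z - g w| < e.
  move=> Kz w zw; apply: (H d') => //=.
  rewrite sub0r normrN gtr0_norm// /d' gt_min; apply/orP; left; lra.
have [xK|xK] := leP `|x| (B + 1); first exact: Kd.
have [yK|yK] := leP `|y| (B + 1); first by rewrite distrC; apply: Kd => //; rewrite distrC.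
by rewrite !gB ?subrr ?normr0//; lra.
Unshelve. all: by end_near. Qed.

Lemma CC_slice m (g : 'rV[R]_m.+1 -> R) t : CC g -> CC (fun y => g (consv t y)).
Proof.
move=> [cg [B B0 gB]]; split.
  move=> y; apply/rV_continuousP => e e0.
  have /rV_continuousP/(_ _ e0)[d d0 Hd] := cg (consv t y).
  exists d => // z yz; apply: Hd; rewrite consvB subrr.
  apply: normrow_lt => // i; case: (unliftP ord0 i) => [j|] ->; rewrite ?consv0 ?consvS ?normr0//.
  exact: le_lt_trans (normrow_le _ _) yz.
exists B => // y By; apply: gB; rewrite ltNge consv_norm// negb_and -!ltNge By orbT//.
Qed.

Lemma CC_vanishS m (g : 'rV[R]_m.+1 -> R) t (B : R) : 0 <= B -> vanish B g -> vanish B (fun y => g (consv t y)).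
Proof. by move=> B0 gB y By; apply: gB; rewrite ltNge consv_norm// negb_and -!ltNge By orbT//. Qed.

Lemma CC_lin m a b (g h : 'rV[R]_m -> R) : CC g -> CC h -> CC (fun y => a * g y + b * h y).
Proof.
move=> [cg [B B0 gB]] [ch [C C0 hC]]; split.
  by apply: rV_contD; apply: rV_contM => //; exact: cst_continuous.
exists (Num.max B C); first by rewrite le_max B0.
by move=> y; rewrite gt_max => /andP[? ?]; rewrite gB// hC// !mulr0 addr0.
Qed.

(** The bound and the linearity of [iint] have to be proved by one simultaneous induction on the
    dimension: linearity in dimension m+1 needs slices that are integrable, that is continuous in
    the first variable, and this continuity uses both properties in dimension m. Hence the two
    predicates, which the [_aux] lemmas take as hypotheses. *)
Definition iint_bnd m := forall (B S : R) (g : 'rV[R]_m -> R), 0 <= B -> continuous g ->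
  vanish B g -> (forall y, `|g y| <= S) -> `|iint g| <= (2 * B) ^+ m * S.
Definition iint_linear m := forall a b (g h : 'rV[R]_m -> R), CC g -> CC h ->
  iint (fun y => a * g y + b * h y) = a * iint g + b * iint h.

Lemma iint0_aux m : iint_linear m -> iint (fun _ : 'rV[R]_m => 0) = 0 :> R.
Proof.
move=> IHl; have C0 : CC (fun _ : 'rV[R]_m => 0) by split; [exact: cst_continuous|exists 0].
have := IHl 0 0 _ _ C0 C0; under eq_fun do rewrite !mul0r addr0.
by move=> ->; rewrite !mul0r addr0.
Qed.

Lemma slice_vanish_aux m (B : R) (g : 'rV[R]_m.+1 -> R) : iint_linear m -> 0 <= B ->
  vanish B g -> vanish1 B (fun t => iint (fun y => g (consv t y))).
Proof.
move=> IHl B0 gB t Bt; rewrite -[RHS](iint0_aux IHl); congr iint.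
apply/funext => y; apply: gB; rewrite ltNge consv_norm// negb_and -!ltNge Bt//.
Qed.

Lemma slice_continuous_aux m (g : 'rV[R]_m.+1 -> R) : iint_bnd m -> iint_linear m -> CC g ->
  continuous (fun t => iint (fun y => g (consv t y))).
Proof.
move=> IHb IHl Cg t; apply/cvgrPdist_lt => e e0.
have [B B0 gB] := Cg.2.
have c0 : 0 < (2 * B) ^+ m + 1 by rewrite ltr_wpDl// exprn_ge0// mulr_ge0.
have [d d0 Hd] := CC_unif Cg (divr_gt0 e0 c0).
near=> s.
have -> : iint (fun y => g (consv t y)) - iint (fun y => g (consv s y)) =
          iint (fun y => 1 * g (consv t y) + (- 1) * g (consv s y)).
  by rewrite IHl ?mul1r ?mulN1r//; exact: CC_slice.
have Cd : CC (fun y => 1 * g (consv t y) + (- 1) * g (consv s y)) by apply: CC_lin; exact: CC_slice.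
apply: (@le_lt_trans _ _ ((2 * B) ^+ m * (e / ((2 * B) ^+ m + 1)))).
  apply: IHb => //; first exact: Cd.1.
    move=> y yB; rewrite (CC_vanishS t B0 gB)// (CC_vanishS s B0 gB)// !mulr0 addr0//.
  move=> y; rewrite mul1r mulN1r ltW// Hd// consvB subrr.
  apply: normrow_lt => // i; case: (unliftP ord0 i) => [j|] ->; rewrite ?consv0 ?consvS ?mxE ?normr0//.
rewrite mulrCA gtr_pMr// ltr_pdivrMr// mul1r ltrDl//.
Unshelve. all: by end_near. Qed.

Lemma iint_all m : iint_bnd m /\ iint_linear m.
Proof.
elim: m => [|m [IHb IHl]].
  split=> [B S g _ _ _ gS|a b g h _ _] //=.
  by rewrite expr0 mul1r.
split=> [B S g B0 cg gB gS|a b g h Cg Ch].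
  have Cg : CC g by split => //; exists B.
  rewrite /= -/(int1 _) exprS -mulrA.
  apply: int1_bound => //; [exact: slice_continuous_aux|exact: slice_vanish_aux|].
  move=> t; apply: IHb => //; first exact: (CC_slice t Cg).1.
  exact: CC_vanishS.
have [B B0 gB] := Cg.2; have [C C0 hC] := Ch.2.
rewrite /= -!/(int1 _) -(@int1_lin _ (Num.max B C)).
- congr int1; apply/funext => t; apply: IHl; exact: (CC_slice t).
- exact: (slice_continuous_aux IHb IHl Cg).
- exact: (slice_continuous_aux IHb IHl Ch).
- by apply: (@vanish1W _ B); [rewrite le_max lexx|exact: slice_vanish_aux].
- by apply: (@vanish1W _ C); [rewrite le_max lexx orbT|exact: slice_vanish_aux].
Qed.

Lemma iint_lin m a b (g h : 'rV[R]_m -> R) : CC g -> CC h ->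
  iint (fun y => a * g y + b * h y) = a * iint g + b * iint h.
Proof. exact: (iint_all m).2. Qed.
Lemma iintS m (g : 'rV[R]_m.+1 -> R) : iint g = int1 (fun t => iint (fun y => g (consv t y))).
Proof. by []. Qed.
Lemma slice_continuous m (g : 'rV[R]_m.+1 -> R) : CC g ->
  continuous (fun t => iint (fun y => g (consv t y))).
Proof. exact: (slice_continuous_aux (iint_all m).1 (iint_all m).2). Qed.
Lemma slice_vanish m (B : R) (g : 'rV[R]_m.+1 -> R) : 0 <= B ->
  vanish B g -> vanish1 B (fun t => iint (fun y => g (consv t y))).
Proof. exact: (slice_vanish_aux (iint_all m).2). Qed.

Lemma iint_ge0 m (g : 'rV[R]_m -> R) : (forall y, 0 <= g y) -> 0 <= iint g.
Proof.
elim: m g => [|m IH] g g0; first exact: g0.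
by rewrite iintS; apply: int1_ge0 => t; exact: IH.
Qed.

Lemma CC_shift m (g : 'rV[R]_m -> R) z : CC g -> CC (fun y => g (y + z)).
Proof.
move=> [cg [B B0 gB]]; split.
  move=> y; apply/rV_continuousP => e e0.
  have /rV_continuousP/(_ _ e0)[d d0 Hd] := cg (y + z).
  by exists d => // w yw; apply: Hd; rewrite opprD addrACA subrr addr0.
exists (B + `|z|); first by rewrite addr_ge0.
move=> y By; apply: gB; rewrite -(ltrD2r `|z|) (lt_le_trans By)//.
by rewrite -{1}(addrK z y) (le_trans (ler_normD _ _))// normrN.
Qed.

Lemma iint_shift m (g : 'rV[R]_m -> R) z : CC g -> iint (fun y => g (y + z)) = iint g.
Proof.
elim: m g z => [|m IH] g z Cg; first by rewrite /= (_ : 0 + z = 0)//; apply/rowP => -[].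
have [s [z' ->]] := consvE z.
have [B B0 gB] := Cg.2.
rewrite !iintS [RHS](@int1_affine _ B 1 s)//; last 2 first.
- exact: slice_continuous.
- exact: slice_vanish.
rewrite mul1r; congr int1; apply/funext => t; rewrite mul1r.
under eq_fun do rewrite consvD.
exact: (IH (fun y => g (consv (t + s) y)) z' (CC_slice _ Cg)).
Qed.

Lemma coord_continuousR m (i : 'I_m) : continuous (fun y : 'rV[R]_m => y 0 i).
Proof. by under eq_fun do rewrite -dotp_delta; exact: dotp_continuous. Qed.
Lemma rV_cont_prod m (I : Type) (r : seq I) (F : I -> 'rV[R]_m -> R) :
  (forall i, continuous (F i)) -> continuous (fun y => \prod_(i <- r) F i y).
Proof.
move=> H; elim: r => [|i r IH].
  by under eq_fun do rewrite big_nil; exact: cst_continuous.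
by under eq_fun do rewrite big_cons; exact: rV_contM.
Qed.
Lemma rV_cont_sum m (I : Type) (r : seq I) (F : I -> 'rV[R]_m -> R) :
  (forall i, continuous (F i)) -> continuous (fun y => \sum_(i <- r) F i y).
Proof.
move=> H; elim: r => [|i r IH].
  by under eq_fun do rewrite big_nil; exact: cst_continuous.
by under eq_fun do rewrite big_cons; exact: rV_contD.
Qed.
Lemma CC_tensor m (h : 'I_m -> R -> R) (B : R) : 0 <= B ->
  (forall i, continuous (h i)) -> (forall i, vanish1 B (h i)) ->
  CC (fun y => \prod_(i < m) h i (y 0 i)).
Proof.
move=> B0 ch hB; split.
  by apply: rV_cont_prod => i; apply: rV_contC => //; exact: coord_continuousR.
exists B => // y By.
have [i yi] : exists i, B < `|y 0 i|.
  apply: contrapT => /forallNP H; move: By; rewrite ltNge => /negP; apply.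
  by apply: normrow_leP => // i; rewrite leNgt; apply/negP; exact: H.
by apply/eqP/prodf_eq0; exists i => //; apply/eqP/hB.
Qed.
Lemma iint_tensor m (h : 'I_m -> R -> R) (B : R) : 0 <= B ->
  (forall i, continuous (h i)) -> (forall i, vanish1 B (h i)) ->
  iint (fun y : 'rV[R]_m => \prod_(i < m) h i (y 0 i)) = \prod_(i < m) int1 (h i).
Proof.
move=> B0; elim: m h => [|m IH] h ch hB; first by rewrite /= !big_ord0.
rewrite iintS big_ord_recl -(IH (fun i => h (lift ord0 i)))//.
set c := iint _; rewrite mulrC.
have := @int1_lin R B c 0 (h ord0) (h ord0) (ch _) (ch _) (hB _) (hB _).
rewrite mul0r addr0 => <-; congr int1; apply/funext => t.
have C1 : CC (fun y : 'rV[R]_m => \prod_(i < m) h (lift ord0 i) (y 0 i)).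
  by apply: (@CC_tensor _ (fun i => h (lift ord0 i)) B).
have := @iint_lin _ (h ord0 t) 0 _ _ C1 C1; rewrite !mul0r !addr0 mulrC => <-.
congr iint; apply/funext => y; rewrite big_ord_recl consv0 mul0r addr0; congr (_ * _).
by apply: eq_bigr => i _; rewrite consvS.
Qed.

Lemma mulmx_bound m p (A : 'M[R]_(m, p)) : exists2 M : R, 0 < M & forall y : 'rV_m, `|y *m A| <= M * `|y|.
Proof.
exists (1 + \sum_i \sum_j `|A i j|); first by rewrite ltr_pwDl// sumr_ge0// => i _; rewrite sumr_ge0.
move=> y; apply: normrow_leP => [|j].
  by rewrite mulr_ge0// addr_ge0// sumr_ge0// => i _; rewrite sumr_ge0.
rewrite mxE (le_trans (ler_norm_sum _ _ _))// mulrDl mul1r (@le_trans _ _ (\sum_i `|y 0 i| * `|A i j|))//.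
  by apply: ler_sum => i _; rewrite normrM.
rewrite ler_wpDl// mulr_suml ler_sum// => i _.
rewrite mulrC ler_pM// ?normrow_le//.
by rewrite (bigD1 j)//= lerDl sumr_ge0.
Qed.

Lemma CC_mulmx m (g : 'rV[R]_m -> R) (A : 'M[R]_m) : A \in unitmx -> CC g -> CC (fun y => g (y *m A)).
Proof.
move=> uA [cg [B B0 gB]]; split.
  move=> y; apply/rV_continuousP => e e0.
  have /rV_continuousP/(_ _ e0)[d d0 Hd] := cg (y *m A).
  have [M M0 HM] := mulmx_bound A.
  exists (d / M); first exact: divr_gt0.
  by move=> w; rewrite ltr_pdivlMr// mulrC => yw; apply: Hd; rewrite -mulmxBl (le_lt_trans (HM _)).
have [M M0 HM] := mulmx_bound (invmx A).
exists (M * B); first by rewrite mulr_ge0// ltW.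
move=> y yB; apply: gB; rewrite -(ltr_pM2l M0) (lt_le_trans yB)//.
by rewrite -{1}(mulmxK uA y).
Qed.
End IterInt.

(** * Cubic-spline smoothing of the hinge function *)

Section Spline.
Variable R : realType.
Implicit Types (G g : R -> R) (t h e : R).

(** A quadratic remainder bound can be checked by cases on the signs of the arguments, so the
    piecewise polynomial splines are differentiated at their knots without gluing one-sided
    derivatives. *)
Lemma is_derive_quad G t (d C : R) :
  (forall h, `|h| <= 1 -> `|G (t + h) - G t - h * d| <= C * h ^+ 2) -> is_derive t 1 G d.
Proof.
move=> H.
suff cv : (fun h => h^-1 *: ((G \o shift t) (h *: 1) - G t)) @ 0^' --> d.
  by apply: DeriveDef; [apply/cvg_ex; exists d|exact: cvg_lim].
apply/cvgrPdist_lt => e e0; near=> h.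
have h0 : h != 0 by near: h; exact: nbhs_dnbhs_neq.
have h1 : `|h| < Num.min 1 (e / (`|C| + 1)).
  near: h; apply: (@dnbhs0_lt R R); rewrite lt_min ltr01 divr_gt0// ltr_wpDl//.
move: h1; rewrite lt_min => /andP[h1]; rewrite ltr_pdivlMr ?ltr_wpDl// => hC.
rewrite /= [h *: 1]mulr1 [h + t]addrC -normrN opprB.
rewrite -[X in `|_ - X|](mulKf h0) -mulrBr normrM normfV.
rewrite mulrC ltr_pdivrMr ?normr_gt0//.
rewrite (le_lt_trans (H _ (ltW h1)))// -real_normK ?num_real// expr2 mulrA ltr_pM2r ?normr_gt0//.
by rewrite (le_lt_trans _ hC)// mulrC ler_wpM2l//; have := ler_norm C; lra.
Unshelve. all: by end_near. Qed.

(* [shinge e] is a second difference of the cubic spline [spl3]; it is C^2, agrees with [hinge] outside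
   [[- e, e]], and its second derivative [rho e] is a hat function of integral 1. *)
Definition spl2 t := (hinge t) ^+ 2 / 2.
Definition spl3 t := (hinge t) ^+ 3 / 6.

Lemma hinge_cases t : (0 <= t /\ hinge t = t) \/ (t <= 0 /\ hinge t = 0).
Proof.
by case: (leP t 0) => [t0|/ltW t0]; [right; rewrite hinge_neg|left; rewrite hinge_pos].
Qed.

Lemma is_derive_spl2 t : is_derive t 1 spl2 (hinge t).
Proof.
apply: (@is_derive_quad _ _ _ 1) => h _; rewrite /spl2 ler_norml.
by case: (hinge_cases (t + h)) => -[? ->]; case: (hinge_cases t) => -[? ->]; apply/andP; split; nra.
Qed.

Lemma is_derive_spl3 t : is_derive t 1 spl3 (spl2 t).
Proof.
(* Away from the knot the remainder is h^2 (t/2 + h/6), which |h| <= 1 bounds by (|t| + 1) h^2; the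
   remaining cases straddle the knot or give 0. *)
apply: (@is_derive_quad _ _ _ (`|t| + 1)) => h; rewrite /spl2 /spl3 ler_norml => /andP[h1 h2].
have := ler_norm t; have := ler_norm (- t); rewrite normrN ler_norml.
set a := `|t|; move=> a1 a2.
have hh : 0 <= h ^+ 2 by rewrite sqr_ge0.
case: (hinge_cases (t + h)) => -[k1 ->]; case: (hinge_cases t) => -[k2 ->].
- apply/andP; split; rewrite -subr_ge0.
    rewrite (_ : _ - _ = h ^+ 2 * (t / 2 + h / 6 + (a + 1))); last by field.
    by rewrite mulr_ge0//; lra.
  rewrite (_ : _ - _ = h ^+ 2 * ((a + 1) - (t / 2 + h / 6))); last by field.
  by rewrite mulr_ge0//; lra.
- have q0 : 0 <= (t + h) ^+ 3 by rewrite exprn_ge0.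
  have q1 : (t + h) ^+ 3 <= h ^+ 3 by rewrite lerXn2r ?nnegrE//; lra.
  have q2 : h ^+ 3 <= h ^+ 2 by rewrite exprS ler_piMl//; lra.
  have q3 : h ^+ 2 <= (a + 1) * h ^+ 2 by rewrite ler_peMl//; lra.
  by apply/andP; split; lra.
- have q : 0 ^+ 3 / 6 - t ^+ 3 / 6 - h * (t ^+ 2 / 2) = t ^+ 2 * (- (t + 3 * h)/ 6) by field.
  have t2 : 0 <= t ^+ 2 by rewrite sqr_ge0.
  have t2h : t ^+ 2 <= h ^+ 2.
    by rewrite -[leRHS]sqrrN lerXn2r ?nnegrE//; lra.
  have w1 : 0 <= - (t + 3 * h) by lra.
  have w2 : - (t + 3 * h) / 6 <= 1 by lra.
  have q1 : t ^+ 2 * (- (t + 3 * h)/ 6) <= t ^+ 2 by rewrite ler_piMr//.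
  have q0 : 0 <= t ^+ 2 * (- (t + 3 * h)/ 6) by rewrite mulr_ge0// divr_ge0.
  have q3 : h ^+ 2 <= (a + 1) * h ^+ 2 by rewrite ler_peMl//; lra.
  rewrite q; apply/andP; split; lra.
- have q3 : 0 <= (a + 1) * h ^+ 2 by rewrite mulr_ge0//; lra.
  by rewrite !expr0n/= !mul0r mulr0 !subr0; apply/andP; split; lra.
Qed.

Definition D2 e G t := (G (t + e) - 2 * G t + G (t - e)) / e ^+ 2.

Lemma is_derive_D2 e G G' t : (forall t, is_derive t 1 G (G' t)) -> is_derive t 1 (D2 e G) (D2 e G' t).
Proof.
move=> dG.
have sh a : is_derive t 1 (fun s => G (s + a)) (G' (t + a)).
  have := @is_derive1_comp R G (fun s => s + a) t (G' (t + a)) 1 (dG _) (is_derive_shift _ _ _).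
  by rewrite mulr1.
rewrite (_ : D2 e G = (e ^+ 2)^-1 \*: ((fun s => G (s + e)) - 2 \*: G + (fun s => G (s - e)))); last first.
  by apply/funext => s; rewrite /D2 mulrC.
have H := is_deriveZ (e ^+ 2)^-1 (is_deriveD (is_deriveB (sh e) (is_deriveZ 2 (dG t))) (sh (- e))).
apply: (is_derive_eq H).
by rewrite /D2 mulrC.
Qed.

Definition shinge e := D2 e spl3.
Definition shinge' e := D2 e spl2.
Definition rho e := D2 e (@hinge R).

Lemma is_derive_shinge e t : is_derive t 1 (shinge e) (shinge' e t).
Proof. apply: is_derive_D2; exact: is_derive_spl3. Qed.
Lemma is_derive_shinge' e t : is_derive t 1 (shinge' e) (rho e t).
Proof. apply: is_derive_D2; exact: is_derive_spl2. Qed.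
Lemma rho_ge0 e t : 0 < e -> 0 <= rho e t.
Proof.
move=> e0; rewrite /rho /D2 divr_ge0 ?sqr_ge0//.
case: (hinge_cases (t + e)) => -[k1 ->]; case: (hinge_cases t) => -[k2 ->]; case: (hinge_cases (t - e)) => -[k3 ->]; lra.
Qed.
Lemma rho_out e t : 0 < e -> e <= `|t| -> rho e t = 0.
Proof.
move=> e0; rewrite /rho /D2 ler_normr => H.
rewrite (_ : _ + _ = 0) ?mul0r//.
case: (hinge_cases (t + e)) => -[k1 ->]; case: (hinge_cases t) => -[k2 ->]; case: (hinge_cases (t - e)) => -[k3 ->]; case/orP: H => ?; lra.
Qed.
Lemma rho_vanish e : 0 < e -> vanish1 e (rho e).
Proof. by move=> e0 t /ltW; exact: rho_out. Qed.
Lemma hinge_continuous : continuous (@hinge R).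
Proof.
move=> t; apply/cvgrPdist_lt => e e0; near=> s.
by rewrite (le_lt_trans (hinge_lip _ _)).
Unshelve. all: by end_near. Qed.
Lemma rho_continuous e : continuous (rho e).
Proof.
move=> t; apply: cvgM; last exact: cvg_cst.
have sh a : hinge (s + a) @[s --> t] --> hinge (t + a).
  apply: (@continuous_comp _ _ _ (fun s => s + a) (@hinge R)); last exact: hinge_continuous.
  by apply: cvgD; [exact: cvg_id|exact: cvg_cst].
apply: cvgD; last exact: sh.
apply: cvgB; first exact: sh.
by apply: cvgM; [exact: cvg_cst|exact: hinge_continuous].
Qed.
Lemma shinge_out e t : 0 < e -> e <= `|t| -> shinge e t = hinge t.
Proof.
move=> e0; rewrite /shinge /D2 /spl3 ler_normr => H.
have e1 : e != 0 by rewrite gt_eqF.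
case/orP: H => H.
  by rewrite !hinge_pos//; [field|lra..].
by rewrite !hinge_neg//; [field|lra..].
Qed.
Lemma shinge_near e t : 0 < e -> `|shinge e t - hinge t| <= 3 * e.
Proof.
move=> e0; have [/(shinge_out e0) ->|] := leP e `|t|; first by rewrite subrr normr0; lra.
rewrite ltr_norml => /andP[t1 t2].
have h1 : 0 <= hinge t <= e by rewrite hinge_ge0 ge_max; lra.
have a1 : 0 <= hinge (t + e) <= 2 * e by rewrite hinge_ge0 ge_max; lra.
rewrite /shinge /D2 /spl3 [hinge (t - e)]hinge_neg ?expr0n/= ?mul0r ?addr0; last lra.
have q1 : 0 <= hinge (t + e) ^+ 3 <= 8 * e ^+ 3.
  rewrite exprn_ge0 ?hinge_ge0//= (_ : 8 * e ^+ 3 = (2 * e) ^+ 3); last by ring.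
  by rewrite lerXn2r ?nnegrE ?hinge_ge0//; lra.
have q2 : 0 <= hinge t ^+ 3 <= e ^+ 3.
  by rewrite exprn_ge0 ?hinge_ge0//= lerXn2r ?nnegrE ?hinge_ge0//; lra.
set A := hinge (t + e) ^+ 3 in q1 *; set B := hinge t ^+ 3 in q2 *.
have e2 : 0 < e ^+ 2 by rewrite exprn_gt0.
have q : - (1 / 3) * e <= (A / 6 - 2 * (B / 6)) / e ^+ 2 <= (4 / 3) * e.
  have e3 : e ^+ 3 = e * e ^+ 2 by rewrite exprS.
  by move: q1 q2; rewrite e3 ler_pdivlMr// ler_pdivrMr// => /andP[? ?] /andP[? ?]; apply/andP; split; lra.
rewrite ler_norml; lra.
Qed.

Lemma int1_rho e : 0 < e -> int1 (rho e) = 1.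
Proof.
move=> e0; rewrite (int1_FTC e0 (rho_continuous (e := e)) (rho_vanish e0) (is_derive_shinge' e)).
rewrite /shinge' /D2 /spl2.
rewrite (hinge_pos (_ : 0 <= e + e)) ?(hinge_pos (_ : 0 <= e)) ?subrr ?hinge_neg//; try lra.
by field; rewrite gt_eqF.
Qed.

Lemma cvx1_deriv2 G G' G'' : (forall t, is_derive t 1 G (G' t)) ->
  (forall t, is_derive t 1 G' (G'' t)) -> (forall t, 0 <= G'' t) -> cvx1 G.
Proof.
move=> d1 d2 G0.
have DE : derive G ^~ 1 = G' by apply/funext => t; rewrite (@derive_val _ _ _ _ _ _ _ (d1 t)).
have cG : continuous G by move=> t; apply/differentiable_continuous/derivable1_diffP; exact: (@ex_derive _ _ _ _ _ _ _ (d1 t)).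
have main s t (a : R) : s <= t -> 0 <= a -> a <= 1 -> G (a * s + (1 - a) * t) <= a * G s + (1 - a) * G t.
  move=> st a0 a1.
  apply: (@second_derivative_convex R G s t _ _ _ _ _ (Itv01 a0 a1) st).
  - by move=> x _; rewrite DE (@derive_val _ _ _ _ _ _ _ (d2 x)).
  - exact/cvg_at_left_filter/cG.
  - exact/cvg_at_right_filter/cG.
  - by move=> x _; exact: (@ex_derive _ _ _ _ _ _ _ (d1 x)).
  - by move=> x _; rewrite DE; exact: (@ex_derive _ _ _ _ _ _ _ (d2 x)).
move=> s t a a0 a1; have [st|/ltW ts] := leP s t; first exact: main.
by rewrite addrC [X in _ <= X]addrC; have := main t s (1 - a) ts; rewrite subKr; apply; lra.
Qed.
Lemma cvx1_shinge e : 0 < e -> cvx1 (shinge e).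
Proof.
move=> e0; apply: (cvx1_deriv2 (is_derive_shinge e) (is_derive_shinge' e)) => t.
exact: rho_ge0.
Qed.
End Spline.

(** * Shears, dilations and elimination *)

Section RowOps.
Variables (F : fieldType) (n : nat).
Implicit Types (V : 'M[F]_n) (i j k : 'I_n).
Definition shear i j (s : F) : 'M[F]_n := 1%:M + s *: delta_mx i j.
Definition dilate i (c : F) : 'M[F]_n := 1%:M + (c - 1) *: delta_mx i i.

Lemma delta_mulmx V i j k l : (delta_mx i j *m V) k l = (k == i)%:R * V j l.
Proof.
rewrite mxE (bigD1 j)//= big1 ?addr0; last by move=> m mj; rewrite mxE (negbTE mj) andbF mul0r.
by rewrite mxE eqxx andbT.
Qed.
Lemma shearE V i j s k l : (shear i j s *m V) k l = V k l + (k == i)%:R * (s * V j l).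
Proof. by rewrite mulmxDl mul1mx -scalemxAl [LHS]mxE; congr (_ + _); rewrite mxE delta_mulmx mulrCA. Qed.
Lemma dilateE V i c k l : (dilate i c *m V) k l = (if k == i then c else 1) * V k l.
Proof.
rewrite mulmxDl mul1mx -scalemxAl [LHS]mxE [X in _ + X]mxE delta_mulmx; case: eqVneq => [->|_].
  by rewrite mul1r mulrBl mul1r addrCA subrr addr0.
by rewrite mul0r mulr0 addr0 mul1r.
Qed.
Lemma shearK i j s : i != j -> shear i j (- s) *m shear i j s = 1%:M.
Proof.
move=> ij; apply/matrixP => k l; rewrite shearE !mxE.
by rewrite [j == i]eq_sym [l == j]eq_sym (negbTE ij) /= mulr0 addr0; case: (k == i); case: (k == l); case: (j == l) => /=; ring.
Qed.
Lemma dilateK i c : c != 0 -> dilate i c^-1 *m dilate i c = 1%:M.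
Proof.
move=> c0; apply/matrixP => k l; rewrite dilateE !mxE; case: (eqVneq k i) => [->|_] /=; last by rewrite mulr0 addr0 mul1r.
by case: (eqVneq i l) => _ /=; field.
Qed.
Lemma shear_unit i j s : i != j -> shear i j s \in unitmx.
Proof. by move=> ij; have := shearK s ij => /mulmx1_unit[]. Qed.
Lemma dilate_unit i c : c != 0 -> dilate i c \in unitmx.
Proof. by move=> ij; have := dilateK i ij => /mulmx1_unit[]. Qed.
Lemma det_shear V i j s : i != j -> \det (shear i j s *m V) = \det V.
Proof.
move=> ij; pose C : 'M[F]_n := \matrix_(k, l) if k == i then V j l else V k l.
have -> : \det (shear i j s *m V) = 1 * \det V + s * \det C.
  apply: (determinant_multilinear (i0 := i)).
  - by apply/rowP => l; rewrite mxE shearE !mxE eqxx !mul1r.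
  - by apply/matrixP => k l; rewrite [LHS]mxE [RHS]mxE shearE eq_sym (negbTE (neq_lift _ _)) mul0r addr0.
  - by apply/matrixP => k l; rewrite [RHS]mxE shearE !mxE eq_sym (negbTE (neq_lift _ _)) mul0r addr0.
suff -> : \det C = 0 by rewrite mulr0 addr0 mul1r.
apply: (determinant_alternate ij) => l.
by rewrite !mxE eqxx eq_sym (negbTE ij).
Qed.
Lemma det_dilate V i c : \det (dilate i c *m V) = c * \det V.
Proof.
have -> : \det (dilate i c *m V) = c * \det V + 0 * \det V.
  apply: (determinant_multilinear (i0 := i)).
  - by apply/rowP => l; rewrite mxE dilateE !mxE eqxx mul0r addr0.
  - by apply/matrixP => k l; rewrite [LHS]mxE [RHS]mxE dilateE eq_sym (negbTE (neq_lift _ _)) mul1r.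
  - by apply/matrixP => k l; rewrite [LHS]mxE [RHS]mxE dilateE eq_sym (negbTE (neq_lift _ _)) mul1r.
by rewrite mul0r addr0.
Qed.

(* Gauss-Jordan elimination, phrased as an induction principle. *)
Lemma unitmx_rowop_ind (Q : 'M[F]_n -> Prop) : Q 1%:M ->
  (forall V i j s, i != j -> V \in unitmx -> Q V -> Q (shear i j s *m V)) ->
  (forall V i c, c != 0 -> V \in unitmx -> Q V -> Q (dilate i c *m V)) ->
  forall V, V \in unitmx -> Q V.
Proof.
move=> Q1 Qs Qd.
(* The operations are invertible, so [Q] also passes from the reduced matrix back to the original;
   the proof can then reduce [V] to the identity. *)
have Qs' V i j s : i != j -> V \in unitmx -> Q (shear i j s *m V) -> Q V.
  move=> ij uV; rewrite -{2}[V]mul1mx -(shearK s ij) -mulmxA; apply: Qs => //.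
  by rewrite unitmx_mul shear_unit.
have Qd' V i c : c != 0 -> V \in unitmx -> Q (dilate i c *m V) -> Q V.
  move=> c0 uV; rewrite -{2}[V]mul1mx -(dilateK i c0) -mulmxA; apply: Qd => //.
    by rewrite invr_neq0.
  by rewrite unitmx_mul dilate_unit.
(* The first m columns already agree with those of the identity; the induction is on the number d of
   remaining columns. *)
suff main d : forall m, (m + d = n)%N -> forall V, V \in unitmx ->
    (forall i j, (j < m)%N -> V i j = (i == j)%:R) -> Q V.
  by move=> V uV; apply: (main n 0%N (add0n n)).
elim: d => [|d IH] m mn V uV idV.
  suff -> : V = 1%:M by [].
  by apply/matrixP => i j; rewrite idV ?mxE// -[m]addn0 mn ltn_ord.
have mltn : (m < n)%N by rewrite -mn addnS ltnS leq_addr.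
pose k : 'I_n := Ordinal mltn.
have step2 W : W \in unitmx -> (forall i j, (j < m)%N -> W i j = (i == j)%:R) -> W k k != 0 -> Q W.
  move=> uW idW Wkk.
  have kj j : (j < m)%N -> W k j = 0.
    by move=> jm; rewrite idW// (_ : k == j = false)//; apply/negbTE; rewrite neq_ltn /= jm orbT.
  apply: (Qd' _ k (W k k)^-1); rewrite ?invr_neq0//.
  set W1 := dilate _ _ *m W.
  have W1E i j : W1 i j = (if i == k then (W k k)^-1 else 1) * W i j by exact: dilateE.
  have W1kk : W1 k k = 1 by rewrite W1E eqxx mulVf.
  have W1kj j : (j < m)%N -> W1 k j = 0 by move=> jm; rewrite W1E (kj j)// mulr0.
  have idW1 i j : (j < m)%N -> W1 i j = (i == j)%:R.
    move=> jm; rewrite W1E; case: eqVneq => [->|_]; last by rewrite mul1r idW.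
    by rewrite -(idW k j jm) (kj j)// mulr0.
  have uW1 : W1 \in unitmx by rewrite unitmx_mul dilate_unit// invr_neq0.
  (* [E] is the product of the shears that clear column [k] in the rows listed in [r], except in the
     pivot row; [uniq r] ensures that each row is cleared once. *)
  suff elimr (r : seq 'I_n) : uniq r -> exists2 E : 'M[F]_n, (E *m W1) \in unitmx /\ (Q (E *m W1) -> Q W1) &
      forall i j, (E *m W1) i j = W1 i j - ((i \in r) && (i != k))%:R * (W1 i k * W1 k j).
    have [E [uE QE] EE] := elimr (enum 'I_n) (enum_uniq _).
    apply: QE; apply: (IH m.+1) => //; first by rewrite addSnnS.
    move=> i j; rewrite ltnS leq_eqVlt EE mem_enum /= => /orP[/eqP jm|jm].
      have -> : j = k by apply/val_inj.
      rewrite W1kk mulr1; case: eqVneq => [->|_]; first by rewrite W1kk mul0r subr0.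
      by rewrite mul1r subrr.
    by rewrite idW1// W1kj// !mulr0 subr0.
  elim: r => [_|i0 r IHr /= /andP[i0r ur]].
    by exists 1%:M; [rewrite mul1mx|move=> i j; rewrite mul1mx mul0r subr0].
  have [E [uE QE] EE] := IHr ur.
  have [i0k|i0k] := eqVneq i0 k.
    exists E => // i j; rewrite EE in_cons; case: (eqVneq i i0) => [->|//].
    by rewrite i0k eqxx /= andbF.
  exists (shear i0 k (- W1 i0 k) *m E); rewrite -mulmxA.
    split; first by rewrite unitmx_mul shear_unit.
    by move=> H; apply: QE; apply: Qs' H.
  move=> i j; rewrite shearE !EE eqxx andbF mul0r subr0 in_cons.
  case: (eqVneq i i0) => [->|_] /=; last by rewrite mul0r addr0.
  by rewrite (negbTE i0r) i0k /= mul1r mul0r subr0 mul1r mulNr.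
have [Vkk|Vkk] := eqVneq (V k k) 0; last exact: step2.
have [i [ki Vik]] : exists i : 'I_n, (m <= i)%N /\ V i k != 0.
  apply: contrapT => /forallNP H.
  have {}H (i : 'I_n) : (m <= i)%N -> V i k = 0.
    by move=> mi; apply/eqP; apply: contraT => Hi; case: (H i).
  (* If column [k] vanished from row m downwards, it would be a combination of the first m columns,
     which are standard; [w] is the resulting nonzero kernel vector. *)
  pose w : 'cV[F]_n := \col_j (if j == k then 1 else if (j < m)%N then - V j k else 0).
  have Vw : V *m w = 0.
    apply/colP => i; rewrite mxE (bigD1 k)//= !mxE eqxx mulr1.
    have [im|mi] := ltnP i m.
      rewrite (bigD1 i)//=; last by rewrite -val_eqE /= neq_ltn im.
      rewrite big1 ?addr0.
        have ik : i == k = false by apply/negbTE; rewrite -val_eqE /= neq_ltn im.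
        by rewrite [w i 0]mxE ik im [V i i]idV// eqxx mul1r subrr.
      move=> j /andP[jk ji]; rewrite mxE (negbTE jk); case: ifP => [jm|_]; last by rewrite mulr0.
      by rewrite idV// eq_sym (negbTE ji) mul0r.
    rewrite H// add0r big1// => j jk; rewrite mxE (negbTE jk); case: ifP => [jm|_]; last by rewrite mulr0.
    rewrite idV// (_ : i == j = false) ?mul0r//; apply/negbTE.
    by rewrite -val_eqE /= neq_ltn (leq_trans jm mi) orbT.
  have : w = 0 by rewrite -(mulKmx uV w) Vw mulmx0.
  by move=> /colP/(_ k); rewrite !mxE eqxx => /eqP; rewrite oner_eq0.
have ik : k != i by apply: contraNneq Vik => <-; rewrite Vkk.
(* Adding row [i] to row [k] creates the pivot, so a shear does the work of a row exchange; the
   first m columns are unchanged because row [i] vanishes there. *)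
apply: (Qs' _ k i 1 ik uV); apply: step2.
- by rewrite unitmx_mul shear_unit.
- move=> l j jm; rewrite shearE idV// mul1r [V i j]idV//.
  rewrite [i == j](_ : _ = false) ?mulr0 ?addr0//; apply/negbTE.
  by rewrite -val_eqE /= neq_ltn (leq_trans jm ki) orbT.
- by rewrite shearE Vkk eqxx add0r !mul1r.
Qed.
End RowOps.

(** * Linear change of variables *)

Section Haar.
Variable R : realType.

Definition hat : R -> R := rho 1.
(** The hat is a difference of two consecutive values of s |-> [hinge (s + 1) - hinge s], so the sum
    of its integer translates telescopes. *)
Lemma hatE t : hat t = (hinge (t + 1) - hinge t) - (hinge (t - 1 + 1) - hinge (t - 1)).
Proof. by rewrite /hat /rho /D2 expr1n divr1 subrK; ring. Qed.
Lemma hat_sum M t : `|t| <= M%:R -> \sum_(j < M.*2.+1) hat (t - (j%:R - M%:R)) = 1.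
Proof.
rewrite ler_norml => /andP[t1 t2].
pose D (s : R) := hinge (s + 1) - hinge s.
have -> : \sum_(j < M.*2.+1) hat (t - (j%:R - M%:R)) =
   \sum_(0 <= j < M.*2.+1) ((fun j => - D (t + M%:R - j%:R)) j.+1 - (fun j => - D (t + M%:R - j%:R)) j).
  rewrite big_mkord; apply: eq_bigr => j _; rewrite hatE /D -[j.+1%:R]natr1.
  rewrite (_ : t - (j%:R - M%:R) = t + M%:R - j%:R); last by ring.
  by rewrite (_ : t + M%:R - (j%:R + 1) = t + M%:R - j%:R - 1); [ring|ring].
rewrite telescope_sumr// /D -addnn -natr1 natrD.
rewrite !(@hinge_neg _ (_ - (_ + 1) + 1)) ?(@hinge_neg _ (_ - (_ + 1))); try lra.
by rewrite !hinge_pos; lra.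
Qed.
Lemma hat_vanish : vanish1 1 hat. Proof. exact: rho_vanish. Qed.
Lemma hat_continuous : continuous hat. Proof. exact: rho_continuous. Qed.
Lemma hat_ge0 t : 0 <= hat t. Proof. exact: rho_ge0. Qed.
Lemma hatN t : hat (- t) = hat t.
Proof.
rewrite /hat /rho /D2; congr (_ / _).
rewrite [hinge (- t + 1)]hingeN [hinge (- t)]hingeN [hinge (- t - 1)]hingeN.
by rewrite !opprD !opprK; ring.
Qed.
Lemma int1_hat_scale c : c != 0 -> int1 (fun t => hat (c * t)) = `|c|^-1.
Proof.
have pos d : 0 < d -> int1 (fun t => hat (d * t)) = d^-1.
  move=> d0; have := @int1_affine R 1 d 0 hat d0 hat_continuous hat_vanish.
  rewrite int1_rho//; under eq_fun do rewrite addr0.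
  by move=> /(congr1 (fun x => d^-1 * x)); rewrite mulr1 mulKf ?gt_eqF// => <-.
case/lt_total/orP => [c0|c0]; last by rewrite pos// gtr0_norm.
rewrite ltr0_norm// -pos ?oppr_gt0//; congr int1; apply/funext => t.
by rewrite mulNr hatN.
Qed.

Variable m : nat.
Implicit Types (g h : 'rV[R]_m -> R) (L : ('rV[R]_m -> R) -> R).
(* The translates of [lam N] along the lattice of mesh [1 / (N + 1)] form a partition of unity. *)
Definition lam (N : nat) (y : 'rV[R]_m) : R := \prod_(i < m) hat (N.+1%:R * y 0 i).
Lemma lam_ge0 N y : 0 <= lam N y.
Proof. by apply: prodr_ge0 => i _; exact: hat_ge0. Qed.
Lemma scaled_hat N : continuous (fun t : R => hat (N.+1%:R * t)) /\ vanish1 1 (fun t : R => hat (N.+1%:R * t)).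
Proof.
split.
  move=> t; apply: (@continuous_comp R R R (fun t : R => N.+1%:R * t) hat t); last exact: hat_continuous.
  by apply: cvgM; [exact: cvg_cst|exact: cvg_id].
move=> t t1; apply: hat_vanish; rewrite normrM ger0_norm// (lt_le_trans t1)// ler_peMl// ler1n//.
Qed.
Lemma CC_lam N : CC (lam N).
Proof.
have [c v] := scaled_hat N.
exact: (@CC_tensor _ _ (fun _ t => hat (N.+1%:R * t)) 1).
Qed.
Lemma lam_out N y : N.+1%:R^-1 <= `|y| -> lam N y = 0.
Proof.
move=> yN.
have [i yi] : exists i, N.+1%:R^-1 <= `|y 0 i|.
  apply: contrapT => /forallNP H; move: yN; rewrite leNgt => /negP; apply.
  by apply: normrow_lt => // i; rewrite ltNge; apply/negP; exact: H.
apply/eqP/prodf_eq0; exists i => //; apply/eqP/rho_out => //.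
by rewrite normrM ger0_norm// -ler_pdivrMl// mulr1.
Qed.

Definition gridpt N M (f : {ffun 'I_m -> 'I_M.*2.+1}) : 'rV[R]_m :=
  \row_i (((f i)%:R - M%:R) / N.+1%:R).

Lemma lam_sum N M y : N.+1%:R * `|y| <= M%:R ->
  \sum_(f : {ffun 'I_m -> 'I_M.*2.+1}) lam N (y - gridpt N f) = 1.
Proof.
move=> yM.
transitivity (\prod_(i < m) \sum_(j < M.*2.+1) hat (N.+1%:R * y 0 i - (j%:R - M%:R))).
  rewrite bigA_distr_bigA; apply: eq_bigr => f _; apply: eq_bigr => i _.
  by rewrite !mxE mulrBr; congr (hat (_ - _)); rewrite mulrC divfK// pnatr_eq0.
rewrite big1// => i _; apply: hat_sum.
by rewrite normrM ger0_norm// (le_trans _ yM)// ler_pM2l// normrow_le.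
Qed.

(* Positive translation-invariant functionals. *)
Record pti (L : ('rV[R]_m -> R) -> R) : Prop := {
  pti_lin : forall a b g h, CC g -> CC h -> L (fun y => a * g y + b * h y) = a * L g + b * L h;
  pti_ge0 : forall g, CC g -> (forall y, 0 <= g y) -> 0 <= L g;
  pti_shift : forall g z, CC g -> L (fun y => g (y + z)) = L g }.

Lemma CC0 : CC (fun _ : 'rV[R]_m => 0).
Proof. by split; [exact: cst_continuous|exists 0]. Qed.
Lemma CC_sum (I : Type) (r : seq I) (F : I -> 'rV[R]_m -> R) (a : I -> R) :
  (forall i, CC (F i)) -> CC (fun y => \sum_(i <- r) a i * F i y).
Proof.
move=> H; elim: r => [|i r IH].
  by under eq_fun do rewrite big_nil; exact: CC0.
under eq_fun do rewrite big_cons -[X in _ + X]mul1r; exact: CC_lin.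
Qed.
Lemma pti_sum L (I : Type) (r : seq I) (F : I -> 'rV[R]_m -> R) (a : I -> R) : pti L ->
  (forall i, CC (F i)) -> L (fun y => \sum_(i <- r) a i * F i y) = \sum_(i <- r) a i * L (F i).
Proof.
move=> pL H; elim: r => [|i r IH].
  under eq_fun do rewrite big_nil; rewrite big_nil.
  have := pti_lin pL 0 0 CC0 CC0; under eq_fun do rewrite !mul0r addr0.
  by move=> ->; rewrite !mul0r addr0.
under eq_fun do rewrite big_cons -[X in _ + X]mul1r.
by rewrite pti_lin//; [rewrite big_cons mul1r IH|exact: CC_sum].
Qed.
Lemma pti_le L g h : pti L -> CC g -> CC h -> (forall y, g y <= h y) -> L g <= L h.
Proof.
move=> pL cg ch gh; rewrite -subr_ge0.
have -> : L h - L g = L (fun y => 1 * h y + (-1) * g y) by rewrite pti_lin// mul1r mulN1r.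
apply: (pti_ge0 pL); first exact: CC_lin.
by move=> y; rewrite mul1r mulN1r subr_ge0.
Qed.

(** It is at least 1 on the ball of radius [B + 1], which contains the support of [g] and of its
    lattice approximation. By positivity, a uniform error [w] between the two costs at most
    [w * L (plateau B)]. *)
Definition plateau (B : R) (y : 'rV[R]_m) : R := hinge (B + 2 - `|y|).
Lemma CC_plateau B : 0 <= B -> CC (plateau B).
Proof.
move=> B0; split.
  apply: rV_contC; first exact: hinge_continuous.
  move=> y; apply/rV_continuousP => e e0; exists e => // z yz.
  rewrite (_ : _ - _ = `|z| - `|y|); last by ring.
  by rewrite distrC (le_lt_trans _ yz)// ler_dist_dist.
by exists (B + 2); [rewrite addr_ge0|move=> y yB; rewrite /plateau hinge_neg// subr_le0 ltW].
Qed.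
(** The partition of unity replaces [g] by a combination [S] of translates of [lam N] with
    coefficients the values of [g] at the lattice points. Translation invariance gives all
    translates the same [L]-value, so [L S] factors. *)
Lemma pti_approx L g (B w : R) N M : pti L -> CC g -> 0 <= B -> vanish B g -> 0 <= w ->
  (forall x y, `|x - y| < N.+1%:R^-1 -> `|g x - g y| <= w) -> N.+1%:R * (B + 1) <= M%:R ->
  `|L g - (\sum_(f : {ffun 'I_m -> 'I_M.*2.+1}) g (gridpt N f)) * L (lam N)| <= w * L (plateau B).
Proof.
move=> pL Cg B0 gB w0 gw NM.
have Cl f : CC (fun y => lam N (y - gridpt N f)) by exact: (@CC_shift _ _ (lam N) (- gridpt N f) (CC_lam N)).
pose S y := \sum_(f : {ffun 'I_m -> 'I_M.*2.+1}) g (gridpt N f) * lam N (y - gridpt N f).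
have CS : CC S by exact: CC_sum.
have LS : L S = (\sum_(f : {ffun 'I_m -> 'I_M.*2.+1}) g (gridpt N f)) * L (lam N).
  rewrite /S pti_sum// mulr_suml; apply: eq_bigr => f _; congr (_ * _).
  by rewrite pti_shift//; exact: CC_lam.
rewrite -LS.
have CP := CC_plateau B0.
have dP y : `|g y - S y| <= w * plateau B y.
  have [yB|yB] := leP `|y| (B + 1).
    have -> : g y - S y = \sum_(f : {ffun 'I_m -> 'I_M.*2.+1}) (g y - g (gridpt N f)) * lam N (y - gridpt N f).
      under [RHS]eq_bigr do rewrite mulrBl.
      rewrite [RHS]big_split /= sumrN -mulr_sumr lam_sum ?mulr1//.
      by rewrite (le_trans _ NM)// ler_wpM2l.
    rewrite (le_trans (ler_norm_sum _ _ _))//.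
    apply: (@le_trans _ _ (\sum_(f : {ffun 'I_m -> 'I_M.*2.+1}) w * lam N (y - gridpt N f))).
      apply: ler_sum => f _; rewrite normrM [X in _ * X]ger0_norm ?lam_ge0//.
      have [le|lt] := leP N.+1%:R^-1 `|y - gridpt N f|; first by rewrite lam_out// !mulr0.
      by rewrite ler_wpM2r ?lam_ge0// gw.
    rewrite -mulr_sumr lam_sum; last by rewrite (le_trans _ NM)// ler_wpM2l.
    by rewrite ler_wpM2l// /plateau hinge_pos; lra.
  rewrite gB; last by rewrite (lt_trans _ yB)// ltrDl.
  rewrite /S big1 ?subrr ?normr0 ?mulr_ge0 ?hinge_ge0// => f _.
  have [le|lt] := leP N.+1%:R^-1 `|y - gridpt N f|; first by rewrite lam_out// !mulr0.
  rewrite gB ?mul0r//.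
  have N1 : N.+1%:R^-1 <= 1 :> R by rewrite invf_le1 ?ltr0n// ler1n.
  rewrite -(ltrD2l 1) addrC (lt_le_trans yB)// -{1}(subrK (gridpt N f) y) (le_trans (ler_normD _ _))// lerD2r ltW//.
  exact: lt_le_trans lt N1.
have H1 : L (fun y => 1 * g y + (-1) * S y) <= L (fun y => w * plateau B y + 0 * g y).
  apply: pti_le => //; [exact: CC_lin|exact: CC_lin|].
  by move=> y; rewrite mul1r mulN1r mul0r addr0; have := dP y; rewrite ler_norml => /andP[].
have H2 : L (fun y => (-w) * plateau B y + 0 * g y) <= L (fun y => 1 * g y + (-1) * S y).
  apply: pti_le => //; [exact: CC_lin|exact: CC_lin|].
  by move=> y; rewrite mul1r mulN1r mul0r addr0 mulNr; have := dP y; rewrite ler_norml => /andP[].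
move: H1 H2; rewrite !pti_lin// !mul0r !addr0 mul1r mulN1r mulNr ler_norml => -> ->; done.
Qed.

(* Uniqueness of Haar measure: both functionals are limits of the same lattice sums, up to normalization. *)
Lemma pti_unique L1 L2 g h : pti L1 -> pti L2 -> CC g -> CC h -> L1 g * L2 h = L1 h * L2 g.
Proof.
move=> p1 p2 Cg Ch.
have [B1 B10 gB1] := Cg.2; have [B2 B20 hB2] := Ch.2.
pose B := Num.max B1 B2.
have B0 : 0 <= B by rewrite le_max B10.
have gB : vanish B g by apply: vanishW gB1; rewrite le_max lexx.
have hB : vanish B h by apply: vanishW hB2; rewrite le_max lexx orbT.
have P1 : 0 <= L1 (plateau B) by apply: pti_ge0 => //; [exact: CC_plateau|move=> y; exact: hinge_ge0].
have P2 : 0 <= L2 (plateau B) by apply: pti_ge0 => //; [exact: CC_plateau|move=> y; exact: hinge_ge0].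
set Q1 := L1 (plateau B) in P1 *; set Q2 := L2 (plateau B) in P2 *.
pose C := Q1 * (`|L2 h| + Q2) + Q2 * `|L1 g| + Q1 * (`|L2 g| + Q2) + Q2 * `|L1 h| + 1.
have C0 : 0 < C by rewrite /C ltr_wpDl// !addr_ge0// mulr_ge0// addr_ge0.
apply/eqP; rewrite -subr_eq0 -normr_le0; apply/ler_addgt0Pl => e e0; rewrite addr0.
pose w := Num.min 1 (e / C).
have w0 : 0 < w by rewrite lt_min ltr01 divr_gt0.
have w1 : w <= 1 by rewrite ge_min lexx.
have wC : w * C <= e by rewrite -ler_pdivlMr// ge_min lexx orbT.
have [d1 d10 H1] := CC_unif Cg w0; have [d2 d20 H2] := CC_unif Ch w0.
pose d := Num.min d1 d2.
have d0 : 0 < d by rewrite lt_min d10.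
have [N HN] : exists N : nat, N.+1%:R^-1 < d :> R.
  exists (Num.Def.archi_bound d^-1); rewrite invf_plt ?posrE ?ltr0n//.
  by rewrite (lt_trans (archi_boundP _))// ?invr_ge0 ?(ltW d0)// ltr_nat.
have [M HM] : exists M : nat, N.+1%:R * (B + 1) <= M%:R :> R.
  exists (Num.Def.archi_bound (N.+1%:R * (B + 1))); rewrite ltW// archi_boundP//.
  by rewrite mulr_ge0// addr_ge0.
have gw x y : `|x - y| < N.+1%:R^-1 -> `|g x - g y| <= w.
  by move=> xy; rewrite ltW// H1// (lt_trans xy)// (lt_le_trans HN)// ge_min lexx.
have hw x y : `|x - y| < N.+1%:R^-1 -> `|h x - h y| <= w.
  by move=> xy; rewrite ltW// H2// (lt_trans xy)// (lt_le_trans HN)// ge_min lexx orbT.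
have a1 := pti_approx p1 Cg B0 gB (ltW w0) gw HM.
have a2 := pti_approx p2 Cg B0 gB (ltW w0) gw HM.
have a3 := pti_approx p1 Ch B0 hB (ltW w0) hw HM.
have a4 := pti_approx p2 Ch B0 hB (ltW w0) hw HM.
rewrite -/Q1 -/Q2 in a1 a2 a3 a4.
move: a1 a2 a3 a4.
set Sg := \sum_f _; set Sh := \sum_f _; set l1 := L1 (lam N); set l2 := L2 (lam N).
set x1 := L1 g - _; set x2 := L2 g - _; set x3 := L1 h - _; set x4 := L2 h - _ => a1 a2 a3 a4.
(* Each value is a lattice sum times [l1] or [l2] plus an error [x1], ..., [x4]. The two main terms
   are both [Sg * Sh * l1 * l2] and cancel, so only terms containing an error survive; [C] bounds
   them per unit of [w]. *)
have -> : L1 g * L2 h - L1 h * L2 g =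
   (x1 * (L2 h - x4) + x4 * L1 g) - (x3 * (L2 g - x2) + x2 * L1 h) by rewrite /x1 /x2 /x3 /x4; ring.
have bd (x y u v q1 q2 : R) : 0 <= q1 -> 0 <= q2 -> `|x| <= w * q1 -> `|y| <= w * q2 ->
    `|x * (u - y) + y * v| <= w * (q1 * (`|u| + q2) + q2 * `|v|).
  move=> q10 q20 xq yq; rewrite [X in _ <= X]mulrDr (le_trans (ler_normD _ _))// lerD//.
    rewrite normrM mulrA ler_pM// (le_trans (ler_normB _ _))// lerD2l (le_trans yq)// ler_piMl//.
  by rewrite normrM mulrA ler_wpM2r.
rewrite (le_trans (ler_normB _ _))// (le_trans _ wC)//.
rewrite (le_trans (lerD (bd _ _ (L2 h) (L1 g) _ _ P1 P2 a1 a4) (bd _ _ (L2 g) (L1 h) _ _ P1 P2 a3 a2)))//.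
by rewrite -mulrDr ler_wpM2l ?(ltW w0)// /C; lra.
Qed.

Lemma pti_iint : pti (@iint R m).
Proof.
split; [by move=> *; exact: iint_lin|by move=> *; exact: iint_ge0|by move=> *; exact: iint_shift].
Qed.
Lemma pti_iint_mulmx (A : 'M[R]_m) : A \in unitmx -> pti (fun g => iint (fun y => g (y *m A))).
Proof.
move=> uA; split.
- move=> a b g h Cg Ch; exact: (iint_lin a b (CC_mulmx uA Cg) (CC_mulmx uA Ch)).
- by move=> g _ g0; exact: iint_ge0.
- move=> g z Cg; rewrite -[RHS](iint_shift (z *m invmx A) (CC_mulmx uA Cg)).
  by congr iint; apply/funext => y; rewrite mulmxDl mulmxKV.
Qed.
Lemma iint_lam0 : iint (lam 0) = 1.
Proof.
have [c v] := scaled_hat 0.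
rewrite (@iint_tensor _ _ (fun _ t => hat (1%:R * t)) 1)// big1// => i _.
by rewrite int1_hat_scale ?oner_eq0// normr1 invr1.
Qed.

(** The factor by which y |-> y A scales the integral, read off on [lam 0], whose integral is 1. It
    is multiplicative in [A], so it has to be computed only for shears and dilations. *)
Definition jac (A : 'M[R]_m) : R := iint (fun y => lam 0 (y *m A)).
Lemma iint_jac A g : A \in unitmx -> CC g -> iint (fun y => g (y *m A)) = jac A * iint g.
Proof.
move=> uA Cg; have := pti_unique (pti_iint_mulmx uA) pti_iint Cg (CC_lam 0).
by rewrite iint_lam0 mulr1.
Qed.
Lemma jacM A B : A \in unitmx -> B \in unitmx -> jac (A *m B) = jac A * jac B.
Proof.
move=> uA uB; rewrite {1}/jac; under eq_fun do rewrite mulmxA.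
by rewrite (@iint_jac A (fun y => lam 0 (y *m B)))//; exact: CC_mulmx (CC_lam 0).
Qed.
Lemma jac1 : jac 1%:M = 1.
Proof. by rewrite /jac; under eq_fun do rewrite mulmx1; rewrite iint_lam0. Qed.
Lemma jac_neq0 A : A \in unitmx -> jac A != 0.
Proof.
move=> uA; have : jac A * jac (invmx A) = 1 by rewrite -jacM ?unitmx_inv// mulmxV// jac1.
by move=> /eqP; apply: contraTneq => ->; rewrite mul0r eq_sym oner_eq0.
Qed.
Lemma jac_dilate i c : c != 0 -> jac (dilate i c) = `|c|^-1.
Proof.
move=> c0; rewrite /jac.
have dE (y : 'rV[R]_m) j : (y *m dilate i c) 0 j = (if j == i then c else 1) * y 0 j.
  rewrite mulmxDr mulmx1 -scalemxAr [LHS]mxE [X in _ + X]mxE.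
  rewrite [(y *m _) 0 j]mxE (bigD1 i)//= big1 ?addr0; last by move=> k ki; rewrite mxE (negbTE ki) mulr0.
  by rewrite mxE eqxx /=; case: eqVneq => [->|_] /=; ring.
pose hh (j : 'I_m) (t : R) := hat ((if j == i then c else 1) * t).
have dc0 (j : 'I_m) : (if j == i then c else 1) != 0 by case: ifP => // _; rewrite oner_eq0.
transitivity (iint (fun y : 'rV[R]_m => \prod_(j < m) hh j (y 0 j))).
  congr iint; apply/funext => y; apply: eq_bigr => j _.
  by rewrite dE /hh mul1r.
pose Bd := Num.max 1 `|c|^-1.
rewrite (@iint_tensor _ _ hh Bd).
- rewrite (bigD1 i)//= big1 ?mulr1 /hh; last by move=> j /negbTE ->; rewrite int1_hat_scale ?oner_eq0// normr1 invr1.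
  by rewrite eqxx int1_hat_scale.
- by rewrite le_max ler01.
- move=> j t; apply: (@continuous_comp R R R (fun t : R => _ * t) hat t); last exact: hat_continuous.
  by apply: cvgM; [exact: cvg_cst|exact: cvg_id].
- move=> j t Bt; apply: hat_vanish; rewrite normrM; move: Bt; rewrite gt_max => /andP[t1 tc].
  case: ifP => _; last by rewrite normr1 mul1r.
  by rewrite -ltr_pdivrMl ?normr_gt0// mulr1.
Qed.
(* The shear by [2 s] is the square of the shear by [s] and is conjugate to it by a dilation. *)
Lemma jac_shear i j s : i != j -> jac (shear i j s) = 1.
Proof.
move=> ij.
have two0 : (2 : R) != 0 by rewrite pnatr_eq0.
have E : dilate i 2 *m shear i j s = (shear i j s *m shear i j s) *m dilate i 2.
  apply/matrixP => k l; rewrite dilateE -mulmxA !shearE ![dilate _ _ _ _]mxE !mxE.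
  rewrite [j == i]eq_sym (negbTE ij) [l == j]eq_sym /=.
  case: (eqVneq k i) => [->|ki] /=; last by rewrite mul1r; ring.
  by rewrite [l == i]eq_sym /=; ring.
have us := shear_unit s ij; have ud := dilate_unit i two0.
move/(congr1 jac): E; rewrite !jacM ?unitmx_mul ?us//.
rewrite mulrC => /(mulIf (jac_neq0 ud)) /esym/eqP.
by rewrite -subr_eq0 -{3}[jac _]mulr1 -mulrBr mulf_eq0 (negbTE (jac_neq0 us)) /= subr_eq0 => /eqP.
Qed.

Lemma iint_mulmx A g : A \in unitmx -> CC g -> iint (fun y => g (y *m A)) = `|\det A|^-1 * iint g.
Proof.
move=> uA Cg; rewrite iint_jac//; congr (_ * _).
move: A uA; apply: unitmx_rowop_ind.
- by rewrite jac1 det1 normr1 invr1.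
- by move=> V i j s ij uV IH; rewrite jacM ?shear_unit// jac_shear// mul1r IH det_shear.
- by move=> V i c c0 uV IH; rewrite jacM ?dilate_unit// jac_dilate// IH det_dilate normrM invfM.
Qed.
End Haar.

(** * Hessians of sums of ridge functions, and test functions *)

Section Ridge.
Variables (R : realType) (n : nat).
Implicit Types (v x e : 'rV[R]_n) (g : R -> R).

Lemma is_derive_ridge v x e g (d : R) : is_derive (dotp v x) 1 g d ->
  is_derive x e (fun x => g (dotp v x)) (d * dotp v e).
Proof.
move=> dg.
have d1 : is_derive (0 : R) 1 (fun h : R => h * dotp v e + dotp v x) (dotp v e).
  by apply: is_derive_eq; rewrite addr0 scaler0 add0r /GRing.scale /= mulr1.
have H : is_derive (0 : R) 1 (g \o (fun h : R => h * dotp v e + dotp v x)) (d * dotp v e).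
  by apply: is_derive1_comp; rewrite mul0r add0r.
have E : (fun h : R => h^-1 *: (((fun x => g (dotp v x)) \o shift x) (h *: e) - g (dotp v x))) =
         (fun h : R => h^-1 *: (((g \o (fun h : R => h * dotp v e + dotp v x)) \o shift 0) (h *: 1) -
              (g \o (fun h : R => h * dotp v e + dotp v x)) 0)).
  apply/funext => h /=; rewrite dotpDr dotpZr addr0 mul0r add0r; congr (_ *: (g (_ * _ + _) - _)).
  by rewrite /GRing.scale /= mulr1.
case: H => H1 H2; split.
  by rewrite /derivable E.
by rewrite /derive E.
Qed.

Lemma is_derive_seqsum (I : Type) (r : seq I) (F : I -> 'rV[R]_n -> R) (dF : I -> R) x e :
  (forall i, is_derive x e (F i) (dF i)) ->
  is_derive x e (fun x => \sum_(i <- r) F i x) (\sum_(i <- r) dF i).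
Proof.
move=> H; elim: r => [|i r IH].
  under eq_fun do rewrite big_nil; rewrite big_nil; exact: is_derive_cst.
by under eq_fun do rewrite big_cons; rewrite big_cons; exact: is_deriveD.
Qed.

Variables (I : Type) (r : seq I) (v : I -> 'rV[R]_n) (g g' g'' : I -> R -> R).
Hypothesis dg : forall i (t : R), is_derive t 1 (g i) (g' i t).
Hypothesis dg' : forall i (t : R), is_derive t 1 (g' i) (g'' i t).
Hypothesis cg'' : forall i, continuous (g'' i).
Let F x := \sum_(i <- r) g i (dotp (v i) x).

Lemma partial_ridge k : partial k F = fun x => \sum_(i <- r) g' i (dotp (v i) x) * v i 0 k.
Proof.
apply/funext => x; apply: derive_val; apply: is_derive_seqsum => i.
rewrite -(dotp_delta (v i) k) (dotpC (delta_mx 0 k)); apply: is_derive_ridge; exact: dg.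
Qed.
Lemma is_derive_partial k l x : is_derive x (ebasis R l)
   (fun x => \sum_(i <- r) g' i (dotp (v i) x) * v i 0 k) (\sum_(i <- r) g'' i (dotp (v i) x) * v i 0 l * v i 0 k).
Proof.
apply: is_derive_seqsum => i; rewrite -(dotp_delta (v i) l) (dotpC (delta_mx _ _)).
have H := @is_derive_ridge (v i) x (ebasis R l) (g' i) _ (dg' i (dotp (v i) x)).
rewrite mulrC.
rewrite (_ : (fun x => _) = (v i 0 k) \*: (fun x => g' i (dotp (v i) x))); last by apply/funext => y; rewrite mulrC.
exact: is_deriveZ.
Qed.
Lemma partial2_ridge k l : partial l (partial k F) =
   fun x => \sum_(i <- r) g'' i (dotp (v i) x) * v i 0 l * v i 0 k.
Proof.
rewrite partial_ridge; apply/funext => x; apply: derive_val; exact: is_derive_partial.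
Qed.
Lemma ridge_C2 U : C2_on U F.
Proof.
move=> k l x _; split.
  have := @is_derive_seqsum I r (fun i x => g i (dotp (v i) x)) _ x (ebasis R k)
    (fun i => is_derive_ridge (ebasis R k) (dg i (dotp (v i) x))).
  by case.
split; first by rewrite partial_ridge; case: (is_derive_partial k l x).
rewrite partial2_ridge; apply: rV_cont_sum => i.
apply: rV_contM; last exact: cst_continuous.
apply: rV_contM; last exact: cst_continuous.
by apply: rV_contC => //; exact: dotp_continuous.
Qed.
Lemma ridge_hessian x : hessian F x = \sum_(i <- r) g'' i (dotp (v i) x) *: ((v i)^T *m v i).
Proof.
apply/matrixP => k l; rewrite mxE partial2_ridge summxE; apply: eq_bigr => i _.
by rewrite !mxE big_ord1 !mxE mulrAC mulrA.
Qed.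
End Ridge.

Section TestFun.
Variables (R : realType) (n : nat).
Implicit Types (phi h : 'rV[R]_n -> R) (U : set 'rV[R]_n).
Lemma testfun_CC U phi : testfun U phi -> CC phi.
Proof.
move=> [cp [K [/compact_norm_le[M [M0 KM]] [KU sK]]]]; split => //; exists M => // y My.
by apply: sK => Ky; have := KM y Ky; rewrite leNgt My.
Qed.
Lemma testfunM U phi h : testfun U phi -> continuous h -> testfun U (fun x => h x * phi x).
Proof.
move=> [cp [K [cK [KU sK]]]] ch; split; first exact: rV_contM.
by exists K; split => //; split => // x Kx; rewrite sK// mulr0.
Qed.
Lemma testfunD U p1 p2 : testfun U p1 -> testfun U p2 -> testfun U (fun x => p1 x + p2 x).
Proof.
move=> [c1 [K1 [cK1 [K1U s1]]]] [c2 [K2 [cK2 [K2U s2]]]]; split; first exact: rV_contD.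
exists (K1 `|` K2); split; first exact: compactU.
split; first by move=> x [/K1U|/K2U].
by move=> x K; rewrite s1 ?s2 ?addr0// => Kx; apply: K; [right|left].
Qed.
Lemma testfun0 U : testfun U (fun=> 0).
Proof. by split; [exact: cst_continuous|exists set0; split; [exact: compact0|split]]. Qed.
Lemma testfun_sum U (I : Type) (r : seq I) (P : I -> 'rV[R]_n -> R) :
  (forall i, testfun U (P i)) -> testfun U (fun x => \sum_(i <- r) P i x).
Proof.
move=> H; elim: r => [|i r IH].
  by under eq_fun do rewrite big_nil; exact: testfun0.
by under eq_fun do rewrite big_cons; exact: testfunD.
Qed.
(** Nothing is known of [psi] off [U]. Around a point outside [U] the product is locally zero,
    because the complement of the compact set [K] is a neighbourhood of that point. *)
Lemma testfun_psi U (psi phi : 'rV[R]_n -> R) : (forall x, U x -> {for x, continuous psi}) ->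
  testfun U phi -> testfun U (fun x => psi x * phi x).
Proof.
move=> cpsi [cp [K [cK [KU sK]]]]; split.
  move=> x; have [Ux|Ux] := pselect (U x).
    exact: (@cvgM _ _ (nbhs x) _ psi phi _ _ (cpsi x Ux) (cp x)).
  have nK : nbhs x (~` K).
    apply: open_nbhs_nbhs; split; last by move=> /KU.
    by apply: closed_openC; apply: compact_closed => //; exact: norm_hausdorff.
  have x0 : psi x * phi x = 0 by rewrite sK ?mulr0// => /KU.
  move=> A; rewrite x0 => A0.
  apply: filterS nK => y Ky /=; rewrite sK// mulr0; exact: nbhs_singleton A0.
by exists K; split => //; split => // x Kx; rewrite sK// mulr0.
Qed.
Lemma testfunZ U phi a : testfun U phi -> testfun U (fun x => a * phi x).
Proof. by move=> tp; apply: (testfunM tp); exact: cst_continuous. Qed.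
Lemma CC_mul phi h : CC phi -> continuous h -> CC (fun x => phi x * h x).
Proof. by move=> [cp [B B0 pB]] ch; split; [exact: rV_contM|exists B => // y /pB ->; rewrite mul0r]. Qed.
End TestFun.

Lemma cvg_near_unique (R : realType) (u v : nat -> R) (l l' : R) : u @ \oo --> l -> v @ \oo --> l' ->
  (\forall k \near \oo, u k = v k) -> l = l'.
Proof.
move=> ul vl uv; apply: (@cvg_unique _ (@norm_hausdorff _ R^o) (u @ \oo)) => //.
apply: cvg_trans vl; by apply: near_eq_cvg; apply: filterS uv => k ->.
Qed.

(** * Monge-Ampere measures of hinge sums *)

Section HingeSum.
Variables (R : realType) (n : nat).
Definition hs N (V : 'M[R]_(N, n)) (t : 'I_N -> R) (x : 'rV[R]_n) := \sum_(j < N) hinge (dotp (row j V) x - t j).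
Definition eps (k : nat) : R := k.+1%:R^-1.
Lemma eps_gt0 k : 0 < eps k. Proof. by rewrite invr_gt0 ltr0n. Qed.
Lemma eps_cvg : eps @ \oo --> (0 : R). Proof. exact: cvg_harmonic. Qed.
Lemma eps_lt (d : R) : 0 < d -> \forall k \near \oo, eps k < d.
Proof. by move=> d0; exact: (cvgr_lt _ eps_cvg). Qed.
Definition shs e N (V : 'M[R]_(N, n)) (t : 'I_N -> R) (x : 'rV[R]_n) := \sum_(j < N) shinge e (dotp (row j V) x - t j).
Lemma cvx1_shift g (a : R) : cvx1 g -> cvx1 (fun t => g (t - a)).
Proof.
move=> cg s t b b0 b1; rewrite (_ : _ - a = b * (s - a) + (1 - b) * (t - a)); last by ring.
exact: cg.
Qed.
Lemma convex_on_hinge U v (t : R) : convex_on U (fun x : 'rV[R]_n => hinge (dotp v x - t)).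
Proof.
have := @cvx1_hinge R t 1 ler01; under eq_fun do rewrite mul1r.
exact: (@convex_on_ridge R n U (fun s => hinge (s - t)) v).
Qed.
Lemma convex_on_hs U N (V : 'M[R]_(N, n)) t : convex_on U (hs V t).
Proof. apply: convex_on_sum => j; exact: convex_on_hinge. Qed.
Lemma convex_on_shs U e N (V : 'M[R]_(N, n)) t : 0 < e -> convex_on U (shs e V t).
Proof.
move=> e0; apply: convex_on_sum => j.
apply: (@convex_on_ridge R n U (fun s => shinge e (s - t j))); apply: cvx1_shift.
exact: cvx1_shinge.
Qed.
Lemma cvg_shs U N (V : 'M[R]_(N, n)) t : cvg_loc_unif U (fun k => shs (eps k) V t) (hs V t).
Proof.
apply: cvg_lu_sum => j; apply: (@cvg_lu_ridge _ _ U (fun k s => shinge (eps k) (s - t j)) (fun s => hinge (s - t j))).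
move=> M e e0; have : 0 < e / 3 by rewrite divr_gt0.
move=> /eps_lt; apply: filterS => k ek s _.
rewrite (le_lt_trans (shinge_near _ (eps_gt0 k)))//; lra.
Qed.
Definition hsH e N (V : 'M[R]_(N, n)) (t : 'I_N -> R) x :=
  \sum_(j < N) rho e (dotp (row j V) x - t j) *: ((row j V)^T *m row j V).
Lemma is_derive_shift1 (G : R -> R) (G' a t : R) : is_derive (t - a) 1 G G' -> is_derive t 1 (fun s => G (s - a)) G'.
Proof.
move=> dG; have := @is_derive1_comp R G (fun s => s - a) t G' 1 dG (is_derive_shift _ _ _).
by rewrite mulr1.
Qed.
Lemma shs_C2 U e N (V : 'M[R]_(N, n)) t : C2_on U (shs e V t) /\ forall x, hessian (shs e V t) x = hsH e V t x.
Proof.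
have d1 (j : 'I_N) (s : R) : is_derive s 1 (fun s => shinge e (s - t j)) (shinge' e (s - t j)).
  by apply: is_derive_shift1; exact: is_derive_shinge.
have d2 (j : 'I_N) (s : R) : is_derive s 1 (fun s => shinge' e (s - t j)) (rho e (s - t j)).
  by apply: is_derive_shift1; exact: is_derive_shinge'.
have cr (j : 'I_N) : continuous (fun s => rho e (s - t j)).
  move=> s; apply: (@continuous_comp R R R (fun s : R => s - t j) (rho e) s); last exact: rho_continuous.
  by apply: cvgD; [exact: cvg_id|exact: cvg_cst].
split; first exact: (ridge_C2 _ _ d1 d2).
exact: (ridge_hessian _ _ d1 d2).
Qed.
Lemma mx_cont_det m (A : 'rV[R]_n -> 'M[R]_m) : (forall i j, continuous (fun x => A x i j)) -> continuous (fun x => \det (A x)).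
Proof.
move=> cA; rewrite /determinant; apply: rV_cont_sum => s; apply: rV_contM; first exact: cst_continuous.
by apply: rV_cont_prod => i; exact: cA.
Qed.
Lemma hsH_continuous e N (V : 'M[R]_(N, n)) t : continuous (fun x => \det (hsH e V t x)).
Proof.
apply: mx_cont_det => i j; rewrite /hsH; under eq_fun do rewrite summxE.
apply: rV_cont_sum => k; under eq_fun do rewrite mxE.
apply: rV_contM; last exact: cst_continuous.
apply: (@rV_contC _ _ (fun s => rho e s) (fun x => dotp (row k V) x - t k)); first exact: rho_continuous.
apply: (rV_contD _ (@cst_continuous _ _ (- t k))); exact: dotp_continuous.
Qed.
(** In this Gram form the determinant visibly vanishes when [V] has rank below n, and for square [V]
    it splits into [\det V ^+ 2] and a product of hats. *)
Lemma hsHE e N (V : 'M[R]_(N, n)) t x : hsH e V t x = V^T *m diag_mx (\row_j rho e (dotp (row j V) x - t j)) *m V.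
Proof.
apply/matrixP => k l; rewrite summxE !mxE; apply: eq_bigr => j _.
rewrite !mxE big_ord1 !mxE mulrA; congr (_ * _); rewrite (bigD1 j)//= big1 ?addr0.
  by rewrite !mxE eqxx mulr1n mulrC.
by move=> i ij; rewrite !mxE (negbTE ij) mulr0n mulr0.
Qed.
Lemma det_hsH_rank e N (V : 'M[R]_(N, n)) t x : (\rank V < n)%N -> \det (hsH e V t x) = 0.
Proof.
move=> rV; apply/eqP; apply: contraTT rV; rewrite -unitfE -unitmxE -row_free_unit /row_free => /eqP H.
by rewrite -leqNgt -{1}H hsHE mxrankM_maxr.
Qed.
Lemma det_hsH_square e (V : 'M[R]_n) t x : \det (hsH e V t x) = \det V ^+ 2 * \prod_j rho e (dotp (row j V) x - t j).
Proof.
rewrite hsHE !det_mulmx det_tr det_diag expr2 mulrAC; congr (_ * _).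
by apply: eq_bigr => j _; rewrite mxE.
Qed.

Variables (U : set 'rV[R]_n) (MA : ('rV[R]_n -> R) -> ('rV[R]_n -> R) -> R).
Hypothesis hMA : is_MongeAmpere U MA.

Lemma MA_hs_cvg N (V : 'M[R]_(N, n)) t phi : testfun U phi ->
  (fun k => iint (fun x => phi x * \det (hsH (eps k) V t x))) @ \oo --> MA (hs V t) phi.
Proof.
move=> tp.
have := hMA.2 (fun k => shs (eps k) V t) (hs V t) _ (@convex_on_hs U N V t) (@cvg_shs U N V t) phi tp.
move=> /(_ (fun k => @convex_on_shs U _ N V t (eps_gt0 k))).
have -> : (fun k => MA (shs (eps k) V t) phi) = (fun k => iint (fun x => phi x * \det (hsH (eps k) V t x))).
  apply/funext => k; rewrite hMA.1//; last 2 first.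
  - exact: convex_on_shs (eps_gt0 k).
  - exact: (@shs_C2 U (eps k) N V t).1.
  by congr iint; apply/funext => x; rewrite (@shs_C2 U (eps k) N V t).2.
by [].
Qed.
Lemma MA_hs_rank N (V : 'M[R]_(N, n)) t phi : testfun U phi -> (\rank V < n)%N -> MA (hs V t) phi = 0.
Proof.
move=> tp rV; apply: (cvg_near_unique (@MA_hs_cvg _ V t _ tp) (@cvg_cst R^o 0 nat \oo _)).
apply: nearW => k; under eq_fun do rewrite det_hsH_rank// mulr0.
have C0 := @CC0 R n; have := iint_lin 0 0 C0 C0; under eq_fun do rewrite !mul0r addr0.
by move=> ->; rewrite !mul0r addr0.
Qed.
(** [is_MongeAmpere] does not state linearity in the test function; here it is inherited from [iint]
    through the smoothed hinge sums. *)
Lemma MA_hs_lin N (V : 'M[R]_(N, n)) t (a b : R) p1 p2 : testfun U p1 -> testfun U p2 ->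
  MA (hs V t) (fun x => a * p1 x + b * p2 x) = a * MA (hs V t) p1 + b * MA (hs V t) p2.
Proof.
move=> t1 t2.
have t12 := testfunD (testfunZ a t1) (testfunZ b t2).
apply: (cvg_near_unique (@MA_hs_cvg _ V t _ t12)).
  apply: cvgD; (apply: cvgM; first exact: cvg_cst); exact: MA_hs_cvg.
apply: nearW => k; rewrite -[RHS]/(a * iint _ + b * iint _) -iint_lin; last 2 first.
- by apply: CC_mul; [exact: testfun_CC t1|exact: hsH_continuous].
- by apply: CC_mul; [exact: testfun_CC t2|exact: hsH_continuous].
by congr iint; apply/funext => x; rewrite mulrDl !mulrA.
Qed.
(** Once the smoothing width is below [d], the hat of hinge [j] vanishes wherever [phi] does not, so
    that hinge leaves no trace in the Hessian. *)
Lemma MA_hs_local N (V : 'M[R]_(N.+1, n)) t j phi (d : R) : testfun U phi -> 0 < d ->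
  (forall x, phi x != 0 -> d <= `|dotp (row j V) x - t j|) ->
  MA (hs V t) phi = MA (hs (row' j V) (t \o lift j)) phi.
Proof.
move=> tp d0 H.
apply: (cvg_near_unique (@MA_hs_cvg _ V t _ tp) (@MA_hs_cvg _ (row' j V) (t \o lift j) _ tp)).
apply: filterS (eps_lt d0) => k kd; congr iint; apply/funext => x.
have [->|px] := eqVneq (phi x) 0; first by rewrite !mul0r.
congr (_ * \det _); rewrite /hsH (bigD1_ord j)//= rho_out ?eps_gt0//; last by rewrite (le_trans _ (H x px))// ltW.
rewrite scale0r add0r; apply: eq_bigr => i _ /=.
by rewrite -!row_rowsub.
Qed.

Definition vertex (V : 'M[R]_n) (t : 'I_n -> R) : 'rV[R]_n := (\row_j t j) *m invmx V^T.
Lemma dotp_rowE N (V : 'M[R]_(N, n)) j x : dotp (row j V) x = (x *m V^T) 0 j.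
Proof. by rewrite dotp_mulmx tr_row colE mulmxA -colE [LHS]mxE. Qed.
Lemma vertexP (V : 'M[R]_n) t j : V \in unitmx -> dotp (row j V) (vertex V t) = t j.
Proof. by move=> uV; rewrite dotp_rowE /vertex mulmxKV ?unitmx_tr// mxE. Qed.

(** The smoothed determinants [J e] form an approximate identity at the vertex. Their mass is
    [\det V ^+ 2] from the Gram form divided by |det V| from the change of variables. *)
Lemma MA_hs_square (V : 'M[R]_n) t phi : testfun U phi -> V \in unitmx ->
  MA (hs V t) phi = `|\det V| * phi (vertex V t).
Proof.
move=> tp uV; set x0 := vertex V t.
have uVT : V^T \in unitmx by rewrite unitmx_tr.
pose K e (y : 'rV[R]_n) := \prod_(j < n) rho e (y 0 j).
have CK e : 0 < e -> CC (K e).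
  move=> e0; apply: (@CC_tensor _ _ (fun _ => rho e) e); first exact: ltW.
    by move=> _; exact: rho_continuous.
  by move=> _; exact: rho_vanish.
have IK e : 0 < e -> iint (K e) = 1.
  move=> e0; rewrite (@iint_tensor _ _ (fun _ => rho e) e) ?(ltW e0)//.
  - by rewrite big1// => j _; exact: int1_rho.
  - by move=> _; exact: rho_continuous.
  - by move=> _; exact: rho_vanish.
pose J e x := \det (hsH e V t x).
have JE e x : J e x = \det V ^+ 2 * K e ((x - x0) *m V^T).
  rewrite /J det_hsH_square; congr (_ * _); apply: eq_bigr => j _.
  by rewrite -dotp_rowE dotpBr vertexP.
have CJ' e : 0 < e -> CC (fun x => K e ((x - x0) *m V^T)).
  by move=> e0; apply: (CC_shift (- x0) (CC_mulmx uVT (CK e e0))).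
have CJ e : 0 < e -> CC (J e).
  move=> e0; have := CC_lin (\det V ^+ 2) 0 (CJ' e e0) (CJ' e e0).
  by congr CC; apply/funext => x; rewrite mul0r addr0 JE.
have IJ e : 0 < e -> iint (J e) = `|\det V|.
  move=> e0; have := iint_lin (\det V ^+ 2) 0 (CJ' e e0) (CJ' e e0).
  rewrite (_ : (fun y => _) = J e); last by apply/funext => x; rewrite mul0r addr0 JE.
  move=> ->; rewrite mul0r addr0 (iint_shift (- x0) (CC_mulmx uVT (CK e e0))).
  rewrite iint_mulmx// ?IK// ?mulr1; last exact: CK.
  rewrite det_tr -real_normK ?num_real// expr2 mulfK// normr_eq0.
  by rewrite -unitfE -unitmxE.
have J0 e x : 0 < e -> 0 <= J e x.
  by move=> e0; rewrite JE mulr_ge0 ?sqr_ge0// prodr_ge0// => j _; exact: rho_ge0.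
have [M M0 HM] := mulmx_bound (invmx V^T).
have Jout e x : 0 < e -> M * e <= `|x - x0| -> J e x = 0.
  move=> e0 xe; rewrite JE.
  have [j Hj] : exists j, e <= `|((x - x0) *m V^T) 0 j|.
    apply: contrapT => /forallNP H; move: xe; rewrite leNgt => /negP; apply.
    rewrite -(mulmxK uVT (x - x0)) (le_lt_trans (HM _))// ltr_pM2l//.
    by apply: normrow_lt => // i; rewrite ltNge; apply/negP; exact: H.
  rewrite (_ : K _ _ = 0) ?mulr0//; apply/eqP/prodf_eq0; exists j => //.
  by apply/eqP/rho_out.
have Cp := testfun_CC tp.
symmetry; apply: (cvg_near_unique _ (@MA_hs_cvg _ V t _ tp) (u := fun k => `|\det V| * phi x0 + (iint (fun x => phi x * J (eps k) x) - `|\det V| * phi x0))); last by apply: nearW => k; rewrite addrC subrK.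
rewrite -[X in _ --> X]addr0; apply: cvgD; first exact: cvg_cst.
apply/cvgrPdist_le => e e0.
have D0 : 0 < `|\det V| + 1 by rewrite ltr_wpDl.
pose eta := e / (`|\det V| + 1).
have eta0 : 0 < eta by rewrite divr_gt0.
have /rV_continuousP/(_ _ eta0)[d d0 Hd] := Cp.1 x0.
have dM : 0 < d / M by rewrite divr_gt0.
apply: filterS (eps_lt dM) => k; rewrite ltr_pdivlMr// mulrC => kd.
have ek := eps_gt0 k.
have CpJ : CC (fun x => phi x * J (eps k) x) by apply: CC_mul => //; exact: hsH_continuous.
rewrite sub0r normrN.
have -> : iint (fun x => phi x * J (eps k) x) - `|\det V| * phi x0 =
          iint (fun x => 1 * (phi x * J (eps k) x) + (- phi x0) * J (eps k) x).
  by rewrite iint_lin//; [rewrite IJ//; ring|exact: CJ].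
have bd x : `|1 * (phi x * J (eps k) x) + (- phi x0) * J (eps k) x| <= eta * J (eps k) x.
  rewrite mul1r -mulrDl normrM [X in _ * X]ger0_norm; last exact: J0.
  have [le|lt] := leP (M * eps k) `|x - x0|; first by rewrite Jout// !mulr0.
  by rewrite ler_wpM2r ?J0// distrC ltW// Hd// distrC (lt_trans lt).
have Cd : CC (fun x => 1 * (phi x * J (eps k) x) + (- phi x0) * J (eps k) x).
  by apply: CC_lin => //; exact: CJ.
have Ce a : CC (fun x => a * J (eps k) x + 0 * J (eps k) x) by apply: CC_lin; exact: CJ.
have Ie a : iint (fun x => a * J (eps k) x + 0 * J (eps k) x) = a * `|\det V|.
  by rewrite iint_lin ?IJ// ?mul0r ?addr0//; exact: CJ.
apply: (@le_trans _ _ (eta * `|\det V|)); last first.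
  by rewrite /eta mulrAC ler_pdivrMr// ler_pM2l// lerDl.
rewrite ler_norml -mulNr -!Ie; apply/andP; split; apply: (pti_le (pti_iint R n)) => // x.
  by rewrite mul0r addr0 mulNr; have := bd x; rewrite ler_norml => /andP[].
by rewrite mul0r addr0; have := bd x; rewrite ler_norml => /andP[].
Qed.
End HingeSum.

(** Cauchy's functional equation on the half-line, to which coefficients are confined by convexity.
    Additivity settles rational arguments, and the truncations [s k] with denominator k + 1 reach
    the others by sequential continuity. *)
Lemma additive_linear (R : realType) (A : R -> R) :
  (forall x y, 0 <= x -> 0 <= y -> A (x + y) = A x + A y) ->
  (forall (s : nat -> R) (a : R), (forall k, 0 <= s k) -> 0 <= a -> s @ \oo --> a -> A (s k) @[k --> \oo] --> A a) ->
  forall a, 0 <= a -> A a = a * A 1.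
Proof.
move=> Aadd Ac a a0.
have A0 : A 0 = 0 by have := Aadd 0 0 (lexx _) (lexx _); rewrite addr0; lra.
have An x k : 0 <= x -> A (k%:R * x) = k%:R * A x.
  move=> x0; elim: k => [|k IH]; first by rewrite !mul0r A0.
  by rewrite -natr1 !mulrDl !mul1r Aadd ?IH// mulr_ge0.
pose s k : R := (Num.truncn (a * k.+1%:R))%:R / k.+1%:R.
have s0 k : 0 <= s k by rewrite divr_ge0.
have k0 k : (k.+1%:R : R) != 0 by rewrite pnatr_eq0.
have As k : A (s k) = s k * A 1.
  have H : A (k.+1%:R^-1) = k.+1%:R^-1 * A 1.
    have := An k.+1%:R^-1 k.+1; rewrite mulfV// => ->; first by rewrite mulKf.
    by rewrite invr_ge0.
  by rewrite /s An ?invr_ge0// H mulrA.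
have sa : s @ \oo --> a.
  apply/cvgrPdist_lt => e /eps_lt; apply: filterS => k ke.
  rewrite (le_lt_trans _ ke)// /eps -[leRHS]mul1r ler_pdivlMr ?ltr0n//.
  rewrite -[X in _ * X]ger0_norm// -normrM mulrBl /s divfK//.
  have H1 : (Num.truncn (a * k.+1%:R))%:R <= a * k.+1%:R by rewrite truncn_le// mulr_ge0.
  have H2 : a * k.+1%:R < (Num.truncn (a * k.+1%:R)).+1%:R by exact: truncnS_gt.
  move: H2; rewrite -[X in _ < X]natr1 => H2; rewrite ger0_norm; lra.
apply: (cvg_near_unique (Ac s a s0 a0 sa) (cvgM sa (@cvg_cst R^o (A 1) nat \oo _))).
exact: nearW.
Qed.

Lemma orthproj_dotp (R : realType) n N (V : 'M[R]_(N, n)) x j :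
  dotp (row j V) (orthproj <<V>>%MS x) = dotp (row j V) x.
Proof.
set E := <<V>>%MS.
(* [kermx E^T] is the orthogonal complement of [E]. An element of both is orthogonal to itself,
   hence 0, as a sum of squares vanishes over the reals only termwise. *)
have cap0 : (E :&: kermx E^T = 0)%MS.
  apply/eqP; set C := (_ :&: _)%MS.
  have /submxP[D CD] : (C <= E)%MS by exact: capmxSl.
  have /sub_kermxP CE : (C <= kermx E^T)%MS by exact: capmxSr.
  have CC : C *m C^T = 0 by rewrite {2}CD trmx_mul mulmxA CE mul0mx.
  apply/eqP/matrixP => i k; rewrite mxE; apply/eqP.
  have := congr1 (fun M : 'M[R]_n => M i i) CC; rewrite !mxE => /eqP.
  under eq_bigr do rewrite mxE -expr2.
  rewrite psumr_eq0 => [/allP/(_ k)|l _]; last exact: sqr_ge0.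
  by rewrite mem_index_enum => /(_ isT); rewrite sqrf_eq0.
have full : (x <= E + kermx E^T)%MS.
  rewrite submx_full// /row_full.
  have := mxrank_sum_cap E (kermx E^T); rewrite cap0 mxrank0 addn0 mxrank_ker mxrank_tr.
  by move=> ->; rewrite subnKC// rank_leq_col.
have := proj_mx_compl_sub full => /sub_kermxP; rewrite -/(orthproj E x) => H.
have /submxP[D VD] : (V <= E)%MS by rewrite genmxE.
apply/eqP; rewrite eq_sym -subr_eq0 -dotpBr dotp_rowE VD trmx_mul mulmxA H mul0mx mxE//.
Qed.

Ltac no_minmax x := lazymatch x with context[Num.max _ _] => fail | context[Num.min _ _] => fail | _ => idtac end.
Ltac minmax := rewrite /hinge; repeat match goal with
  | |- context[Num.max ?x ?y] => no_minmax x; no_minmax y; case: (leP x y) => ?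
  | |- context[Num.min ?x ?y] => no_minmax x; no_minmax y; case: (leP x y) => ? end; lra.
(* [hinge a + hinge b] and [hinge (a + b) + hinge b] occur as max-min partners of the same two functions,
   up to the affine summand [b]; hence valuations cannot tell them apart. *)
Lemma shear_max1 (R : realType) (a b : R) : hinge a + hinge b = Num.max (Num.max (Num.max 0 b) (a + b)) (Num.max (Num.max 0 a) (a + b)).
Proof. rewrite [Num.max 0 b]maxC [Num.max 0 a]maxC /hinge; case: (leP a 0) => ?; case: (leP b 0) => ?; minmax. Qed.
Lemma shear_min1 (R : realType) (a b : R) : hinge (a + b) = Num.min (Num.max (Num.max 0 b) (a + b)) (Num.max (Num.max 0 a) (a + b)).
Proof. rewrite [Num.max 0 b]maxC [Num.max 0 a]maxC /hinge; case: (leP a 0) => ?; case: (leP b 0) => ?; minmax. Qed.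
Lemma shear_max2 (R : realType) (a b : R) : hinge (a + b) + hinge b = Num.max (Num.max (Num.max 0 b) (a + b)) (Num.max (Num.max 0 a) (a + b) + b).
Proof. rewrite [Num.max 0 b]maxC [Num.max 0 a]maxC /hinge; case: (leP a 0) => ?; case: (leP b 0) => ?; minmax. Qed.
Lemma shear_min2 (R : realType) (a b : R) : hinge a + b = Num.min (Num.max (Num.max 0 b) (a + b)) (Num.max (Num.max 0 a) (a + b) + b).
Proof. rewrite [Num.max 0 b]maxC [Num.max 0 a]maxC /hinge; case: (leP a 0) => ?; case: (leP b 0) => ?; minmax. Qed.

(** * Partitions of unity by sets of positivity *)

Section Partition.
Variables (R : realType) (n : nat) (U : set 'rV[R]_n).
Implicit Types (phi : 'rV[R]_n -> R).

(** The weights are the normalized functions (d_i - delta)^+. Subtracting [delta] makes the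
    positivity uniform on the support of each weight, which locality arguments require; [D] floors
    the denominator so that the weights are continuous off [K] too. *)
Lemma partition_pos (I : finType) (d : I -> 'rV[R]_n -> R) phi K :
  compact K -> supported_in K phi -> (forall i, continuous (d i)) ->
  (forall x, K x -> exists i, 0 < d i x) ->
  exists delta : R, exists chi : I -> 'rV[R]_n -> R, [/\ 0 < delta, forall i, continuous (chi i),
    forall x, phi x = \sum_i chi i x * phi x & forall i x, chi i x != 0 -> delta <= d i x].
Proof.
move=> cK sK cd dK.
have [K0|/eqP K0] := pselect (K = set0).
  exists 1, (fun _ _ => 0); split => //; first by move=> i; exact: cst_continuous.
    by move=> x; rewrite sK ?K0// big1// => i _; rewrite mulr0.
  by move=> i x; rewrite eqxx.
have Kn0 : K !=set0 by exact/set0P.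
pose S x := \sum_i hinge (d i x).
have ch a : continuous (fun t : R => hinge (t - a)).
  move=> t; apply: (@continuous_comp R R R (fun t => t - a) (@hinge R) t); last exact: hinge_continuous.
  by apply: cvgD; [exact: cvg_id|exact: cvg_cst].
have cS : continuous S by apply: rV_cont_sum => i; apply: rV_contC => //; exact: hinge_continuous.
have [c Kc Smin] := EVT_min_rV Kn0 cK (continuous_subspaceT cS).
have m0 : 0 < S c.
  have [i di] := dK c (set_mem Kc); rewrite /S (bigD1 i)//= ltr_pwDl ?sumr_ge0//; last by move=> *; exact: hinge_ge0.
  by rewrite hinge_pos// ltW.
pose N : R := #|I|.+1%:R.
have N0 : 0 < N by rewrite ltr0n.
(* Lowering every [d i] by [delta] reduces the sum by at most [#|I| * delta], at most half of its
   minimum over [K]. *)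
pose delta := S c / 2 / N.
have d0 : 0 < delta by rewrite !divr_gt0.
pose S' x := \sum_i hinge (d i x - delta).
have S'K x : K x -> S c / 2 <= S' x.
  move=> Kx; have := Smin x (mem_set Kx); rewrite /S => Sx.
  have : S x - #|I|%:R * delta <= S' x.
    rewrite /S /S' -sum1_card natr_sum mulr_suml -sumrB; apply: ler_sum => i _.
    rewrite mul1r lerBlDr ge_max; apply/andP; split; first by rewrite -lerBlDr le_max lexx.
    by rewrite addr_ge0 ?hinge_ge0// ltW.
  have : #|I|%:R * delta <= S c / 2.
    rewrite /delta mulrA ler_pdivrMr// mulrC ler_wpM2l ?ler_nat// divr_ge0// ltW//.
  by move: Sx; rewrite -!/(S _); lra.
pose D x := Num.max (S c / 2) (S' x).
have D0 x : 0 < D x by rewrite lt_max divr_gt0.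
have cS' : continuous S' by apply: rV_cont_sum => i; apply: (@rV_contC _ _ (fun t => hinge (t - delta)) (d i)).
have cD : continuous D.
  have -> : D = fun x => S c / 2 + hinge (S' x - S c / 2).
    by apply/funext => x; rewrite /D /hinge; case: (leP (S c / 2) (S' x)); case: (leP (S' x - S c / 2) 0); lra.
  apply: rV_contD; first exact: cst_continuous.
  exact: (@rV_contC _ _ (fun t => hinge (t - S c / 2)) S').
exists delta, (fun i x => hinge (d i x - delta) / D x); split => //.
- move=> i; apply: rV_contM; first exact: (@rV_contC _ _ (fun t => hinge (t - delta)) (d i)).
  by move=> x; apply: (@cvgV _ _ (nbhs x)); [rewrite gt_eqF|exact: cD].
- move=> x; have [Kx|Kx] := pselect (K x); last by rewrite sK// big1// => i _; rewrite mulr0.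
  rewrite -mulr_suml -mulr_suml -/(S' x) (_ : D x = S' x) ?divff ?mul1r//.
    by rewrite gt_eqF// (lt_le_trans _ (S'K x Kx))// divr_gt0.
  by rewrite /D max_r// S'K.
- move=> i x H; rewrite leNgt; apply/negP => H'; move: H.
  by rewrite hinge_neg ?mul0r ?eqxx// subr_le0 ltW.
Qed.

(** The uniform bound makes the support a compact subset of the open set where [d] is positive, as
    [lv_loc] demands. *)
Lemma testfun_away phi d (delta : R) : testfun U phi -> continuous d -> 0 < delta ->
  (forall x, phi x != 0 -> delta <= d x) -> testfun (U `&` [set x | 0 < d x]) phi.
Proof.
move=> [cp [K [cK [KU sK]]]] cd d0 H; split => //.
exists (K `&` [set x | delta <= d x]); split.
  apply: (subclosed_compact _ cK); last by move=> x [].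
  apply: closedI; first by apply: compact_closed => //; exact: norm_hausdorff.
  by apply: (@preimage_closed _ _ d [set t | delta <= t]); [move=> x _; exact: cd|exact: closed_ge].
split; first by move=> x [Kx /= dx]; split; [exact: KU|exact: lt_le_trans dx].
move=> x nK; have [//|px] := eqVneq (phi x) 0.
have [Kx|Kx] := pselect (K x); last by rewrite sK.
by case: nK; split => //; exact: H.
Qed.
End Partition.

Lemma rV_contN (R : realType) n (g : 'rV[R]_n -> R) : continuous g -> continuous (fun x => - g x).
Proof. by move=> cg x; apply: (@cvgN _ _ _ (nbhs x)); exact: cg. Qed.
Lemma rV_cont_hinge (R : realType) n (g : 'rV[R]_n -> R) a : continuous g -> continuous (fun x => hinge (g x - a)).
Proof.
move=> cg; apply: (@rV_contC _ _ (@hinge R) (fun x => g x - a)); first exact: hinge_continuous.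
by apply: rV_contD => //; exact: cst_continuous.
Qed.

(* The properties of a real or imaginary part of [Psi]. *)
Record locval (R : realType) (n : nat) (U : set 'rV[R]_n) (P : ('rV[R]_n -> R) -> ('rV[R]_n -> R) -> R) : Prop := Locval {
  lv_open : open U;
  lv_convex : convex_set U;
  lv_lin : forall f, convex_on U f -> forall p1 p2 (a b : R), testfun U p1 -> testfun U p2 ->
    P f (fun x => a * p1 x + b * p2 x) = a * P f p1 + b * P f p2;
  lv_bounded : forall f, convex_on U f -> forall K, compact K -> K `<=` U -> exists C : R, forall phi,
    testfun U phi -> supported_in K phi -> (forall x, `|phi x| <= 1) -> `|P f phi| <= C;
  lv_cont : forall F f, (forall k, convex_on U (F k)) -> convex_on U f ->
    cvg_loc_unif U F f -> forall phi, testfun U phi -> (fun k => P (F k) phi) @ \oo --> P f phi;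
  lv_val : forall f h, convex_on U f -> convex_on U h ->
    convex_on U (fun x => Num.min (f x) (h x)) -> forall phi, testfun U phi ->
    P f phi + P h phi = P (fun x => Num.max (f x) (h x)) phi + P (fun x => Num.min (f x) (h x)) phi;
  lv_inv : forall f l, convex_on U f -> affine l -> forall phi, testfun U phi ->
    P (fun x => f x + l x) phi = P f phi;
  lv_simple : forall (E : 'M[R]_n), (\rank E < n)%N -> forall f, convex_on (subspace_of E) f ->
    forall phi, testfun U phi -> P (fun x => f (orthproj E x)) phi = 0;
  lv_loc : forall f h (V : set 'rV[R]_n), convex_on U f -> convex_on U h -> open V -> V `<=` U ->
    (forall x, V x -> f x = h x) -> forall phi, testfun V phi -> P f phi = P h phi }.

(** * Valuations of hinge sums *)

Section Valuation.
Variables (R : realType) (n : nat) (U : set 'rV[R]_n).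
Variable P : ('rV[R]_n -> R) -> ('rV[R]_n -> R) -> R.
Hypothesis HP : locval U P.
Let hUo := lv_open HP.
Let hUc := lv_convex HP.
Let Plin := lv_lin HP.
Let Pbd := lv_bounded HP.
Let Pcont := lv_cont HP.
Let Pval := lv_val HP.
Let Pinv := lv_inv HP.
Let Psimple := lv_simple HP.
Let Ploc := lv_loc HP.
Implicit Types (f h phi : 'rV[R]_n -> R).

(** Such an [f] equals its own composite with the orthogonal projection onto the row space of [V], a
    proper subspace, so simplicity applies. *)
Lemma P_rank N (V : 'M[R]_(N, n)) f phi : (\rank V < n)%N -> convex_on setT f ->
  (forall x y, (forall j, dotp (row j V) x = dotp (row j V) y) -> f x = f y) ->
  testfun U phi -> P f phi = 0.
Proof.
move=> rV cf fV tp.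
have -> : f = fun x => f (orthproj <<V>>%MS x).
  by apply/funext => x; apply: fV => j; rewrite orthproj_dotp.
apply: Psimple => //; first by rewrite genmxE.
exact: convex_onS cf.
Qed.

Lemma P_valuation f h M m phi : convex_on U f -> convex_on U h -> convex_on U m ->
  (forall x, M x = Num.max (f x) (h x)) -> (forall x, m x = Num.min (f x) (h x)) -> testfun U phi ->
  P f phi + P h phi = P M phi + P m phi.
Proof.
move=> cf ch cm /funext -> /[dup] /funext mE; rewrite mE in cm * => _; exact: Pval.
Qed.

Lemma P_sum f (I : Type) (r : seq I) (p : I -> 'rV[R]_n -> R) : convex_on U f -> (forall i, testfun U (p i)) ->
  P f (fun x => \sum_(i <- r) p i x) = \sum_(i <- r) P f (p i).
Proof.
move=> cf tp; elim: r => [|i r IH].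
  under eq_fun do rewrite big_nil; rewrite big_nil.
  have := Plin cf 0 0 (testfun0 U) (testfun0 U); under eq_fun do rewrite !mul0r addr0.
  by move=> ->; rewrite !mul0r addr0.
rewrite big_cons -IH; have := Plin cf 1 1 (tp i) (testfun_sum r tp); rewrite !mul1r => <-.
by congr P; apply/funext => x; rewrite big_cons !mul1r.
Qed.

(* Gluing a kink onto a function that is already affine beyond it. *)
Lemma P_insert f v (g : R -> R) (tau sg ka c : R) phi :
  convex_on U f -> cvx1 g -> 0 <= c -> (forall s, sg * s + ka <= g s) ->
  (forall s, tau <= s -> g s = sg * s + ka) -> testfun U phi ->
  P (fun x => f x + (g (dotp v x) + c * hinge (dotp v x - tau))) phi - P f phi =
  (P (fun x => f x + g (dotp v x)) phi - P f phi) + (P (fun x => f x + c * hinge (dotp v x - tau)) phi - P f phi).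
Proof.
move=> cf cg c0 gl ge tp.
have ch : convex_on U (fun x => c * hinge (dotp v x - tau)) by exact: (@convex_on_ridge R n U (fun t => c * hinge (t - tau)) v (cvx1_hinge tau c0)).
have al : affine (fun x => dotp (sg *: v) x + ka) by exact: affine_dotp.
pose l x := dotp (sg *: v) x + ka.
(* With [l] the affine function that continues the last piece of [g], the maximum of f + g and f + c
   hinge + l is f + g + c hinge and their minimum is f + l: the kink starts where [g] has joined the
   line. Invariance then removes [l]. *)
have H := @P_valuation (fun x => f x + g (dotp v x)) (fun x => f x + (c * hinge (dotp v x - tau)) + l x)
  (fun x => f x + (g (dotp v x) + c * hinge (dotp v x - tau))) (fun x => f x + l x) phi.
rewrite (Pinv (convex_onD cf ch) al tp) (Pinv cf al tp) in H.
suff : P (fun x => f x + g (dotp v x)) phi + P (fun x => f x + c * hinge (dotp v x - tau)) phi =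
  P (fun x => f x + (g (dotp v x) + c * hinge (dotp v x - tau))) phi + P f phi by lra.
apply: H => //.
- by apply: convex_onD => //; exact: convex_on_ridge.
- by apply: convex_onD; [exact: convex_onD|exact: convex_on_affine].
- by apply: convex_onD => //; exact: convex_on_affine.
- move=> x; rewrite /l dotpZl -addrA -addr_maxr; congr (_ + _).
  have [s1|s1] := leP tau (dotp v x).
    have h0 : 0 <= c * hinge (dotp v x - tau) by rewrite mulr_ge0// hinge_ge0.
    rewrite (ge _ s1) max_r; lra.
  rewrite hinge_neg; last by lra.
  rewrite mulr0 addr0 add0r max_l//.
- move=> x; rewrite /l dotpZl -addrA -addr_minr; congr (_ + _).
  have [s1|s1] := leP tau (dotp v x).
    have h0 : 0 <= c * hinge (dotp v x - tau) by rewrite mulr_ge0// hinge_ge0.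
    rewrite (ge _ s1) min_l; lra.
  rewrite hinge_neg; last by lra.
  rewrite mulr0 add0r min_r//.
Qed.

Lemma hinge_bdd tau (M : R) : exists C : R, forall t, `|t| <= M -> `|hinge (t - tau)| <= C.
Proof.
exists (M + `|tau|) => t tM; rewrite -[hinge _]subr0 -(@hinge_neg _ 0)//.
by rewrite (le_trans (hinge_lip _ _))// subr0 (le_trans (ler_normB _ _))// lerD2r.
Qed.

(** [P_insert], with [g] itself a hinge at [tau], makes the increment additive in the coefficient;
    continuity of [P] then yields linearity. *)
Lemma P_hinge_linear f v (tau c : R) phi : convex_on U f -> 0 <= c -> testfun U phi ->
  P (fun x => f x + c * hinge (dotp v x - tau)) phi - P f phi =
  c * (P (fun x => f x + hinge (dotp v x - tau)) phi - P f phi).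
Proof.
move=> cf c0 tp.
pose A (c : R) := P (fun x => f x + c * hinge (dotp v x - tau)) phi - P f phi.
have -> : P (fun x => f x + hinge (dotp v x - tau)) phi - P f phi = A 1.
  by congr (P _ _ - _); apply/funext => x; rewrite mul1r.
apply: (@additive_linear R A) => // [a b a0 b0|s a s0 a0 sa].
  rewrite /A -(@P_insert _ _ (fun s => a * hinge (s - tau)) tau a (- (a * tau)))//.
  - by congr (P _ _ - _); apply/funext => x; rewrite mulrDl.
  - exact: cvx1_hinge.
  - move=> s; rewrite -mulrBr ler_wpM2l// le_max lexx//.
  - by move=> s ts; rewrite hinge_pos ?mulrBr// subr_ge0.
have ch (b : R) : 0 <= b -> convex_on U (fun x => b * hinge (dotp v x - tau)).
  by move=> b0; exact: (@convex_on_ridge R n U (fun t => b * hinge (t - tau)) v (cvx1_hinge tau b0)).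
apply: cvgB; last exact: cvg_cst.
apply: (Pcont (F := fun k x => f x + s k * hinge (dotp v x - tau))) => //.
- by move=> k; apply: convex_onD => //; exact: ch.
- by apply: convex_onD => //; exact: ch.
apply: cvg_luD; first exact: cvg_lu_cst.
apply: (@cvg_lu_ridge _ _ U (fun k t => s k * hinge (t - tau)) (fun t => a * hinge (t - tau))).
apply: (@cvg_lu1Z _ (fun _ t => hinge (t - tau))) => //; last exact: hinge_bdd.
by move=> M e e0; apply: nearW => k t _; rewrite subrr normr0.
Qed.

(** The sign [s] selects the side of the kink containing the support: for 1 the hinge is affine
    there and removed by invariance, for -1 it is zero. *)
Lemma P_hinge_local f v (t s delta : R) phi : convex_on U f -> s = 1 \/ s = -1 -> testfun U phi -> 0 < delta ->
  (forall x, phi x != 0 -> delta <= s * (dotp v x - t)) ->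
  P (fun x => f x + hinge (dotp v x - t)) phi = P f phi.
Proof.
move=> cf s1 tp d0 H.
have cd : continuous (fun x => s * (dotp v x - t)).
  apply: rV_contM; first exact: cst_continuous.
  apply: (rV_contD _ (@cst_continuous _ _ (- t))); exact: dotp_continuous.
have tp' := testfun_away tp cd d0 H.
have oV : open (U `&` [set x | 0 < s * (dotp v x - t)]).
  apply: openI => //; apply: (@open_comp _ _ (fun x => s * (dotp v x - t)) [set r | 0 < r]); last exact: open_gt.
  by move=> x _; exact: cd.
have c1 : convex_on U (fun x => f x + hinge (dotp v x - t)).
  by apply: convex_onD => //; exact: convex_on_hinge.
case: s1 => s1; rewrite s1 in tp' oV.
  rewrite -(Pinv cf (affine_dotp v (- t)) tp); apply: Ploc tp' => //.
  - by apply: convex_onD => //; apply: convex_on_affine; exact: affine_dotp.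
  - by move=> x [_ /=]; rewrite mul1r => xt; rewrite hinge_pos// ltW.
apply: Ploc tp' => //.
by move=> x [_ /=]; rewrite mulN1r oppr_gt0 => xt; rewrite hinge_neg ?addr0// ltW.
Qed.


(** The 2N open half-spaces cut out by the hyperplanes cover every point that is not on all of them.
    [T] is left abstract because this is applied both to [P] at a cone and to the difference between
    [P] and the Monge-Ampere side. *)
Lemma partition_zero (T : ('rV[R]_n -> R) -> R) N (V : 'M[R]_(N, n)) (t : 'I_N -> R) phi K :
  (forall (I : finType) (p : I -> 'rV[R]_n -> R), (forall i, testfun U (p i)) ->
     T (fun x => \sum_i p i x) = \sum_i T (p i)) ->
  (forall j (s delta : R) p, s = 1 \/ s = -1 -> testfun U p -> 0 < delta ->
     (forall x, p x != 0 -> delta <= s * (dotp (row j V) x - t j)) -> T p = 0) ->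
  testfun U phi -> compact K -> supported_in K phi ->
  (forall x, K x -> exists j, dotp (row j V) x != t j) -> T phi = 0.
Proof.
move=> Tsum T0 tp cK sK HK.
pose sg (b : bool) : R := if b then 1 else -1.
pose d (i : 'I_N * bool) x := sg i.2 * (dotp (row i.1 V) x - t i.1).
have cd i : continuous (d i).
  apply: rV_contM; first exact: cst_continuous.
  apply: (rV_contD _ (@cst_continuous _ _ (- t i.1))); exact: dotp_continuous.
have dK x : K x -> exists i, 0 < d i x.
  move=> Kx; have [j] := HK x Kx; rewrite neq_lt => /orP[H|H].
    by exists (j, false); rewrite /d /= mulN1r oppr_gt0 subr_lt0.
  by exists (j, true); rewrite /d /= mul1r subr_gt0.
have [delta [chi [d0 cchi pE chid]]] := partition_pos cK sK cd dK.
have -> : phi = fun x => \sum_i chi i x * phi x by apply/funext.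
rewrite Tsum; last by move=> i; exact: testfunM.
apply: big1 => i _; apply: (T0 i.1 (sg i.2) delta) => //.
- by case: (i.2); [left|right].
- exact: testfunM.
- by move=> x H; apply: (chid i x); apply: contraNneq H => ->; rewrite mul0r.
Qed.

Definition cone (V : 'M[R]_n) (x0 : 'rV[R]_n) := hs V (fun j => dotp (row j V) x0).
Lemma rank_dilate0 (V : 'M[R]_n) j : (\rank (dilate j 0 *m V) < n)%N.
Proof.
rewrite ltn_neqAle rank_leq_row andbT -[_ == _]/(row_free _) row_free_unit unitmxE det_dilate mul0r.
by rewrite unitfE eqxx.
Qed.
Lemma P_cone_rest (V : 'M[R]_n) (t : 'I_n -> R) j phi : testfun U phi ->
  P (fun x => \sum_(i | i != j) hinge (dotp (row i V) x - t i)) phi = 0.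
Proof.
move=> tp; apply: (P_rank (rank_dilate0 V j)) => //.
  by apply: convex_on_sum => i; exact: convex_on_hinge.
move=> x y H; apply: eq_bigr => i ij; congr (hinge (_ - _)).
have := H i; rewrite (_ : row i _ = row i V)//.
by apply/rowP => k; rewrite mxE dilateE (negbTE ij) mul1r mxE.
Qed.

Lemma P_cone_vanish (V : 'M[R]_n) x0 phi (r : R) : V \in unitmx -> testfun U phi -> 0 < r ->
  (forall x, phi x != 0 -> r <= `|x - x0|) -> P (cone V x0) phi = 0.
Proof.
move=> uV tp r0 Hr.
have [cp [K [cK [KU sK]]]] := tp.
pose K' := K `&` [set x | r <= `|x - x0|].
have cK' : compact K'.
  apply: (subclosed_compact _ cK); last by move=> x [].
  apply: closedI; first by apply: compact_closed => //; exact: norm_hausdorff.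
  apply: (@preimage_closed _ _ (fun x : 'rV[R]_n => `|x - x0|) [set t | r <= t]); last exact: closed_ge.
  move=> x _; apply/rV_continuousP => e e0; exists e => // y xy.
  by rewrite (le_lt_trans (ler_dist_dist _ _))// opprB addrA subrK.
apply: (@partition_zero (P (cone V x0)) n V (fun j => dotp (row j V) x0) phi K') => //.
- by move=> I p tpp; apply: P_sum => //; exact: convex_on_hs.
- move=> j s delta p s1 tpp d0 H.
  have -> : cone V x0 = fun x => (\sum_(i | i != j) hinge (dotp (row i V) x - dotp (row i V) x0)) + hinge (dotp (row j V) x - dotp (row j V) x0).
    by apply/funext => x; rewrite /cone /hs (bigD1 j)//= addrC.
  rewrite (P_hinge_local _ s1 tpp d0 H); first exact: P_cone_rest.
  by apply: convex_on_sum => i; exact: convex_on_hinge.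
- move=> x nK; have [//|px] := eqVneq (phi x) 0.
  have [Kx|Kx] := pselect (K x); last by rewrite sK.
  by case: nK; split => //; exact: Hr.
- move=> x [Kx /= xr]; apply: contrapT => /forallNP H; move: xr; rewrite leNgt => /negP; apply.
  have -> : x = x0; last by rewrite subrr normr0.
  have uVT : V^T \in unitmx by rewrite unitmx_tr.
  rewrite -(mulmxK uVT x) -(mulmxK uVT x0); congr (_ *m _); apply/rowP => j.
  by rewrite -!dotp_rowE; have := H j; move/negP; rewrite negbK => /eqP.
Qed.

(** Locality alone gives a distribution supported at [x0], which could involve derivatives of the
    Dirac mass. The Radon bound [lv_bounded] excludes them: [phi] is uniformly approximated by test
    functions vanishing near [x0]. *)
Lemma P_cone_zero (V : 'M[R]_n) x0 phi : V \in unitmx -> testfun U phi -> phi x0 = 0 -> P (cone V x0) phi = 0.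
Proof.
move=> uV tp p0.
have [cp [K [cK [KU sK]]]] := tp.
have cf : convex_on U (cone V x0) by exact: convex_on_hs.
have [C HC] := Pbd cf cK KU.
apply/eqP; rewrite -normr_le0; apply/ler_addgt0Pl => e e0; rewrite addr0.
pose d := e / (`|C| + 1).
have C1 : 0 < `|C| + 1 by rewrite ltr_wpDl.
have d0 : 0 < d by rewrite divr_gt0.
(* soft thresholding: [S] vanishes near [x0] and stays within [d] of [phi] *)
pose S x := hinge (phi x - d) - hinge (- phi x - d).
have cS : continuous S.
  apply: rV_contD; first exact: rV_cont_hinge.
  by apply: rV_contN; apply: rV_cont_hinge; exact: rV_contN.
have S0 x : `|phi x| <= d -> S x = 0.
  by rewrite ler_norml => /andP[? ?]; rewrite /S !hinge_neg ?subrr//; lra.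
have tS : testfun U S.
  by split => //; exists K; split => //; split => // x Kx; rewrite S0// sK// normr0 ltW.
have Sd x : `|phi x - S x| <= d.
  by rewrite /S; case: (hinge_cases (phi x - d)) => -[? ->]; case: (hinge_cases (- phi x - d)) => -[? ->]; rewrite ler_norml; apply/andP; split; lra.
have PS : P (cone V x0) S = 0.
  have /rV_continuousP/(_ _ d0)[r r0 Hr] := cp x0.
  apply: (P_cone_vanish uV tS r0) => x; apply: contraNle; rewrite distrC => /Hr.
  by rewrite p0 sub0r normrN => /ltW/S0 ->.
have td : testfun U (fun x => d^-1 * (1 * phi x + (-1) * S x)).
  by apply: testfunZ; apply: testfunD; exact: testfunZ.
have := HC _ td; rewrite (_ : (fun x => _) = (fun x => d^-1 * phi x + (- d^-1) * S x)); last first.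
  by apply/funext => x; ring.
rewrite Plin// PS mulr0 addr0 normrM gtr0_norm ?invr_gt0// => H.
have {}H : d^-1 * `|P (cone V x0) phi| <= C.
  apply: H => x.
    by move=> Kx; rewrite sK// S0 ?sK// ?normr0 ?mulr0 ?addr0// ltW.
  rewrite mul1r mulN1r normrM [X in X * _]gtr0_norm ?invr_gt0// mulrC ler_pdivrMr// mul1r; exact: Sd.
move: H; rewrite ler_pdivrMl// => H.
rewrite (le_trans H)// /d mulrAC ler_pdivrMr// ler_pM2l// (le_trans (ler_norm _))// lerDl//.
Qed.

Lemma P_cone_mult (V : 'M[R]_n) x0 phi b : V \in unitmx -> testfun U phi -> testfun U b ->
  b x0 * P (cone V x0) phi = phi x0 * P (cone V x0) b.
Proof.
move=> uV tp tb; have cf : convex_on U (cone V x0) by exact: convex_on_hs.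
have H : P (cone V x0) (fun x => b x0 * phi x + (- phi x0) * b x) = 0.
  by apply: P_cone_zero => //; [apply: testfunD; exact: testfunZ|ring].
by move: H; rewrite Plin// mulNr => /eqP; rewrite subr_eq0 => /eqP.
Qed.

Lemma P_shear_half R0 (a b : 'rV[R]_n -> R) phi : convex_on U R0 -> testfun U phi -> affine a -> affine b -> affine (fun x => a x + b x) ->
  P (fun x => R0 x + Num.max (Num.max 0 (b x)) (a x + b x)) phi + P (fun x => R0 x + Num.max (Num.max 0 (a x)) (a x + b x)) phi =
  P (fun x => R0 x + (hinge (a x) + hinge (b x))) phi + P (fun x => R0 x + hinge (a x + b x)) phi.
Proof.
move=> cR tp Aa Ab Aab.
have ca l : affine l -> convex_on U l by exact: convex_on_affine.
have cmx l l' : affine l -> affine l' -> convex_on U (fun x => R0 x + Num.max (Num.max 0 (l x)) (l' x)).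
  by move=> al al'; apply: convex_onD => //; apply: convex_on_max; [apply: convex_on_max; [exact: convex_on_cst|exact: ca]|exact: ca].
apply: P_valuation => //; [exact: cmx|exact: cmx| | |].
- by apply: convex_onD => //; apply: convex_on_max; [exact: ca|exact: convex_on_cst].
- by move=> x; rewrite -addr_maxr shear_max1.
- by move=> x; rewrite -addr_minr shear_min1.
Qed.
(** The two valuation identities for the pair of maxima differ only by the affine summand b, so
    their right-hand sides agree. The two vanishing hypotheses dispose of the minima; for cones they
    hold because one direction is then missing. *)
Lemma P_shear R0 va vb (ta tb : R) phi : convex_on U R0 -> testfun U phi ->
  P (fun x => R0 x + hinge ((dotp va x - ta) + (dotp vb x - tb))) phi = 0 ->
  P (fun x => R0 x + hinge (dotp va x - ta)) phi = 0 ->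
  P (fun x => R0 x + (hinge ((dotp va x - ta) + (dotp vb x - tb)) + hinge (dotp vb x - tb))) phi =
  P (fun x => R0 x + (hinge (dotp va x - ta) + hinge (dotp vb x - tb))) phi.
Proof.
move=> cR tp z1 z2.
pose a x := dotp va x - ta; pose b x := dotp vb x - tb.
have Aa : affine a by exact: affine_dotp.
have Ab : affine b by exact: affine_dotp.
have Aab : affine (fun x => a x + b x).
  rewrite (_ : (fun x => _) = (fun x => dotp (va + vb) x + (- ta - tb))); first exact: affine_dotp.
  by apply/funext => x; rewrite /a /b dotpDl; ring.
have H1 := P_shear_half cR tp Aa Ab Aab.
rewrite z1 addr0 in H1.
have ca l : affine l -> convex_on U l by exact: convex_on_affine.
have cmx l l' : affine l -> affine l' -> convex_on U (fun x => R0 x + Num.max (Num.max 0 (l x)) (l' x)).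
  by move=> al al'; apply: convex_onD => //; apply: convex_on_max; [apply: convex_on_max; [exact: convex_on_cst|exact: ca]|exact: ca].
have H2 : P (fun x => R0 x + Num.max (Num.max 0 (b x)) (a x + b x)) phi +
    P (fun x => R0 x + Num.max (Num.max 0 (a x)) (a x + b x) + b x) phi =
    P (fun x => R0 x + (hinge (a x + b x) + hinge (b x))) phi + P (fun x => R0 x + hinge (a x) + b x) phi.
  apply: P_valuation => //; [exact: cmx| | | |].
  - by apply: convex_onD; [exact: cmx|exact: ca].
  - by apply: convex_onD; [apply: convex_onD => //; apply: convex_on_max; [exact: ca|exact: convex_on_cst]|exact: ca].
  - by move=> x; rewrite -[X in Num.max _ X]addrA -addr_maxr shear_max2.
  - by move=> x; rewrite -[X in Num.min _ X]addrA -addr_minr -addrA shear_min2.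
rewrite (Pinv (cmx _ _ Aa Aab) Ab tp) in H2.
have ch : convex_on U (fun x => R0 x + hinge (a x)).
  by apply: convex_onD => //; apply: convex_on_max; [exact: ca|exact: convex_on_cst].
rewrite (Pinv ch Ab tp) in H2.
by rewrite z2 addr0 in H2; rewrite -[LHS]H2 -[RHS]H1.
Qed.
End Valuation.

(** [lv_cont] speaks of sequences only, so the continuity of the density is tested on sequences, and
    those converging at rate [eps] suffice. *)
Lemma rV_seq_continuous (R : realType) n (f : 'rV[R]_n -> R) x :
  (forall y : nat -> 'rV[R]_n, (forall k, `|x - y k| < eps R k) -> f (y k) @[k --> \oo] --> f x) ->
  {for x, continuous f}.
Proof.
move=> H; apply/rV_continuousP => e e0; apply: contrapT => nH.
have {}nH k : exists y, `|x - y| < eps R k /\ e <= `|f x - f y|.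
  apply: contrapT => /forallNP nH'; apply: nH; exists (eps R k); first exact: eps_gt0.
  by move=> y xy; rewrite ltNge; apply/negP => ey; apply: (nH' y).
have [y Hy] := choice nH.
have /cvgrPdist_lt/(_ e e0) := H y (fun k => (Hy k).1).
by case=> k _ /(_ k (leqnn _)) /=; rewrite ltNge (Hy k).2.
Qed.

Lemma bump_exists (R : realType) n (U : set 'rV[R]_n) x : open U -> U x ->
  exists b, testfun U b /\ b x = 1.
Proof.
move=> oU Ux.
have /rV_nbhsP[d d0 Hd] : nbhs x U by exact: open_nbhs_nbhs.
have r0 : 0 < d / 2 by rewrite divr_gt0.
have cd : continuous (fun y : 'rV[R]_n => `|y - x|).
  move=> y; apply/rV_continuousP => e e0; exists e => // z yz.
  by rewrite (le_lt_trans (ler_dist_dist _ _))// opprB addrA subrK.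
exists (fun y => hinge (- ((d / 2)^-1 * `|y - x|) - -1)); split; last first.
  by rewrite subrr normr0 mulr0 oppr0 sub0r opprK hinge_pos.
split.
  by apply: rV_cont_hinge; apply: rV_contN; apply: rV_contM => //; exact: cst_continuous.
exists [set y | `|y - x| <= d / 2]; split; last split.
- apply: bounded_closed_compact.
    exists (d / 2 + `|x|); split; first by rewrite num_real.
    move=> M BM y /= Ky; rewrite -(subrK x y) (le_trans (ler_normD _ _))// ltW//.
    by rewrite (le_lt_trans _ BM)// lerD2r.
  apply: (@preimage_closed _ _ (fun y : 'rV[R]_n => `|y - x|) [set t | t <= d / 2]); last exact: closed_le.
  by move=> y _; exact: cd.
- by move=> y /= yx; apply: Hd; rewrite distrC (le_lt_trans yx)//; lra.
- move=> y /= /negP; rewrite -ltNge => yx; rewrite hinge_neg// opprK addrC subr_le0.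
  by rewrite -ler_pdivrMl ?invr_gt0// invrK mulr1 ltW.
Qed.

(** * The density [psi] and the identity on hinge sums *)

Section VertexDensity.
Variables (R : realType) (n : nat) (U : set 'rV[R]_n).
Variable P : ('rV[R]_n -> R) -> ('rV[R]_n -> R) -> R.
Hypothesis HP : locval U P.
Implicit Types (f h phi : 'rV[R]_n -> R).

Lemma cvg_lu_hs N (V : 'M[R]_(N, n)) (t : nat -> 'I_N -> R) t0 :
  (forall j, t k j @[k --> \oo] --> t0 j) -> cvg_loc_unif U (fun k => hs V (t k)) (hs V t0).
Proof.
move=> tt; apply: cvg_lu_sum => j.
apply: (@cvg_lu_ridge _ _ U (fun k s => hinge (s - t k j)) (fun s => hinge (s - t0 j))).
move=> M e e0; have /cvgrPdist_lt/(_ e e0) := tt j; apply: filterS => k H s _.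
by rewrite (le_lt_trans (hinge_lip _ _))// (_ : _ - _ = t0 j - t k j)//; ring.
Qed.

(** [psi x] is the value of the standard cone at [x] on a bump equal to 1 at [x]. These bumps are
    chosen without any continuity in [x]; near a fixed [x] its own bump is kept, and psi(y) is the
    value of the cone at y on it, divided by its value at y. *)
Lemma psi_exists : exists psi : 'rV[R]_n -> R, (forall x, U x -> {for x, continuous psi}) /\
  forall x phi, U x -> testfun U phi -> P (cone 1%:M x) phi = psi x * phi x.
Proof.
have hb x : exists b, U x -> testfun U b /\ b x = 1.
  have [Ux|nUx] := pselect (U x); last by exists (fun=> 0).
  by have [b Hb] := bump_exists (lv_open HP) Ux; exists b.
have [b Hb] := choice hb.
pose psi x := P (cone 1%:M x) (b x).
have main x phi : U x -> testfun U phi -> P (cone 1%:M x) phi = psi x * phi x.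
  move=> Ux tp; have [tb b1] := Hb x Ux.
  by have := P_cone_mult HP x (unitmx1 R n) tp tb; rewrite b1 mul1r mulrC.
exists psi; split => // x Ux.
have [tb b1] := Hb x Ux.
apply: rV_seq_continuous => y Hy.
have cb : b x (y k) @[k --> \oo] --> (1 : R).
  apply/cvgrPdist_lt => e e0; have /rV_continuousP/(_ e e0)[d d0 Hd] := tb.1 x.
  by apply: filterS (eps_lt d0) => k kd; rewrite -b1; apply: Hd; exact: lt_trans (Hy k) kd.
have cP : P (cone 1%:M (y k)) (b x) @[k --> \oo] --> psi x.
  apply: (lv_cont HP) => //; [move=> k; exact: convex_on_hs|exact: convex_on_hs|].
  apply: cvg_lu_hs => j; apply/cvgrPdist_lt => e e0.
  have S0 : 0 < 1 + \sum_i `|(row j (1%:M : 'M[R]_n)) 0 i| by rewrite ltr_pwDl// sumr_ge0.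
  apply: filterS (eps_lt (divr_gt0 e0 S0)) => k; rewrite ltr_pdivlMr// => ke.
  rewrite -dotpBr (le_lt_trans (dotp_le _ _))// mulrC (le_lt_trans _ ke)// ler_pM// ?sumr_ge0//.
    exact: ltW.
  by rewrite lerDr.
have /rV_nbhsP[d d0 Hd] : nbhs x U by apply: open_nbhs_nbhs; split => //; exact: lv_open HP.
have Q : (fun k => P (cone 1%:M (y k)) (b x) * (b x (y k))^-1) @ \oo --> psi x.
  have := cvgM cP (cvgV (oner_neq0 R) cb); rewrite invr1 mulr1; exact.
apply: cvg_trans Q; apply: near_eq_cvg.
have half : (0 : R) < 1 / 2 by rewrite divr_gt0.
have /cvgrPdist_lt/(_ _ half) := cb.
apply: filterS2 (eps_lt d0) => k kd bk.
rewrite main//; last by apply: Hd; exact: lt_trans (Hy k) kd.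
rewrite mulfK// gt_eqF//; move: bk; rewrite ltr_norml => /andP[]; lra.
Qed.

Lemma coneE_dilate (V : 'M[R]_n) x0 i c x : cone (dilate i c *m V) x0 x =
  \sum_(k | k != i) hinge (dotp (row k V) x - dotp (row k V) x0) + hinge (c * (dotp (row i V) x - dotp (row i V) x0)).
Proof.
rewrite /cone /hs (bigD1 i)//= addrC; congr (_ + _).
  apply: eq_bigr => k ki; rewrite (_ : row k _ = row k V)//.
  by apply/rowP => l; rewrite mxE dilateE (negbTE ki) mul1r mxE.
rewrite (_ : row i _ = c *: row i V) ?dotpZl ?mulrBr//.
by apply/rowP => l; rewrite mxE dilateE eqxx !mxE.
Qed.
Lemma coneE (V : 'M[R]_n) x0 i x : cone V x0 x =
  \sum_(k | k != i) hinge (dotp (row k V) x - dotp (row k V) x0) + hinge (dotp (row i V) x - dotp (row i V) x0).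
Proof. by rewrite /cone /hs (bigD1 i)//= addrC. Qed.

(** For negative [c], hinge(c t) is |c| hinge(t) plus the linear term c t, which invariance
    removes. *)
Lemma P_cone_dilate (V : 'M[R]_n) x0 i c phi : testfun U phi ->
  P (cone (dilate i c *m V) x0) phi = `|c| * P (cone V x0) phi.
Proof.
move=> tp.
pose f x := \sum_(k | k != i) hinge (dotp (row k V) x - dotp (row k V) x0).
have cf : convex_on U f by apply: convex_on_sum => k; exact: convex_on_hinge.
have Pf : P f phi = 0 by exact: P_cone_rest HP _ _ _ _ tp.
have lin d : 0 <= d -> P (fun x => f x + d * hinge (dotp (row i V) x - dotp (row i V) x0)) phi = d * P (cone V x0) phi.
  move=> d0; have := P_hinge_linear HP (row i V) (dotp (row i V) x0) cf d0 tp.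
  rewrite Pf !subr0 => ->; congr (_ * P _ _); apply/funext => x; exact/esym/coneE.
have ch d : 0 <= d -> convex_on U (fun x => f x + d * hinge (dotp (row i V) x - dotp (row i V) x0)).
  move=> d0; apply: convex_onD => //.
  exact: (@convex_on_ridge R n U (fun t => d * hinge (t - dotp (row i V) x0)) (row i V) (cvx1_hinge _ d0)).
have [c0|c0] := leP 0 c.
  rewrite ger0_norm// -lin//; congr P; apply/funext => x.
  by rewrite coneE_dilate hingeM.
rewrite ltr0_norm// -lin; last by rewrite oppr_ge0 ltW.
rewrite -[RHS](lv_inv HP _ (affine_dotp (c *: row i V) (- (c * dotp (row i V) x0))))//; last by apply: ch; rewrite oppr_ge0 ltW.
congr P; apply/funext => x; rewrite coneE_dilate -addrA; congr (_ + _).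
rewrite dotpZl -mulrBr; set t := _ - _.
by rewrite -{1}[c]opprK mulNr -mulrN hingeM ?oppr_ge0 ?ltW// [hinge t]hingeN; ring.
Qed.

Lemma P_cone_shear1 (V : 'M[R]_n) x0 i j phi : i != j -> testfun U phi ->
  P (cone (shear i j 1 *m V) x0) phi = P (cone V x0) phi.
Proof.
move=> ij tp.
pose V' := shear i j 1 *m V.
have ji : j != i by rewrite eq_sym.
have rk k : k != i -> row k V' = row k V.
  by move=> ki; apply/rowP => l; rewrite mxE shearE (negbTE ki) mul0r addr0 mxE.
have ri : row i V' = row i V + row j V.
  by apply/rowP => l; rewrite mxE shearE eqxx !mul1r !mxE.
pose R0 x := \sum_(k | (k != j) && (k != i)) hinge (dotp (row k V) x - dotp (row k V) x0).
have R0E x : \sum_(k | (k != j) && (k != i)) hinge (dotp (row k V') x - dotp (row k V') x0) = R0 x.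
  by apply: eq_bigr => k /andP[kj ki]; rewrite rk.
have E1 x : cone V' x0 x = R0 x + (hinge ((dotp (row i V) x - dotp (row i V) x0) + (dotp (row j V) x - dotp (row j V) x0)) + hinge (dotp (row j V) x - dotp (row j V) x0)).
  rewrite (coneE _ _ j) (bigD1 i)//= R0E (rk j)// ri !dotpDl [_ + R0 x]addrC addrA; congr (_ + hinge _ + _); ring.
have E2 x : cone V x0 x = R0 x + (hinge (dotp (row i V) x - dotp (row i V) x0) + hinge (dotp (row j V) x - dotp (row j V) x0)).
  by rewrite (coneE _ _ j) (bigD1 i)//= [_ + R0 x]addrC addrA.
rewrite -/V' (funext E1) (funext E2).
apply: (P_shear HP) => //.
- by apply: convex_on_sum => k; exact: convex_on_hinge.
- rewrite -[RHS](P_cone_rest HP V' (fun k => dotp (row k V') x0) j tp); congr P; apply/funext => x.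
  by rewrite (bigD1 i)//= R0E ri !dotpDl [RHS]addrC; congr (_ + hinge _); ring.
- rewrite -[RHS](P_cone_rest HP V (fun k => dotp (row k V) x0) j tp); congr P; apply/funext => x.
  by rewrite (bigD1 i)//= [RHS]addrC.
Qed.

Lemma P_cone_det (V : 'M[R]_n) x0 phi : V \in unitmx -> testfun U phi ->
  P (cone V x0) phi = `|\det V| * P (cone 1%:M x0) phi.
Proof.
move=> + tp; move: V; apply: unitmx_rowop_ind.
- by rewrite det1 normr1 mul1r.
- move=> V i j s ij uV IH; rewrite det_shear//.
  have [->|s0] := eqVneq s 0.
    by rewrite (_ : shear i j 0 = 1%:M) ?mul1mx// /shear scale0r addr0.
  (* Conjugating by a dilation of row [j] reduces the shear to the one by 1 handled by the valuation
     property; the two scaling factors cancel. *)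
  have -> : shear i j s *m V = dilate j s^-1 *m (shear i j 1 *m (dilate j s *m V)).
    apply/matrixP => k l; rewrite [LHS]shearE [RHS]dilateE [in RHS](shearE (dilate j s *m V)) 2![in RHS](dilateE V) eqxx mul1r.
    case: (eqVneq k j) => [->|kj]; last by rewrite !mul1r.
    by rewrite [j == i]eq_sym (negbTE ij) !mul0r !addr0 mulKf.
  by rewrite P_cone_dilate// P_cone_shear1// P_cone_dilate// IH normfV mulKf// normr_eq0.
- by move=> V i c c0 uV IH; rewrite P_cone_dilate// IH det_dilate normrM mulrA.
Qed.

Variable MA : ('rV[R]_n -> R) -> ('rV[R]_n -> R) -> R.
Hypothesis hMA : is_MongeAmpere U MA.
Variable psi : 'rV[R]_n -> R.
Hypothesis psi_cont : forall x, U x -> {for x, continuous psi}.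
Hypothesis psiP : forall x phi, U x -> testfun U phi -> P (cone 1%:M x) phi = psi x * phi x.

(** The equation [e] lets the square case be used on a matrix whose number of rows is only provably
    n, as happens in the induction of [P_hs]. *)
Lemma P_hs_square N (e : n = N) (V : 'M[R]_(N, n)) t phi : testfun U phi -> \rank V = n ->
  P (hs V t) phi = MA (hs V t) (fun x => psi x * phi x).
Proof.
case: N / e V t => V t tp rV.
have uV : V \in unitmx by rewrite -row_free_unit /row_free rV.
rewrite (MA_hs_square hMA)//; last exact: testfun_psi.
have -> : hs V t = cone V (vertex V t).
  by apply/funext => x; apply: eq_bigr => j _; rewrite vertexP.
have [Ux|nUx] := pselect (U (vertex V t)).
  by rewrite P_cone_det// psiP.
have p0 : phi (vertex V t) = 0 by have [_ [K [_ [KU sK]]]] := tp; apply: sK => /KU.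
by rewrite (P_cone_zero HP)// p0 !mulr0.
Qed.

Lemma MA_hs_sum N (V : 'M[R]_(N, n)) t (I : Type) (r : seq I) (p : I -> 'rV[R]_n -> R) :
  (forall i, testfun U (p i)) -> MA (hs V t) (fun x => \sum_(i <- r) p i x) = \sum_(i <- r) MA (hs V t) (p i).
Proof.
move=> tp; elim: r => [|i r IH].
  under eq_fun do rewrite big_nil; rewrite big_nil.
  have := MA_hs_lin hMA V t 0 0 (testfun0 U) (testfun0 U); under eq_fun do rewrite !mul0r addr0.
  by move=> ->; rewrite !mul0r addr0.
rewrite big_cons -IH; have := MA_hs_lin hMA V t 1 1 (tp i) (testfun_sum r tp); rewrite !mul1r => <-.
by congr MA; apply/funext => x; rewrite big_cons !mul1r.
Qed.

Lemma P_hs N (V : 'M[R]_(N, n)) t phi : testfun U phi ->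
  P (hs V t) phi = MA (hs V t) (fun x => psi x * phi x).
Proof.
elim: N V t phi => [|N IH] V t phi tp; have tpsi := testfun_psi psi_cont tp;
  have [rV|rV] := ltnP (\rank V) n.
- rewrite (MA_hs_rank hMA)//; apply: (P_rank HP rV) => //; first exact: convex_on_hs.
  by move=> x y H; rewrite /hs !big_ord0.
- apply: P_hs_square => //; last by apply/eqP; rewrite eqn_leq rV rank_leq_col.
  by apply/eqP; rewrite -leqn0 (leq_trans rV)// rank_leq_row.
- rewrite (MA_hs_rank hMA)//; apply: (P_rank HP rV) => //; first exact: convex_on_hs.
  by move=> x y H; apply: eq_bigr => j _; rewrite H.
have rVn : \rank V = n by apply/eqP; rewrite eqn_leq rV rank_leq_col.
have [nN|nN] := eqVneq n N.+1; first exact: P_hs_square.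
have ltnN : (n < N.+1)%N by rewrite ltn_neqAle nN -rVn rank_leq_row.
(* With more than n rows there is a nonzero linear relation [al] among them. The hyperplanes can
   have a common point only if the offsets satisfy the same relation. *)
have [i /rowV0Pn[al /sub_kermxP alV al0]] : exists i : 'I_1, kermx V != 0.
  by exists ord0; rewrite kermx_eq0 /row_free rVn.
have key t' : \sum_j al 0 j * t' j != 0 -> P (hs V t') phi = MA (hs V t') (fun x => psi x * phi x).
  move=> st.
  have [_ [K [cK [KU sK]]]] := tp.
  apply/eqP; rewrite -subr_eq0; apply/eqP.
  apply: (@partition_zero R n U (fun phi => P (hs V t') phi - MA (hs V t') (fun x => psi x * phi x)) _ V t' phi K) => //.
  - move=> J p tpp; rewrite (P_sum HP)//; last exact: convex_on_hs.
    rewrite sumrB; congr (_ - _); rewrite -MA_hs_sum; last by move=> j; exact: testfun_psi.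
    by congr MA; apply/funext => x; rewrite mulr_sumr.
  - move=> j s delta p s1 tpp d0 H.
    have -> : P (hs V t') p = P (hs (row' j V) (t' \o lift j)) p.
      have E : hs V t' = fun x => hs (row' j V) (t' \o lift j) x + hinge (dotp (row j V) x - t' j).
        apply/funext => x; rewrite /hs (bigD1_ord j)//= addrC; congr (_ + _).
        by apply: eq_bigr => k _; rewrite -!row_rowsub.
      rewrite E; apply: (P_hinge_local HP _ s1 tpp d0 H); exact: convex_on_hs.
    rewrite (MA_hs_local hMA (d := delta) (j := j))//; last 2 first.
    - exact: testfun_psi.
    - move=> x H'; have px : p x != 0 by apply: contraNneq H' => ->; rewrite mulr0.
      rewrite (le_trans (H x px))//; case: s1 => ->; first by rewrite mul1r ler_norm.
      by rewrite mulN1r -normrN ler_norm.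
    by rewrite IH// subrr.
  - move=> x Kx; apply: contrapT => /forallNP Hx; move/negP: st; apply; apply/eqP.
    have Hx' j : t' j = (x *m V^T) 0 j by rewrite -dotp_rowE; have := Hx j => /negP; rewrite negbK => /eqP.
    have -> : \sum_j al 0 j * t' j = (x *m (al *m V)^T) 0 0.
      rewrite trmx_mul mulmxA mxE; apply: eq_bigr => j _.
      by rewrite Hx' mulrC [al^T _ _]mxE.
    by rewrite alV trmx0 mulmx0 mxE.
have [s0|] := eqVneq (\sum_j al 0 j * t j) 0; last exact: key.
have al2 : 0 < \sum_j al 0 j ^+ 2.
  rewrite lt_neqAle sumr_ge0 ?andbT; last by move=> j _; exact: sqr_ge0.
  rewrite eq_sym psumr_eq0; last by move=> j _; exact: sqr_ge0.
  apply: contra al0 => /allP H; apply/eqP/rowP => j; rewrite mxE.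
  by have := H j; rewrite mem_index_enum sqrf_eq0 => /(_ isT)/eqP.
(* Moving the offsets along [al] itself gives the relation the value eps_k |al|^2, which is
   positive, so the hyperplanes have no common point. *)
pose tk k j := t j + eps R k * al 0 j.
have tkP k : P (hs V (tk k)) phi = MA (hs V (tk k)) (fun x => psi x * phi x).
  apply: key; rewrite /tk; under eq_bigr do rewrite mulrDr mulrCA -expr2.
  by rewrite big_split /= s0 add0r -mulr_sumr mulf_neq0// gt_eqF// eps_gt0.
have ctk : cvg_loc_unif U (fun k => hs V (tk k)) (hs V t).
  apply: cvg_lu_hs => j; rewrite /tk -[X in _ --> X]addr0; apply: cvgD; first exact: cvg_cst.
  rewrite -(mul0r (al 0 j)); apply: cvgM; [exact: eps_cvg|exact: cvg_cst].
apply: (cvg_near_unique (lv_cont HP (fun k => @convex_on_hs R n U _ V (tk k)) (@convex_on_hs R n U _ V t) ctk tp)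
   (hMA.2 _ _ (fun k => @convex_on_hs R n U _ V (tk k)) (@convex_on_hs R n U _ V t) ctk _ tpsi)).
by apply: nearW => k.
Qed.
End VertexDensity.

(** * Convex exponential sums *)

Section PiecewiseLinear.
Variable R : realType.
Implicit Types (G : R -> R) (s : R).

(* Convex piecewise linear functions vanishing near [-oo], with all kinks at most [tau]. *)
Inductive pl : R -> (R -> R) -> Prop :=
| pl_zero tau : pl tau (fun=> 0)
| pl_kink tau tau' G c : pl tau G -> tau <= tau' -> 0 <= c -> pl tau' (fun s => G s + c * hinge (s - tau')).

Lemma cvx1D g g' : cvx1 g -> cvx1 g' -> cvx1 (fun s : R => g s + g' s).
Proof. by move=> c1 c2 s t a a0 a1; rewrite !mulrDr addrACA lerD// ?c1 ?c2. Qed.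
(** Supplies the hypotheses of [P_insert]: beyond its last kink [G] is a line, and it lies above
    that line everywhere. This is why [pl] adds kinks from left to right. *)
Lemma pl_line tau G : pl tau G -> cvx1 G /\ exists sg ka, (forall s, sg * s + ka <= G s) /\
  (forall s, tau <= s -> G s = sg * s + ka).
Proof.
elim => {tau G} [tau|tau tau' G c _ [cG [sg [ka [H1 H2]]]] tt c0].
  split; first by move=> s t a a0 a1; rewrite !mulr0 addr0.
  by exists 0, 0; split => s; rewrite mul0r addr0.
split; first by apply: cvx1D => //; exact: cvx1_hinge.
exists (sg + c), (ka - c * tau'); split => s.
  rewrite (_ : _ + _ = (sg * s + ka) + c * (s - tau')); last by ring.
  by rewrite lerD// ler_wpM2l// le_max lexx.
by move=> ts; rewrite (H2 _ (le_trans tt ts)) hinge_pos; [ring|rewrite subr_ge0].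
Qed.

(* Chord interpolation of [expR s - expR (- M)] on the grid [- M + i * h], extended by [0] to the left of [- M]. *)
Section Interp.
Variables (M h : R).
Hypothesis h0 : 0 < h.
Definition grid (i : nat) : R := - M + i%:R * h.
Definition slope (i : nat) : R := (expR (grid i.+1) - expR (grid i)) / h.
Definition slope_left (i : nat) : R := if i is j.+1 then slope j else 0.
Fixpoint interp (i : nat) : R -> R :=
  if i is j.+1 then fun s => interp j s + (slope j - slope_left j) * hinge (s - grid j) else fun=> 0.
Lemma gridS i : grid i.+1 = grid i + h.
Proof. by rewrite /grid -natr1; ring. Qed.
Lemma slope_ge0 i : 0 <= slope i.
Proof. by rewrite divr_ge0// ?(ltW h0)// subr_ge0 ler_expR gridS lerDl ltW. Qed.
Lemma slope_mono i : slope_left i <= slope i.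
Proof.
case: i => [|i] /=; first exact: slope_ge0.
rewrite /slope ler_pM2r ?invr_gt0// !gridS (expRD (grid i + h) h) (expRD (grid i) h).
have e0 := expR_gt0 (grid i); have e1 : 1 <= expR h by rewrite -expR0 ler_expR ltW.
rewrite -subr_ge0 (_ : _ - _ = expR (grid i) * (expR h - 1) ^+ 2); last by ring.
by rewrite mulr_ge0 ?sqr_ge0// ltW.
Qed.
Lemma interp_pl i : pl (grid i) (interp i).
Proof.
elim: i => [|i IH]; first exact: pl_zero.
have H : pl (grid i) (interp i.+1).
  by apply: (@pl_kink (grid i)) => //; rewrite subr_ge0 slope_mono.
(* A kink of coefficient 0 moves the bound on the kinks from [grid i] to [grid i.+1] without
   changing the function. *)
have := @pl_kink _ (grid i.+1) _ 0 H; rewrite gridS lerDl (ltW h0) => /(_ isT (lexx 0)).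
by congr pl; apply/funext => s; rewrite mul0r addr0.
Qed.
(** For positive i the hypothesis says that [s] is not before the last kink, one step before
    [grid i]; the formula is the last chord, written from its right end. *)
Lemma interp_line i s : grid i <= s + h -> interp i s = (expR (grid i) - expR (- M)) + slope_left i * (s - grid i) \/ i = 0%N.
Proof.
elim: i s => [|i IH] s si; [by right|left].
rewrite gridS lerD2r in si.
have sh : grid i <= s + h by rewrite (le_trans si)// lerDl ltW.
rewrite /= hinge_pos ?subr_ge0//.
have hS : slope i * h = expR (grid i.+1) - expR (grid i) by rewrite /slope divfK// gt_eqF.
case: (IH s sh) => [->|i0].
  rewrite gridS in hS *; move: hS; set E := expR _; set E' := expR (grid i); set sl := slope i => hS.
  have -> : sl * (s - (grid i + h)) = sl * (s - grid i) - sl * h by ring.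
  rewrite hS; ring.
subst i; rewrite /= subr0 add0r.
have g0 : grid 0 = - M by rewrite /grid mul0r addr0.
rewrite -g0 gridS in hS *; move: hS; set E := expR (_ + _); set E' := expR (grid 0); set sl := slope 0 => hS.
have -> : sl * (s - (grid 0 + h)) = sl * (s - grid 0) - sl * h by ring.
rewrite hS; ring.
Qed.
Lemma interp_close i s : - M <= s -> s <= grid i ->
  `|interp i s - (expR s - expR (- M))| <= expR (grid i) * (expR h - 1).
Proof.
have hh : 0 <= expR h - 1 by rewrite subr_ge0 -expR0 ler_expR ltW.
elim: i s => [|i IH] s sM.
  rewrite /grid mul0r addr0 => sM'; have -> : s = - M by apply/eqP; rewrite eq_le sM sM'.
  by rewrite /= subrr subr0 normr0 mulr_ge0// expR_ge0.
have [si _|si si1] := leP s (grid i).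
  rewrite /= hinge_neg ?subr_le0// mulr0 addr0 (le_trans (IH s sM si))//.
  by rewrite ler_wpM2r// ler_expR gridS lerDl ltW.
have := @interp_line i.+1 s; rewrite gridS lerD2r => /(_ (ltW si)) [|//]; rewrite -gridS => ->.
rewrite (_ : _ - _ = expR (grid i.+1) + slope i * (s - grid i.+1) - expR s); last by rewrite /=; ring.
have es1 : expR (grid i) <= expR s by rewrite ler_expR ltW.
have es2 : expR s <= expR (grid i.+1) by rewrite ler_expR.
have hS : slope i * h = expR (grid i.+1) - expR (grid i) by rewrite /slope divfK// gt_eqF.
have sl0 := slope_ge0 i.
have b1 : slope i * (s - grid i.+1) <= 0 by rewrite mulr_ge0_le0// subr_le0.
have b2 : - (slope i * h) <= slope i * (s - grid i.+1).
  by rewrite -mulrN ler_wpM2l// gridS; lra.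
have gE : expR (grid i.+1) = expR (grid i) * expR h by rewrite gridS expRD.
have gE' : expR (grid i.+1) - expR (grid i) <= expR (grid i.+1) * (expR h - 1).
  rewrite (_ : _ - _ = expR (grid i) * (expR h - 1)); last by rewrite gE; ring.
  by rewrite ler_wpM2r// ler_expR gridS lerDl ltW.
rewrite ler_norml; apply/andP; split; lra.
Qed.
End Interp.

Lemma expR_cvg0 (e : R) : 0 < e -> exists2 d : R, 0 < d & expR d - 1 < e.
Proof.
move=> e0; have /cvgrPdist_lt/(_ e e0)[d /= d0 Hd] := @continuous_expR R 0.
exists (d / 2); first by rewrite divr_gt0.
have := Hd (d / 2); rewrite expR0 /= sub0r normrN gtr0_norm ?divr_gt0// => /(_ _).
rewrite distrC; move=> H; rewrite (le_lt_trans (ler_norm _))//; apply: H; lra.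
Qed.

Lemma expR_pl_approx (M e : R) : 0 < e -> exists G, (exists tau, pl tau G) /\ forall s, `|s| <= M -> `|G s - expR s| < e.
Proof.
move=> e0.
have e2 : 0 < e / 2 by rewrite divr_gt0.
(* The window contains [[- M, M]], and 1 + N <= exp N makes the offset exp(- N) smaller than e/2.
   The other e/2 is for the interpolation error, at most exp(N + 1) (exp h - 1), since h <= 1 keeps
   the last node below N + 1. *)
pose N := Num.max (`|M|) (2 / e).
have MN : M <= N by rewrite le_max ler_norm.
have N0 : 0 < N by rewrite lt_max divr_gt0 ?orbT.
have eN : expR (- N) < e / 2.
  rewrite expRN invf_plt ?posrE ?expR_gt0// invf_div.
  have Ne : 2 / e <= N by rewrite le_max lexx orbT.
  have := expR_ge1Dx N; lra.
have [d d0 Hd] := @expR_cvg0 (e / 2 / expR (N + 1)) (divr_gt0 e2 (expR_gt0 _)).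
pose h := Num.min d 1.
have h0 : 0 < h by rewrite lt_min d0 ltr01.
have hd : expR h - 1 < e / 2 / expR (N + 1) by rewrite (le_lt_trans _ Hd)// lerD2r ler_expR ge_min lexx.
pose T := Num.truncn (2 * N / h); pose K := T.+1.
have K1 : 2 * N / h < K%:R by exact: truncnS_gt.
have K2 : T%:R <= 2 * N / h by rewrite truncn_le divr_ge0// ?mulr_ge0// ltW.
have gK : N <= grid N h K.
  by move: K1; rewrite ltr_pdivrMr// /grid => /ltW; lra.
have gK' : grid N h K <= N + 1.
  move: K2; rewrite ler_pdivlMr// /grid /K -(natr1 T) => K2.
  have : h <= 1 by rewrite ge_min lexx orbT.
  by rewrite mulrDl mul1r; lra.
exists (interp N h K); split; first by exists (grid N h K); exact: interp_pl.
move=> s; rewrite ler_norml => /andP[s1 s2].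
have := @interp_close N h h0 K s; have sN : - N <= s by lra.
have sK : s <= grid N h K by lra.
move=> /(_ sN sK) H.
have hh : 0 <= expR h - 1 by rewrite subr_ge0 -expR0 ler_expR ltW.
have H2 : expR (grid N h K) * (expR h - 1) < e / 2.
  apply: (@le_lt_trans _ _ (expR (N + 1) * (expR h - 1))).
    by rewrite ler_wpM2r// ler_expR.
  by rewrite mulrC -ltr_pdivlMr ?expR_gt0.
have p0 := expR_gt0 (- N).
by move: H; rewrite ler_norml ltr_norml => /andP[H3 H4]; apply/andP; split; lra.
Qed.

Lemma expR_pl_cvg : exists G : nat -> R -> R, (forall k, exists tau, pl tau (G k)) /\ cvg_lu1 G (@expR R).
Proof.
have [G HG] := choice (fun k : nat => @expR_pl_approx k%:R (eps R k) (eps_gt0 R k)).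
exists G; split; first by move=> k; exact: (HG k).1.
move=> M e e0; near=> k => s sM.
rewrite (lt_trans ((HG k).2 s _))//.
  by rewrite (le_trans sM)//; near: k; exact: nbhs_infty_ger.
by near: k; exact: eps_lt.
Unshelve. all: by end_near. Qed.
Lemma cvx1_expR : cvx1 (@expR R).
Proof. by move=> s t a a0 a1; exact: (@convex_expR R (Itv01 a0 a1) s t). Qed.
Lemma cvx1Z (c : R) g : 0 <= c -> cvx1 g -> cvx1 (fun s => c * g s).
Proof. by move=> c0 cg s t a a0 a1; rewrite !(mulrCA _ c) -mulrDr ler_wpM2l// cg. Qed.
End PiecewiseLinear.

Section DetRank1.
Variables (F : comUnitRingType) (m : nat).
(** The matrix determinant lemma without inverting [A]: a Schur complement turns the perturbed
    determinant into a bordered one, which is affine in its first row and hence in [s]. *)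
Lemma det_rank1 (A : 'M[F]_m) (u : 'cV[F]_m) (w : 'rV[F]_m) : exists c, forall s, \det (A + s *: (u *m w)) = \det A + s * c.
Proof.
have key s : \det (A + s *: (u *m w)) = \det (block_mx (1%:M : 'M[F]_1) (- s *: w) u A).
  have -> : block_mx (1%:M : 'M[F]_1) (- s *: w) u A = block_mx 1%:M 0 u 1%:M *m block_mx 1%:M (- s *: w) 0 (A + s *: (u *m w)).
    rewrite mulmx_block !mul1mx !mulmx1 !mul0mx !addr0 scaleNr mulmxN -scalemxAr.
    by rewrite addrCA addNr addr0.
  by rewrite det_mulmx det_lblock det_ublock !det1 !mul1r.
exists (\det (block_mx (0 : 'M[F]_1) (- w) u A)) => s.
have <- : \det (block_mx (1%:M : 'M[F]_1) (0 *: w) u A) = \det A.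
  by have := key 0; rewrite scale0r addr0 oppr0 => ->.
rewrite key -[\det (block_mx 1%:M (0 *: w) u A)]mul1r.
have low (B B' : 'rV[F]_(1 + m)) : row' (lshift m (ord0 : 'I_1)) (col_mx B (row_mx u A)) = row' (lshift m (ord0 : 'I_1)) (col_mx B' (row_mx u A)).
  apply/matrixP => k l; rewrite [LHS]mxE [RHS]mxE.
  case: (split_ordP (lift (lshift m ord0) k)) => k' e; last by rewrite e !col_mxEd.
  by have := neq_lift (lshift m (ord0 : 'I_1)) k; rewrite e [k']ord1 eqxx.
apply: (determinant_multilinear (i0 := lshift m (ord0 : 'I_1))); rewrite /block_mx //.
rewrite !rowKu !(row_id) !scale_row_mx add_row_mx.
by congr row_mx; [rewrite scaler0 addr0 scale1r|rewrite scale0r scaler0 add0r scalerN scaleNr].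
Qed.
Lemma det_rank1_extrapolate (A : 'M[F]_m) (u : 'cV[F]_m) (w : 'rV[F]_m) c :
  \det A = 2 * \det (A + c *: (u *m w)) - \det (A + (2 * c) *: (u *m w)).
Proof. by have [d H] := det_rank1 A u w; rewrite !H; ring. Qed.
End DetRank1.

Section ExpSums.
Variables (R : realType) (n : nat) (U : set 'rV[R]_n).
Variable P : ('rV[R]_n -> R) -> ('rV[R]_n -> R) -> R.
Hypothesis HP : locval U P.
Variable MA : ('rV[R]_n -> R) -> ('rV[R]_n -> R) -> R.
Hypothesis hMA : is_MongeAmpere U MA.
Variable psi : 'rV[R]_n -> R.
Hypothesis psi_cont : forall x, U x -> {for x, continuous psi}.
Hypothesis psiP : forall x phi, U x -> testfun U phi -> P (cone 1%:M x) phi = psi x * phi x.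
Implicit Types (f h phi : 'rV[R]_n -> R).

Definition repr f := convex_on U f /\ forall phi, testfun U phi -> P f phi = MA f (fun x => psi x * phi x).

Lemma repr_lim F f : (forall k, repr (F k)) -> convex_on U f -> cvg_loc_unif U F f -> repr f.
Proof.
move=> rF cf Ff; split => // phi tp.
apply: (cvg_near_unique (lv_cont HP (fun k => (rF k).1) cf Ff tp)
   (hMA.2 F f (fun k => (rF k).1) cf Ff _ (testfun_psi psi_cont tp))).
by apply: nearW => k; exact: (rF k).2.
Qed.

Definition hingesum f := exists N (V : 'M[R]_(N, n)) t, f = hs V t.
Lemma hingesum_repr f : hingesum f -> repr f.
Proof.
move=> [N [V [t ->]]]; split; first exact: convex_on_hs.
by move=> phi tp; exact: (P_hs HP hMA psi_cont psiP).
Qed.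
Lemma hingesum_add f v tau c : hingesum f -> 0 <= c -> hingesum (fun x => f x + c * hinge (dotp v x - tau)).
Proof.
move=> [N [V [t ->]]] c0.
exists (N + 1)%N, (col_mx V (c *: v)), (fun i => match fintype.split i with inl j => t j | inr _ => c * tau end).
apply/funext => x; rewrite /hs big_split_ord /= big_ord1; congr (_ + _).
  apply: eq_bigr => i _; rewrite rowKu; congr (hinge (_ - _)).
  by case: split_ordP => j /eqP; rewrite ?eq_lshift ?eq_lrshift// => /eqP ->.
rewrite rowKd row_id dotpZl -hingeM// mulrBr; congr (hinge (_ - _)).
by case: split_ordP => j /eqP; rewrite ?eq_rlshift.
Qed.
Lemma hingesum_pl f G tau v a : hingesum f -> pl tau G -> 0 <= a -> hingesum (fun x => f x + a * G (dotp v x)).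
Proof.
move=> hf pG a0; elim: pG => {tau G} [tau|tau tau' G c _ IH tt c0].
  by under eq_fun do rewrite mulr0 addr0.
have := hingesum_add v tau' IH (mulr_ge0 a0 c0).
by congr hingesum; apply/funext => x; rewrite mulrDr addrA mulrA.
Qed.

Definition expsum (L : seq (R * 'rV[R]_n)) x := \sum_(p <- L) p.1 * expR (dotp p.2 x).
Lemma convex_on_exp (a : R) w : 0 <= a -> convex_on U (fun x => a * expR (dotp w x)).
Proof. by move=> a0; apply: (@convex_on_ridge R n U (fun s => a * expR s)); apply: cvx1Z => //; exact: cvx1_expR. Qed.
Lemma cvg_lu1Zc (G : nat -> R -> R) (g : R -> R) (a : R) : cvg_lu1 G g -> (forall M : R, exists C : R, forall t, `|t| <= M -> `|g t| <= C) ->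
  cvg_lu1 (fun k t => a * G k t) (fun t => a * g t).
Proof. by move=> H bg; apply: (@cvg_lu1Z _ G g (fun=> a)) => //; exact: cvg_cst. Qed.
Lemma expR_bdd (M : R) : exists C : R, forall t : R, `|t| <= M -> `|expR t| <= C.
Proof.
exists (expR M) => t tM; rewrite ger0_norm ?expR_ge0// ler_expR.
exact: le_trans (ler_norm _) tM.
Qed.

(** The exponentials are replaced one at a time by piecewise linear functions, whose hinges are
    absorbed in [f]; hence the general hinge sum in the statement. *)
Lemma repr_expsum_pos f L : hingesum f -> all (fun p => 0 <= p.1) L -> repr (fun x => f x + expsum L x).
Proof.
elim: L f => [|[a w] L IH] f hf /=.
  by move=> _; under eq_fun do rewrite /expsum big_nil addr0; exact: hingesum_repr.
move=> /andP[a0 aL].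
have [G [plG Gexp]] := expR_pl_cvg R.
apply: (@repr_lim (fun k x => (f x + a * G k (dotp w x)) + expsum L x)).
- by move=> k; apply: IH => //; have [tau pG] := plG k; exact: hingesum_pl pG a0.
- have [cf _] := IH f hf aL; have := convex_onD cf (convex_on_exp w a0).
  by congr convex_on; apply/funext => x; rewrite /expsum big_cons /=; ring.
- rewrite (_ : (fun x => _) = (fun x => (f x + a * expR (dotp w x)) + expsum L x)); last first.
    by apply/funext => x; rewrite /expsum big_cons /=; ring.
  apply: cvg_luD; last exact: cvg_lu_cst.
  apply: cvg_luD; first exact: cvg_lu_cst.
  apply: (@cvg_lu_ridge _ _ U (fun k t => a * G k t) (fun t => a * expR t)).
  apply: cvg_lu1Zc => //; exact: expR_bdd.
Qed.

(** By [P_insert] the increments of [P] along the successive kinks add up, and each is linear in its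
    coefficient. No convexity is used beyond that of [f] and of the multiples of [G]. *)
Lemma P_pl_linear f v G tau s phi : convex_on U f -> pl tau G -> 0 <= s -> testfun U phi ->
  P (fun x => f x + s * G (dotp v x)) phi - P f phi = s * (P (fun x => f x + G (dotp v x)) phi - P f phi).
Proof.
move=> cf pG s0 tp; elim: pG => {tau G} [tau|tau tau' G c pG IH tt c0].
  have -> : (fun x => f x + s * 0) = f by apply/funext => x; rewrite mulr0 addr0.
  have -> : (fun x => f x + 0) = f by apply/funext => x; rewrite addr0.
  by rewrite subrr mulr0.
have [cG [sg [ka [H1 H2]]]] := pl_line pG.
have H3 x : tau' <= x -> G x = sg * x + ka by move=> tx; apply: H2; exact: le_trans tx.
rewrite (P_insert HP v cf cG c0 H1 H3 tp) mulrDr -IH.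
rewrite (P_hinge_linear HP v tau' cf c0 tp).
have -> : (fun x => f x + s * (G (dotp v x) + c * hinge (dotp v x - tau'))) =
          (fun x => f x + (s * G (dotp v x) + (s * c) * hinge (dotp v x - tau'))).
  by apply/funext => x; rewrite mulrDr mulrA.
rewrite (P_insert HP (g := fun t => s * G t) v (tau := tau') (sg := s * sg) (ka := s * ka) cf (cvx1Z s0 cG) (mulr_ge0 s0 c0) _ _ tp).
- by rewrite (P_hinge_linear HP v tau' cf (mulr_ge0 s0 c0) tp) mulrA.
- by move=> x; rewrite -mulrA -mulrDr ler_wpM2l.
- by move=> x tx; rewrite H3// mulrDr mulrA.
Qed.

Lemma P_exp_linear f w s phi : convex_on U f -> 0 <= s -> testfun U phi ->
  P (fun x => f x + s * expR (dotp w x)) phi - P f phi = s * (P (fun x => f x + expR (dotp w x)) phi - P f phi).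
Proof.
move=> cf s0 tp.
have [G [plG Gexp]] := expR_pl_cvg R.
have cvgP a : 0 <= a -> P (fun x => f x + a * G k (dotp w x)) phi @[k --> \oo] --> P (fun x => f x + a * expR (dotp w x)) phi.
  move=> a0; apply: (lv_cont HP (F := fun k x => f x + a * G k (dotp w x))) => //.
  - move=> k; apply: convex_onD => //; have [tau /pl_line[cG _]] := plG k.
    by apply: (@convex_on_ridge R n U (fun s => a * G k s)); apply: cvx1Z.
  - by apply: convex_onD => //; exact: convex_on_exp.
  - apply: cvg_luD; first exact: cvg_lu_cst.
    apply: (@cvg_lu_ridge _ _ U (fun k t => a * G k t) (fun t => a * expR t)).
    apply: cvg_lu1Zc => //; exact: expR_bdd.
have c1 : P (fun x => f x + G k (dotp w x)) phi @[k --> \oo] --> P (fun x => f x + expR (dotp w x)) phi.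
  have := cvgP 1 ler01; under eq_fun do (under eq_fun do rewrite mul1r).
  by under [in X in _ --> X]eq_fun do rewrite mul1r.
apply: (cvg_near_unique (cvgB (cvgP s s0) (@cvg_cst R^o (P f phi) nat \oo _))
  (cvgM (@cvg_cst R^o s nat \oo _) (cvgB c1 (@cvg_cst R^o (P f phi) nat \oo _)))).
apply: nearW => k; have [tau pG] := plG k; exact: P_pl_linear pG s0 tp.
Qed.

Definition expH L x := \sum_(p <- L) (p.1 * expR (dotp p.2 x)) *: (p.2^T *m p.2) : 'M[R]_n.
Lemma expsum_C2 L : C2_on U (expsum L) /\ forall x, hessian (expsum L) x = expH L x.
Proof.
have d (p : R * 'rV[R]_n) (t : R) : is_derive t 1 (fun s => p.1 * expR s) (p.1 * expR t).
  exact: (is_deriveZ p.1 (is_derive_expR t)).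
have cr (p : R * 'rV[R]_n) : continuous (fun s => p.1 * expR s).
  by move=> s; apply: cvgM; [exact: cvg_cst|exact: continuous_expR].
split; first exact: (@ridge_C2 R n _ L snd (fun p s => p.1 * expR s) _ _ d d cr).
exact: (@ridge_hessian R n _ L snd (fun p s => p.1 * expR s) _ _ d d).
Qed.
Lemma det_expH_continuous L : continuous (fun x => \det (expH L x)).
Proof.
apply: mx_cont_det => i j; rewrite /expH; under eq_fun do rewrite summxE.
apply: rV_cont_sum => p; under eq_fun do rewrite mxE.
apply: rV_contM; last exact: cst_continuous.
apply: rV_contM; first exact: cst_continuous.
by apply: rV_contC; [exact: continuous_expR|exact: dotp_continuous].
Qed.

(** The Monge-Ampere side is written with its explicit density, so that its affine dependence on a
    coefficient can be checked pointwise on determinants. *)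
Definition good L := forall phi, testfun U phi -> P (expsum L) phi = iint (fun x => psi x * phi x * \det (expH L x)).

Lemma expsum_pos_good L : all (fun p => 0 <= p.1) L -> good L.
Proof.
move=> aL phi tp.
have h0 : hingesum (fun=> 0).
  exists 0%N, 0, (fun=> 0); apply/funext => x; by rewrite /hs big_ord0.
have [cE E] := repr_expsum_pos h0 aL.
have E0 : (fun x => 0 + expsum L x) = expsum L by apply/funext => x; rewrite add0r.
rewrite E0 in cE E; rewrite E// hMA.1//; last 2 first.
- exact: (expsum_C2 L).1.
- exact: testfun_psi.
by congr iint; apply/funext => x; rewrite (expsum_C2 L).2.
Qed.

Lemma expsum_cat L1 L2 x : expsum (L1 ++ L2) x = expsum L1 x + expsum L2 x.
Proof. by rewrite /expsum big_cat. Qed.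
Lemma expH_cat L1 L2 x : expH (L1 ++ L2) x = expH L1 x + expH L2 x.
Proof. by rewrite /expH big_cat. Qed.

(* [s |-> P (f + s exp)] and the determinant are both affine in [s], so the case [s >= 1], where a negative
   coefficient has been compensated, determines the case [s = 0]. *)
Lemma expsum_good L1 L2 : all (fun p => 0 <= p.1) L1 -> all (fun p => p.1 < 0) L2 ->
  convex_on U (expsum (L1 ++ L2)) -> good (L1 ++ L2).
Proof.
elim: L2 L1 => [|[a w] L2 IH] L1 p1 /=; first by move=> _ _; apply: expsum_pos_good; rewrite cats0.
move=> /andP[a0 p2] cf phi tp.
(* Adding s |a| exp<w, .> turns the coefficient [a] into (s - 1) |a|, nonnegative once s >= 1. The
   sum stays convex and has one negative term fewer, so the induction hypothesis applies at s = 1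
   and s = 2, from which s = 0 is extrapolated. *)
pose Ls s := ((s - 1) * - a, w) :: L1 ++ L2.
have LsE s x : expsum (Ls s) x = expsum (L1 ++ (a, w) :: L2) x + (s * - a) * expR (dotp w x).
  by rewrite !expsum_cat /expsum !big_cons big_cat /=; ring.
have LsH s x : expH (Ls s) x = expH (L1 ++ (a, w) :: L2) x + (s * (- a * expR (dotp w x))) *: (w^T *m w).
  rewrite !expH_cat /expH !big_cons big_cat /=.
  set S1 := \sum_(_ <- L1) _; set S2 := \sum_(_ <- L2) _; set W := w^T *m w.
  by move: S1 S2 W => S1 S2 W; apply/matrixP => k l; rewrite !mxE; ring.
have gs s : 1 <= s -> P (expsum (Ls s)) phi = iint (fun x => psi x * phi x * \det (expH (Ls s) x)).
  move=> s1; apply: (IH (((s - 1) * - a, w) :: L1)) => //=.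
    by rewrite p1 andbT mulr_ge0 ?subr_ge0// oppr_ge0 ltW.
  rewrite -[_ :: _]/(Ls s) (funext (LsE s)); apply: convex_onD => //; apply: convex_on_exp.
  by rewrite mulr_ge0 ?oppr_ge0 ?(ltW a0)// (le_trans _ s1).
set f := expsum (L1 ++ (a, w) :: L2) in cf LsE *.
have na : 0 <= - a by rewrite oppr_ge0 ltW.
have lin s : 0 <= s -> P (expsum (Ls s)) phi - P f phi = s * - a * (P (fun x => f x + expR (dotp w x)) phi - P f phi).
  by move=> s0; rewrite (funext (LsE s)) P_exp_linear// mulr_ge0.
have Pf : P f phi = 2 * P (expsum (Ls 1)) phi - P (expsum (Ls 2)) phi.
  have l1 := lin 1 ler01; have l2 := lin 2 (ler0n _ _).
  have : P (expsum (Ls 2)) phi - P f phi = 2 * (P (expsum (Ls 1)) phi - P f phi) by rewrite l1 l2; ring.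
  lra.
have Cpsi := testfun_CC (testfun_psi psi_cont tp).
have CCs L : CC (fun x => psi x * phi x * \det (expH L x)).
  by apply: CC_mul => //; exact: det_expH_continuous.
rewrite Pf !gs ?ler1n// -mulN1r -iint_lin//; congr iint; apply/funext => x.
rewrite [\det (expH (L1 ++ _) x)](det_rank1_extrapolate _ w^T w (- a * expR (dotp w x))) !LsH mul1r.
ring.
Qed.

Lemma expsum_perm L L' : perm_eq L L' -> expsum L = expsum L'.
Proof. by move=> p; apply/funext => x; exact: perm_big. Qed.
Lemma expsum_repr L : convex_on U (expsum L) -> repr (expsum L).
Proof.
move=> cL.
pose L1 := [seq p <- L | 0 <= p.1]; pose L2 := [seq p <- L | ~~ (0 <= p.1)].
have E : expsum L = expsum (L1 ++ L2) by apply: expsum_perm; rewrite perm_sym; apply/permPl; exact: perm_filterC.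
rewrite E in cL *.
split => // phi tp; rewrite (@expsum_good L1 L2)//; last 2 first.
- exact: filter_all.
- by apply: sub_all (filter_all _ L) => p; rewrite -ltNge.
rewrite hMA.1//; last 2 first.
- exact: (expsum_C2 _).1.
- exact: testfun_psi.
by congr iint; apply/funext => x; rewrite (expsum_C2 _).2.
Qed.
End ExpSums.

(** * Subgradients and maxima of affine functions *)

Section Sublinear.
Variables (R : realType) (n : nat).
Implicit Types (q : 'rV[R]_n -> R) (u v : 'rV[R]_n).
Definition sublinear q := (forall u v, q (u + v) <= q u + q v) /\ (forall a v, 0 <= a -> q (a *: v) = a * q v).
Lemma sublinear0 q : sublinear q -> q 0 = 0.
Proof. by move=> [_ H]; rewrite -(scale0r (0 : 'rV[R]_n)) H// mul0r. Qed.
Lemma sublinear_opp q v : sublinear q -> - q (- v) <= q v.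
Proof. by move=> sq; have := sq.1 v (- v); rewrite subrr sublinear0//; lra. Qed.

(* Take [q' v := inf_(t >= 0) (q (v + t u) - t q u)]. *)
Lemma sublinear_step q u : sublinear q -> exists q', [/\ sublinear q', forall v, q' v <= q v & q' u + q' (- u) = 0].
Proof.
move=> sq.
pose S v := [set r | exists2 t : R, 0 <= t & r = q (v + t *: u) - t * q u].
pose q' v := inf (S v).
have S0 v : S v !=set0 by exists (q (v + 0 *: u) - 0 * q u), 0.
have lb v : lbound (S v) (- q (- v)).
  move=> _ [t t0 ->]; have := sq.1 (- v) (v + t *: u).
  by rewrite addKr sq.2//; lra.
have le v t : 0 <= t -> q' v <= q (v + t *: u) - t * q u.
  by move=> t0; apply: ge_inf; [exists (- q (- v)); exact: lb|exists t].
have ge v z : (forall t, 0 <= t -> z <= q (v + t *: u) - t * q u) -> z <= q' v.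
  by move=> H; apply: lb_le_inf => // _ [t t0 ->]; exact: H.
have le0 v : q' v <= q v by have := le v 0 (lexx _); rewrite scale0r addr0 mul0r subr0.
have sub v w : q' (v + w) <= q' v + q' w.
  suff : q' (v + w) - q' w <= q' v by lra.
  apply: (ge) => t t0; suff : q' (v + w) - (q (v + t *: u) - t * q u) <= q' w by lra.
  apply: ge => s s0; have := le (v + w) (t + s) (addr_ge0 t0 s0).
  by have := sq.1 (v + t *: u) (w + s *: u); rewrite addrACA -scalerDl mulrDl; lra.
have z0 : q' 0 = 0.
  apply/eqP; rewrite eq_le -{1}(sublinear0 sq) le0 /=.
  by apply: ge => t t0; rewrite add0r sq.2// subrr.
have homle a v : 0 < a -> a * q' v <= q' (a *: v).
  move=> a0; apply: ge => t t0; rewrite -ler_pdivlMl//.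
  have := le v (a^-1 * t) (mulr_ge0 (ltW (_ : 0 < a^-1)) t0); rewrite invr_gt0 => /(_ a0) H.
  rewrite (le_trans H)// -scalerA -[X in q (X + _)](scalerK (lt0r_neq0 a0)) -scalerDr sq.2; last by rewrite invr_ge0 ltW.
  by rewrite mulrBr mulrA.
exists q'; split => //.
- split => // a v; rewrite le_eqVlt => /predU1P[<-|a0]; first by rewrite scale0r mul0r.
  apply/eqP; rewrite eq_le homle// andbT.
  have := homle a^-1 (a *: v); rewrite invr_gt0 scalerK ?gt_eqF// => /(_ a0).
  by rewrite ler_pdivrMl.
- apply/eqP; rewrite eq_le; apply/andP; split.
    have := le (- u) 1 ler01; rewrite scale1r addNr (sublinear0 sq); have := le0 u; lra.
  by rewrite -[leLHS]z0 -(subrr u).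
Qed.

Lemma hahn_banach_rV q : sublinear q -> exists p : 'rV[R]_n, forall v, dotp p v <= q v.
Proof.
move=> sq.
(* One use of [sublinear_step] per coordinate direction; linearity along earlier directions
   survives, since a smaller sublinear functional satisfies 0 <= q2(u) + q2(- u) <= q1(u) + q1(- u)
   = 0. *)
have [q' [sq' qq' H]] : exists q', [/\ sublinear q', forall v, q' v <= q v & forall i, i \in enum 'I_n -> q' (delta_mx 0 i) + q' (- delta_mx 0 i) = 0].
  elim: (enum 'I_n) => [|i r [q1 [sq1 q1q H1]]]; first by exists q; split.
  have [q2 [sq2 q2q1 H2]] := sublinear_step (delta_mx 0 i) sq1.
  exists q2; split => //; first by move=> v; exact: le_trans (q1q v).
  move=> j; rewrite in_cons => /predU1P[->//|/H1 E].
  have := q2q1 (delta_mx 0 j); have := q2q1 (- delta_mx 0 j); have := sublinear_opp (delta_mx 0 j) sq2.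
  lra.
have {}H i : q' (delta_mx 0 i) + q' (- delta_mx 0 i) = 0 by apply: H; rewrite mem_enum.
pose p : 'rV[R]_n := \row_i q' (delta_mx 0 i).
have le v : q' v <= dotp p v.
  rewrite {1}[v]row_sum_delta /dotp.
  have : q' (\sum_(i < n) v 0 i *: delta_mx 0 i) <= \sum_(i < n) q' (v 0 i *: delta_mx 0 i).
    elim: (index_enum _) => [|i r IH]; first by rewrite !big_nil sublinear0.
    by rewrite !big_cons (le_trans (sq'.1 _ _))// lerD2l.
  move=> /le_trans; apply; apply: ler_sum => i _; rewrite mxE mulrC.
  have [v0|v0] := leP 0 (v 0 i); first by rewrite sq'.2.
  have -> : v 0 i *: delta_mx 0 i = - v 0 i *: - delta_mx 0 i :> 'rV[R]_n by rewrite scalerN scaleNr opprK.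
  rewrite sq'.2; last by rewrite oppr_ge0 ltW.
  have -> : q' (- delta_mx 0 i) = - q' (delta_mx 0 i) by have := H i; lra.
  by rewrite mulrNN.
(* Subadditivity gave q' <= p; at [- v] it reads p(v) <= - q'(- v), which is at most q'(v). *)
exists p => v; rewrite (le_trans _ (qq' v))// (le_trans _ (sublinear_opp v sq'))//.
by have := le (- v); rewrite dotpNr; lra.
Qed.
End Sublinear.

Section Subgradient.
Variables (R : realType) (n : nat) (U : set 'rV[R]_n).
Hypothesis (oU : open U) (cU : convex_set U).
Variable f : 'rV[R]_n -> R.
Hypothesis cf : convex_on U f.

Lemma open_segment y (v : 'rV[R]_n) : U y -> exists2 t : R, 0 < t & U (y + t *: v).
Proof.
move=> Uy; have /rV_nbhsP[d d0 Hd] : nbhs y U by exact: open_nbhs_nbhs.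
exists (d / 2 / (`|v| + 1)); first by rewrite !divr_gt0// ltr_wpDl.
apply: Hd; rewrite opprD addrA subrr add0r normrN normrZ gtr0_norm; last by rewrite !divr_gt0// ltr_wpDl.
rewrite mulrAC ltr_pdivrMr ?ltr_wpDl//; have := normr_ge0 v; nra.
Qed.
Lemma convex_set_comb x y (t : R) : U x -> U y -> 0 <= t -> t <= 1 -> U (t *: x + (1 - t) *: y).
Proof. by move=> Ux Uy t0 t1; have := cU (Itv01 t0 t1) (mem_set Ux) (mem_set Uy); rewrite inE. Qed.

Lemma subgradient y : U y -> exists p : 'rV[R]_n, forall x, U x -> f y + dotp p (x - y) <= f x.
Proof.
move=> Uy.
have /convex_onP cvf := cf.
pose S (v : 'rV[R]_n) := [set r | exists t : R, [/\ 0 < t, U (y + t *: v) & r = (f (y + t *: v) - f y) / t]].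
(* The step t = t1 t2 / (t1 + t2) is the one for which y + t (u + v) is a convex combination of the
   points y + t1 u and y + t2 v. This yields subadditivity of the directional derivative without
   monotonicity of the quotients. *)
have comb (u v : 'rV[R]_n) t1 t2 : 0 < t1 -> 0 < t2 -> U (y + t1 *: u) -> U (y + t2 *: v) ->
   let t := t1 * t2 / (t1 + t2) in [/\ 0 < t, U (y + t *: (u + v)) &
   (f (y + t *: (u + v)) - f y) / t <= (f (y + t1 *: u) - f y) / t1 + (f (y + t2 *: v) - f y) / t2].
  move=> t10 t20 U1 U2 t.
  have s0 : 0 < t1 + t2 by rewrite addr_gt0.
  have t0 : 0 < t by rewrite divr_gt0// mulr_gt0.
  pose a := t2 / (t1 + t2).
  have a0 : 0 <= a by rewrite divr_ge0 ?ltW.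
  have a1 : a <= 1 by rewrite ler_pdivrMr// mul1r lerDr ltW.
  have E : y + t *: (u + v) = a *: (y + t1 *: u) + (1 - a) *: (y + t2 *: v).
    have t1a : a * t1 = t by rewrite /a /t; field; rewrite gt_eqF.
    have t2a : (1 - a) * t2 = t by rewrite /a /t; field; rewrite gt_eqF.
    rewrite !scalerDr !scalerA t1a t2a addrACA -scalerDl; congr (_ + _).
    by rewrite addrCA subrr addr0 scale1r.
  split => //; first by rewrite E; exact: convex_set_comb.
  rewrite ler_pdivrMr// E; have := cvf _ _ _ U1 U2 a0 a1.
  set A := f (y + t1 *: u); set B := f (y + t2 *: v).
  have -> : ((A - f y) / t1 + (B - f y) / t2) * t = a * A + (1 - a) * B - f y.
    by rewrite /a /t; field; rewrite !gt_eqF.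
  by lra.
have S0 v : S v !=set0.
  by have [t t0 Ut] := open_segment v Uy; exists ((f (y + t *: v) - f y) / t), t.
(* Any admissible step along [- v] bounds the quotients along [v] from below, since [comb] for these
   two directions returns to [y]. *)
have lb v : has_lbound (S v).
  have [s s0 Us] := open_segment (- v) Uy.
  exists (- ((f (y + s *: - v) - f y) / s)) => _ [t [t0 Ut ->]].
  have [_ _] := comb _ _ _ _ t0 s0 Ut Us.
  by rewrite subrr scaler0 addr0 subrr mul0r; lra.
pose q v := inf (S v).
have le v t : 0 < t -> U (y + t *: v) -> q v <= (f (y + t *: v) - f y) / t.
  by move=> t0 Ut; apply: ge_inf => //; exists t.
have ge v z : (forall t, 0 < t -> U (y + t *: v) -> z <= (f (y + t *: v) - f y) / t) -> z <= q v.
  by move=> H; apply: lb_le_inf => // _ [t [t0 Ut ->]]; exact: H.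
have homle a v : 0 < a -> a * q v <= q (a *: v).
  move=> a0; apply: ge => t t0; rewrite scalerA => Ut.
  have := le v (t * a) (mulr_gt0 t0 a0) Ut.
  by rewrite invfM mulrA ler_pdivlMr// mulrC.
have q0 : q 0 = 0.
  apply/eqP; rewrite eq_le; apply/andP; split.
    by have := le 0 1 ltr01; rewrite scaler0 addr0 subrr mul0r; exact.
  by apply: ge => t _ _; rewrite scaler0 addr0 subrr mul0r.
have sq : sublinear q.
  split.
    move=> u v; suff : q (u + v) - q v <= q u by lra.
    apply: (ge) => t1 t10 U1; suff : q (u + v) - (f (y + t1 *: u) - f y) / t1 <= q v by lra.
    apply: ge => t2 t20 U2; have [t0 Ut H] := comb _ _ _ _ t10 t20 U1 U2.
    by have := le _ _ t0 Ut; lra.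
  move=> a v; rewrite le_eqVlt => /predU1P[<-|a0]; first by rewrite scale0r mul0r.
  apply/eqP; rewrite eq_le homle// andbT.
  have := homle a^-1 (a *: v); rewrite invr_gt0 scalerK ?gt_eqF// => /(_ a0).
  by rewrite ler_pdivrMl.
have [p Hp] := hahn_banach_rV sq.
exists p => x Ux; have := Hp (x - y); have := le (x - y) 1 ltr01.
by rewrite scale1r addrC subrK divr1 => /(_ Ux); lra.
Qed.

Lemma jensen (r : seq (R * 'rV[R]_n)) y : U y -> (forall p, p \in r -> 0 <= p.1 /\ U p.2) ->
  \sum_(p <- r) p.1 <= 1 ->
  U ((1 - \sum_(p <- r) p.1) *: y + \sum_(p <- r) p.1 *: p.2) /\
  f ((1 - \sum_(p <- r) p.1) *: y + \sum_(p <- r) p.1 *: p.2) <= (1 - \sum_(p <- r) p.1) * f y + \sum_(p <- r) p.1 * f p.2.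
Proof.
elim: r y => [|[s p] r IH] y Uy Hr; first by rewrite !big_nil subr0 !scale1r !addr0 mul1r.
rewrite !big_cons /=; set S := \sum_(p <- r) p.1 => S1.
have [s0 Up] := Hr (s, p) (mem_head _ _).
have {}Hr q : q \in r -> 0 <= q.1 /\ U q.2 by move=> qr; apply: Hr; rewrite in_cons qr orbT.
(* The share of the mass outside the tail that belongs to [p]; if that mass is 0 then [s] is 0, and
   division by zero correctly gives 0. *)
pose a := s / (1 - S).
have aS : (1 - S) * a = s.
  have [S0|S0] := eqVneq (1 - S) 0; last by rewrite /a mulrC divfK.
  rewrite S0 mul0r; apply/eqP; rewrite eq_le s0; apply/andP; split => //; lra.
have a0 : 0 <= a by rewrite divr_ge0// subr_ge0; rewrite /= in s0; lra.
have a1 : a <= 1.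
  have [S0|S0] := eqVneq (1 - S) 0; first by rewrite /a S0 invr0 mulr0.
  have S0' : 0 < 1 - S by rewrite lt_neqAle eq_sym S0 subr_ge0; rewrite /= in s0; lra.
  by rewrite /a ler_pdivrMr// mul1r; lra.
have Uy' := convex_set_comb Up Uy a0 a1.
have SS : S <= 1 by rewrite /= in s0; lra.
have [IH1 IH2] := IH _ Uy' Hr SS.
have E : (1 - (s + S)) *: y + (s *: p + \sum_(p <- r) p.1 *: p.2) =
  (1 - S) *: (a *: p + (1 - a) *: y) + \sum_(p <- r) p.1 *: p.2.
  rewrite scalerDr !scalerA aS mulrBr mulr1 aS addrA [_ + s *: p]addrC; congr (_ + _ *: _ + _); ring.
rewrite -/S E; split => //; rewrite (le_trans IH2)// -/S addrA lerD2r /=.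
have /convex_onP cvf := cf; have := cvf _ _ _ Up Uy a0 a1 => H.
have S0 : 0 <= 1 - S by rewrite subr_ge0.
rewrite (le_trans (ler_wpM2l S0 H))// -aS le_eqVlt; apply/orP; left; apply/eqP; ring.
Qed.

(** A point near [y] is a Jensen combination of [y] and points y + r e_i or y - r e_i, with small
    weights on the latter. Upper semicontinuity is enough, since the affine minorants come from
    subgradients. *)
Lemma convex_usc y (e : R) : U y -> 0 < e -> exists2 d : R, 0 < d & forall x, `|y - x| < d -> U x /\ f x < f y + e.
Proof.
move=> Uy e0.
have /rV_nbhsP[d0 d00 Hd0] : nbhs y U by exact: open_nbhs_nbhs.
pose r := d0 / 2.
have r0 : 0 < r by rewrite divr_gt0.
have nd (i : 'I_n) : `|delta_mx 0 i : 'rV[R]_n| <= 1.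
  apply: normrow_leP => // j; rewrite mxE eqxx /=; case: (j == i); by rewrite ?normr1 ?normr0.
have Uv (s : R) i : `|s| <= r -> U (y + s *: delta_mx 0 i).
  move=> sr; apply: Hd0; rewrite opprD addrA subrr add0r normrN normrZ.
  have := nd i; have := normr_ge0 s; rewrite /r in sr; nra.
pose B := \sum_(i < n) (`|f (y + r *: delta_mx 0 i) - f y| + `|f (y + - r *: delta_mx 0 i) - f y|).
have B0 : 0 <= B by rewrite sumr_ge0// => i _; rewrite addr_ge0.
(* The first bound keeps the total weight below 1, the second keeps the increase of [f] below [e]; n
   + 1 and B + 1 avoid zero denominators. *)
pose d := Num.min (r / n.+1%:R) (e * r / (n.+1%:R * (B + 1))).
have n0 : (0 : R) < n.+1%:R by rewrite ltr0n.
have B1 : 0 < B + 1 by rewrite ltr_wpDl.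
have dpos : 0 < d by rewrite lt_min !divr_gt0// ?mulr_gt0.
exists d => // x; rewrite lt_min => /andP[x1 x2].
pose z := x - y.
have zi i : `|z 0 i| <= `|y - x| by rewrite -normrN opprB normrow_le.
pose sg i : R := if 0 <= z 0 i then r else - r.
pose L := [seq (`|z 0 i| / r, y + sg i *: delta_mx 0 i) | i <- enum 'I_n].
have sL (T : zmodType) (F : R -> 'rV[R]_n -> T) : \sum_(p <- L) F p.1 p.2 = \sum_(i < n) F (`|z 0 i| / r) (y + sg i *: delta_mx 0 i).
  by rewrite big_map big_enum.
have sumz : \sum_(i < n) `|z 0 i| <= n%:R * `|y - x|.
  apply: (@le_trans _ _ (\sum_(i < n) `|y - x|)); first by apply: ler_sum => i _.
  by rewrite big_const_ord iter_addr_0 mulr_natl.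
have nn : n%:R * `|y - x| <= n.+1%:R * `|y - x| by rewrite ler_wpM2r// ler_nat.
have S1 : \sum_(p <- L) p.1 <= 1.
  rewrite (sL R^o (fun a _ => a)) -mulr_suml ler_pdivrMr// mul1r.
  by move: x1; rewrite ltr_pdivlMr//; lra.
have HL p : p \in L -> 0 <= p.1 /\ U p.2.
  move=> /mapP[i _ ->] /=; split; first by rewrite divr_ge0// ltW.
  by apply: Uv; rewrite /sg; case: ifP => _; rewrite ?normrN gtr0_norm.
have [J1 J2] := jensen Uy HL S1.
have xE : (1 - \sum_(p <- L) p.1) *: y + \sum_(p <- L) p.1 *: p.2 = x.
  rewrite (sL _ (fun a b => a *: b)) (sL R^o (fun a _ => a)).
  under [X in _ + X]eq_bigr do rewrite scalerDr scalerA.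
  have -> : \sum_(i < n) ((`|z 0 i| / r) *: y + (`|z 0 i| / r * sg i) *: delta_mx 0 i) =
      (\sum_(i < n) `|z 0 i| / r) *: y + \sum_(i < n) (`|z 0 i| / r * sg i) *: delta_mx 0 i.
    by rewrite big_split scaler_suml.
  rewrite addrA -scalerDl subrK scale1r.
  rewrite (_ : \sum_(i < n) _ = z); first by rewrite /z addrC subrK.
  rewrite [RHS]row_sum_delta; apply: eq_bigr => i _; congr (_ *: _).
  rewrite /sg; case: ifPn => [zp|]; first by rewrite ger0_norm// divfK// gt_eqF.
  by rewrite -ltNge => zn; rewrite ltr0_norm// mulrN mulNr mulNr opprK divfK// gt_eqF.
rewrite xE in J1 J2; split => //; rewrite (le_lt_trans J2)//.
rewrite (sL R^o (fun a b => a * f b)) (sL R^o (fun a _ => a)).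
have bd i : `|z 0 i| / r * (f (y + sg i *: delta_mx 0 i) - f y) <= `|z 0 i| / r * B.
  apply: ler_wpM2l; first by rewrite divr_ge0// ltW.
  rewrite (le_trans (ler_norm _))// /B (bigD1 i)//= /sg.
  have rest : 0 <= \sum_(i0 < n | i0 != i) (`|f (y + r *: delta_mx 0 i0) - f y| + `|f (y + - r *: delta_mx 0 i0) - f y|).
    by rewrite sumr_ge0// => j _; rewrite addr_ge0.
  have h1 := normr_ge0 (f (y + r *: delta_mx 0 i) - f y).
  have h2 := normr_ge0 (f (y + - r *: delta_mx 0 i) - f y).
  by case: ifP => _; lra.
have -> : (1 - \sum_(i < n) `|z 0 i| / r) * f y + \sum_(i < n) `|z 0 i| / r * f (y + sg i *: delta_mx 0 i) =
   f y + \sum_(i < n) `|z 0 i| / r * (f (y + sg i *: delta_mx 0 i) - f y).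
  have -> : \sum_(i < n) `|z 0 i| / r * (f (y + sg i *: delta_mx 0 i) - f y) =
     \sum_(i < n) `|z 0 i| / r * f (y + sg i *: delta_mx 0 i) - (\sum_(i < n) `|z 0 i| / r) * f y.
    by rewrite mulr_suml -sumrB; apply: eq_bigr => i _; rewrite mulrBr.
  ring.
rewrite ltrD2l; apply: (@le_lt_trans _ _ (\sum_(i < n) `|z 0 i| / r * B)); first by apply: ler_sum => i _.
rewrite -mulr_suml -mulr_suml.
move: x2; rewrite ltr_pdivlMr ?mulr_gt0// => x2.
rewrite mulrAC ltr_pdivrMr// (le_lt_trans _ x2)//.
rewrite [X in _ <= X]mulrCA mulrA ler_pM//; [|lra|lra].
by rewrite sumr_ge0.
Qed.
End Subgradient.

Section MaxAffine.
Variables (R : realType) (n : nat).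
Implicit Types (l : 'rV[R]_n * R) (L : seq ('rV[R]_n * R)) (M f : 'rV[R]_n -> R).

Definition aff l x : R := dotp l.1 x + l.2.
(** A relation instead of an iterated maximum: no default value for the empty list enters, and
    attainment forces [L] to be nonempty. *)
Definition maxaff L M := forall x, (exists2 l, l \in L & M x = aff l x) /\ forall l, l \in L -> aff l x <= M x.

Lemma aff_comb l x y (t : R) : aff l (t *: x + (1 - t) *: y) = t * aff l x + (1 - t) * aff l y.
Proof. by rewrite /aff dotpDr !dotpZr; ring. Qed.
Lemma maxaff_exists l0 L : exists M, maxaff (l0 :: L) M.
Proof.
elim: L l0 => [|l1 L IH] l0.
  exists (aff l0) => x; split; first by exists l0; rewrite ?mem_head.
  by move=> l; rewrite inE => /eqP ->.
have [M HM] := IH l1; exists (fun x => Num.max (aff l0 x) (M x)) => x.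
have [[l lL Ml] H] := HM x; split.
  by case: (leP (aff l0 x) (M x)) => _; [exists l; rewrite // inE lL orbT|exists l0; rewrite ?mem_head].
move=> l'; rewrite inE le_max => /predU1P[->|/H ->]; by rewrite ?lexx ?orbT.
Qed.
Lemma maxaff_convex (U : set 'rV[R]_n) L M : maxaff L M -> convex_on U M.
Proof.
move=> HM; apply/convex_onP => x y t _ _ t0 t1.
have [[l lL ->] _] := HM (t *: x + (1 - t) *: y).
rewrite aff_comb lerD// ler_wpM2l ?subr_ge0//; first exact: (HM x).2.
exact: (HM y).2.
Qed.

Variables (U : set 'rV[R]_n) (f : 'rV[R]_n -> R).
Hypotheses (oU : open U) (cU : convex_set U) (cf : convex_on U f).

Lemma maxaff_approx (K : set 'rV[R]_n) (e : R) : compact K -> K `<=` U -> 0 < e ->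
  exists L M, [/\ maxaff L M, forall x, U x -> M x <= f x & forall x, K x -> f x - e < M x].
Proof.
move=> cK KU e0.
have /choice[g Hg] : forall y, exists ld : ('rV[R]_n * R) * R, 0 < ld.2 /\ (U y ->
    (forall x, U x -> aff ld.1 x <= f x) /\ (forall x, `|y - x| < ld.2 -> f x - e < aff ld.1 x)).
  move=> y; have [Uy|nUy] := pselect (U y); last by exists (0, 0, 1).
  have [p Hp] := subgradient oU cU cf Uy.
  have e2 : 0 < e / 2 by rewrite divr_gt0.
  have [d d0 Hd] := convex_usc oU cU cf Uy e2.
  have /rV_continuousP/(_ _ e2)[d' d'0 Hd'] := @dotp_continuous R n p y.
  exists (p, f y - dotp p y, Num.min d d'); split; first by rewrite lt_min d0.
  move=> _; split => x.
    by move=> /Hp; rewrite /aff /= dotpBr; lra.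
  rewrite lt_min => /andP[/Hd[_ H1] /Hd']; rewrite ltr_norml /aff /= => /andP[H2 H3].
  lra.
(* An affine minorant that keeps the list nonempty even when the finite cover is empty. *)
have [l0 Hl0] : exists l0, forall x, U x -> aff l0 x <= f x.
  have [[y Uy]|nU] := pselect (exists y, U y); first by exists (g y).1; exact: ((Hg y).2 Uy).1.
  by exists 0 => x Ux; case: nU; exists x.
move: cK; rewrite compact_cover => /(_ _ K (fun y => (ball y (g y).2)°)) [].
- by move=> y _; exact: open_interior.
- move=> y Ky; exists y => //; apply: nbhs_singleton; apply: nbhs_interior; apply: nbhsx_ballx; exact: (Hg y).1.
move=> D DK KD.
have [M HM] := maxaff_exists l0 [seq (g y).1 | y <- finmap.enum_fset D].
exists (l0 :: [seq (g y).1 | y <- finmap.enum_fset D]), M; split => // x.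
  move=> Ux; have [[l + ->] _] := HM x; rewrite inE => /predU1P[->|/mapP[y yD ->]]; first exact: Hl0.
  by apply: ((Hg y).2 _).1 => //; apply: KU; have := DK y yD; rewrite inE.
move=> Kx; have [y yD /interior_subset] := KD x Kx.
rewrite mx_norm_ball /ball_ /= => yx.
have Uy : U y by apply: KU; have := DK y yD; rewrite inE.
apply: (lt_le_trans (((Hg y).2 Uy).2 x yx)); apply: (HM x).2.
by rewrite inE; apply/orP; right; apply/mapP; exists y.
Qed.

(** Allows a single sequence of maxima to converge on every compact set. [Kn k] consists of the
    points of norm at most k whose open ball of radius [eps k] lies in [U]. *)
Lemma exhaustion : exists Kn : nat -> set 'rV[R]_n, (forall k, compact (Kn k) /\ Kn k `<=` U) /\
  forall K, compact K -> K `<=` U -> \forall k \near \oo, K `<=` Kn k.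
Proof.
pose Kn k : set 'rV[R]_n := [set x | `|x| <= k%:R /\ forall y, `|x - y| < eps R k -> U y].
exists Kn; split.
  move=> k; split; last by move=> x [_ H]; apply: H; rewrite subrr normr0 eps_gt0.
  apply: bounded_closed_compact.
    exists k%:R; split; first by rewrite num_real.
    by move=> M kM x [/= xk _]; rewrite (le_trans xk)// ltW.
  move=> x clx; have cl (d : R) : 0 < d -> exists2 x', Kn k x' & `|x - x'| < d.
    by move=> d0; have [x' [Kx' /=]] := clx _ (nbhsx_ballx x d d0); rewrite mx_norm_ball => ?; exists x'.
  split.
    apply/ler_addgt0Pr => d d0; have [x' [xk _] xx'] := cl d d0.
    by rewrite -(subrK x' x) (le_trans (ler_normD _ _))// addrC lerD// ltW.
  move=> y xy; have d0 : 0 < eps R k - `|x - y| by rewrite subr_gt0.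
  have [x' [_ H] xx'] := cl _ d0; apply: H.
  rewrite -(subrK x x') -addrA (le_lt_trans (ler_normD _ _))// distrC; lra.
move=> K cK KU; have := compact_near_coveringP K; case => /(_ cK) Knear _.
apply: (Knear nat \oo (fun k x => Kn k x)) => x Kx; have /rV_nbhsP[d d0 Hd] : nbhs x U by exact: open_nbhs_nbhs (conj oU (KU x Kx)).
have d2 : 0 < d / 2 by rewrite divr_gt0.
exists (ball x (d / 2), [set k | eps R k < d / 2 /\ `|x| + d / 2 <= k%:R]) => /=.
  split; first exact: nbhsx_ballx.
  near=> k; split; near: k; first exact: eps_lt.
  exact: nbhs_infty_ger.
move=> [x' k] /= []; rewrite mx_norm_ball /ball_ /= => xx' [ek xk]; split.
  rewrite -(subrK x x') (le_trans (ler_normD _ _))// distrC; lra.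
move=> y xy; apply: Hd; rewrite -(subrK x' x) -addrA (le_lt_trans (ler_normD _ _))//; lra.
Unshelve. all: by end_near. Qed.

Lemma maxaff_cvg : exists F : nat -> 'rV[R]_n -> R, (forall k, exists L, maxaff L (F k)) /\ cvg_loc_unif U F f.
Proof.
have [Kn [HK Kex]] := exhaustion.
have /choice[F HF] : forall k, exists M, (exists L, maxaff L M) /\ (forall x, U x -> M x <= f x) /\
    forall x, Kn k x -> f x - eps R k < M x.
  move=> k; have [cK KU] := HK k.
  by have [L [M [H1 H2 H3]]] := maxaff_approx cK KU (eps_gt0 R k); exists M; split => //; exists L.
exists F; split; first by move=> k; exact: (HF k).1.
move=> K cK KU e e0; apply: filterS2 (Kex K cK KU) (eps_lt e0) => k KK ek x Kx.
have [_ [H1 H2]] := HF k; have := H1 x (KU x Kx); have := H2 x (KK x Kx).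
by rewrite ltr_norml => h1 h2; apply/andP; split; lra.
Qed.
End MaxAffine.

(** * Log-sum-exp functions *)

Section LogSeries.
Variable R : realType.
Implicit Types (s t S : R).

(* Partial sums of the expansion of [s = ln (1 - (1 - exp s))] at [exp s = 1]; those of odd order are convex and nondecreasing on the whole line. *)
Fixpoint logser N s : R := if N is m.+1 then logser m s - (1 - expR s) ^+ N / N%:R else 0.

Lemma is_derive_1expX N s : is_derive s 1 (fun t => (1 - expR t) ^+ N.+1) (- (N.+1%:R * (1 - expR s) ^+ N * expR s)).
Proof.
have d1 : is_derive s 1 (fun t => 1 - expR t) (- expR s).
  by rewrite -[- _]add0r; apply: is_deriveB.
have := is_deriveX N.+1 d1; rewrite exprfctE /GRing.scale /= => H.
by apply: is_derive_eq; ring.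
Qed.
Lemma is_derive_logser N s : is_derive s 1 (logser N) (1 - (1 - expR s) ^+ N).
Proof.
elim: N => [|N IH]; first by rewrite expr0 subrr; exact: is_derive_cst.
have := is_deriveB IH (is_deriveZ (N.+1%:R^-1) (is_derive_1expX N s)).
rewrite (_ : (_ - _ : R -> R) = logser N.+1); last first.
  apply/funext => t /=; congr (_ - _); exact: mulrC.
move=> H; apply: (is_derive_eq H).
rewrite /GRing.scale /= exprS; have N0 : N.+1%:R != 0 :> R by rewrite pnatr_eq0.
by field.
Qed.
Lemma logser_continuous N : continuous (logser N).
Proof.
move=> t; apply/differentiable_continuous/derivable1_diffP.
exact: (@ex_derive _ _ _ _ _ _ _ (is_derive_logser N t)).
Qed.
Lemma odd_pow_le1 m (x : R) : x <= 1 -> x ^+ m.*2.+1 <= 1.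
Proof.
move=> x1; have [x0|x0] := leP 0 x; first by rewrite exprn_ile1.
rewrite exprS (le_trans _ ler01)// mulr_le0_ge0 ?(ltW x0)//.
by rewrite -addnn exprD -expr2 sqr_ge0.
Qed.
Lemma logser_mono m s t : s <= t -> logser m.*2.+1 s <= logser m.*2.+1 t.
Proof.
move=> st; have [|c _ E] := MVT_segment st (fun x _ => is_derive_logser m.*2.+1 x).
  exact/continuous_subspaceT/logser_continuous.
rewrite -subr_ge0 E mulr_ge0 ?subr_ge0// odd_pow_le1// gerBl expR_ge0 //.
Qed.
Lemma logser_cvx m : cvx1 (logser m.*2.+1).
Proof.
apply: (cvx1_deriv2 (G' := fun s => 1 - (1 - expR s) ^+ m.*2.+1)
  (G'' := fun s => m.*2.+1%:R * (1 - expR s) ^+ m.*2 * expR s) (is_derive_logser _)) => s; last first.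
  by rewrite mulr_ge0 ?expR_ge0// mulr_ge0// -addnn exprD -expr2 sqr_ge0.
have := is_deriveB (is_derive_cst (1 : R) s 1) (is_derive_1expX m.*2 s).
by rewrite sub0r opprK.
Qed.
Lemma logser0 N : logser N 0 = 0.
Proof. by elim: N => [//|N IH] /=; rewrite IH expR0 subrr expr0n mul0r subr0. Qed.
(** The error vanishes at 0 and has derivative - (1 - exp)^N, whose base lies in [0, 1 - exp(- S)]
    on the interval, so it decays geometrically. *)
Lemma logser_close N S s : - S <= s -> s <= 0 -> `|logser N s - s| <= S * (1 - expR (- S)) ^+ N.
Proof.
move=> Ss s0.
have d (x : R) : is_derive x 1 (fun t => logser N t - t) (- ((1 - expR x) ^+ N)).
  have := is_deriveB (is_derive_logser N x) (is_derive_id x 1) => H.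
  by apply: (is_derive_eq H); ring.
have [|c] := MVT_segment s0 (fun x _ => d x).
  apply: continuous_subspaceT => x; apply: continuousB; [exact: logser_continuous|exact: cvg_id].
rewrite in_itv /= => /andP[sc c0]; rewrite logser0 subrr sub0r => E.
have X0 : 0 <= 1 - expR c by rewrite subr_ge0 -expR0 ler_expR.
have -> : logser N s - s = (1 - expR c) ^+ N * - s by lra.
rewrite normrM !ger0_norm ?oppr_ge0 ?exprn_ge0// mulrC ler_pM ?oppr_ge0 ?exprn_ge0//; first by rewrite lerNl.
rewrite lerXn2r ?nnegrE ?(le_trans X0)// lerD2l lerN2 ler_expR; lra.
Qed.
Lemma logser_approx S (e : R) : 0 <= S -> 0 < e -> exists m, forall s, - S <= s -> s <= 0 -> `|logser m.*2.+1 s - s| < e.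
Proof.
move=> S0 e0.
have z1 : `|1 - expR (- S)| < 1.
  rewrite ger0_norm; last by rewrite subr_ge0 -expR0 ler_expR oppr_le0.
  by rewrite gtrBl expR_gt0.
have S1 : 0 < S + 1 by rewrite ltr_wpDl.
have [N _ HN] : \forall k \near \oo, `|(1 - expR (- S)) ^+ k| < e / (S + 1).
  by apply: (cvgr0_norm_lt _ (cvg_expr z1)); rewrite divr_gt0.
exists N => s Ss s0; rewrite (le_lt_trans (logser_close _ Ss s0))//.
have /HN : (N <= N.*2.+1)%N by rewrite leqW// -addnn leq_addr.
rewrite /= ltr_pdivlMr// => H; rewrite (le_lt_trans _ H)// mulrC.
have := ler_norm ((1 - expR (- S)) ^+ N.*2.+1); have := normr_ge0 ((1 - expR (- S)) ^+ N.*2.+1); nra.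
Qed.
End LogSeries.

Section LogSumExp.
Variables (R : realType) (n : nat).
Implicit Types (g h : 'rV[R]_n -> R) (l : 'rV[R]_n * R) (L : seq ('rV[R]_n * R)).

Definition isexp g := exists L : seq (R * 'rV[R]_n), g = expsum L.
Lemma isexp_cst c : isexp (fun=> c).
Proof.
by exists [:: (c, 0)]; apply/funext => x; rewrite /expsum big_cons big_nil addr0 dotp0l expR0 mulr1.
Qed.
Lemma isexpD g h : isexp g -> isexp h -> isexp (fun x => g x + h x).
Proof. by move=> [L1 ->] [L2 ->]; exists (L1 ++ L2); apply/funext => x; rewrite expsum_cat. Qed.
Lemma isexpM g h : isexp g -> isexp h -> isexp (fun x => g x * h x).
Proof.
move=> [L1 ->] [L2 ->]; exists [seq (p.1 * q.1, p.2 + q.2) | p <- L1, q <- L2].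
apply/funext => x; rewrite /expsum big_allpairs_dep /= mulr_suml; apply: eq_bigr => p _.
by rewrite mulr_sumr; apply: eq_bigr => q _; rewrite dotpDl expRD; ring.
Qed.
Lemma isexpZ c g : isexp g -> isexp (fun x => c * g x).
Proof. exact/isexpM/isexp_cst. Qed.
Lemma isexpX g N : isexp g -> isexp (fun x => g x ^+ N).
Proof.
move=> eg; elim: N => [|N IH]; first by under eq_fun do rewrite expr0; exact: isexp_cst.
by under eq_fun do rewrite exprS; exact: isexpM.
Qed.
Lemma isexp_logser N g : isexp (fun x => expR (g x)) -> isexp (fun x => logser N (g x)).
Proof.
move=> eg; elim: N => [|N IH] /=; first exact: isexp_cst.
have e1 : isexp (fun x => 1 - expR (g x)).
  by under eq_fun do rewrite -mulN1r; apply: isexpD; [exact: isexp_cst|exact: isexpZ].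
have := isexpD IH (isexpZ (- N.+1%:R^-1) (isexpX N.+1 e1)).
by congr isexp; apply/funext => x; rewrite mulNr mulrC.
Qed.

Definition sumexp L x : R := \sum_(l <- L) expR (aff l x).
Definition lse L x : R := ln (sumexp L x).
Lemma sumexp_gt0 L x : L != [::] -> 0 < sumexp L x.
Proof.
case: L => [//|l L] _; rewrite /sumexp big_cons ltr_pwDl ?expR_gt0// sumr_ge0//.
Qed.
Lemma isexp_sumexp L : isexp (sumexp L).
Proof.
exists [seq (expR l.2, l.1) | l <- L]; apply/funext => x; rewrite /expsum big_map.
by apply: eq_bigr => l _; rewrite /aff expRD mulrC.
Qed.
Lemma lse_convex U L : L != [::] -> convex_on U (lse L).
Proof.
move=> L0; apply/convex_onP => x y t _ _ t0 t1.
have A0 : sumexp L x = expR (lse L x) by rewrite lnK// posrE sumexp_gt0.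
have B0 : sumexp L y = expR (lse L y) by rewrite lnK// posrE sumexp_gt0.
move: (lse L x) (lse L y) A0 B0 => A B A0 B0.
rewrite -ler_expR lnK ?posrE ?sumexp_gt0//.
have [C defC] : exists C, C = t * A + (1 - t) * B by exists (t * A + (1 - t) * B).
rewrite -defC.
(* Convexity of exp is applied after subtracting from the exponents the log-sum-exp values [A] and
   [B]; the normalized exponentials at [x] and at [y] then sum to 1, as do the weights t and 1 -
   t. *)
have E l : expR (aff l (t *: x + (1 - t) *: y)) <=
    expR C * (t * (expR (- A) * expR (aff l x)) + (1 - t) * (expR (- B) * expR (aff l y))).
  have -> : aff l (t *: x + (1 - t) *: y) = C + (t * (- A + aff l x) + (1 - t) * (- B + aff l y)).
    by rewrite aff_comb defC; ring.
  rewrite expRD -(expRD (- A)) -(expRD (- B)); apply: ler_wpM2l; first exact: expR_ge0.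
  exact: cvx1_expR.
apply: (le_trans (ler_sum _ (fun l _ => E l))).
rewrite -mulr_sumr big_split /= -!mulr_sumr -!/(sumexp _ _) A0 B0 -!expRD !addNr expR0.
by rewrite !mulr1 addrC subrK mulr1.
Qed.
Lemma lse_maxaff L (M : 'rV[R]_n -> R) x : maxaff L M ->
  M x <= lse L x /\ lse L x <= M x + ln (size L)%:R.
Proof.
move=> HM; have [[l lL Ml] H] := HM x.
have L0 : L != [::] by apply: contraTneq lL => ->.
have s0 : (0 : R) < (size L)%:R by rewrite ltr0n lt0n size_eq0.
split; rewrite -ler_expR lnK ?posrE ?sumexp_gt0//.
  rewrite Ml /sumexp (perm_big _ (perm_to_rem lL)) big_cons /= lerDl sumr_ge0//.
rewrite expRD lnK ?posrE// mulr_natr -iter_addr_0 -(count_predT L) -big_const_seq.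
by rewrite /sumexp big_seq [leRHS]big_seq; apply: ler_sum => i /H; rewrite ler_expR.
Qed.
End LogSumExp.

(** * From log-sum-exp functions to all convex functions *)

Section Density.
Variables (R : realType) (n : nat) (U : set 'rV[R]_n).
Variable P : ('rV[R]_n -> R) -> ('rV[R]_n -> R) -> R.
Hypothesis HP : locval U P.
Variable MA : ('rV[R]_n -> R) -> ('rV[R]_n -> R) -> R.
Hypothesis hMA : is_MongeAmpere U MA.
Variable psi : 'rV[R]_n -> R.
Hypothesis psi_cont : forall x, U x -> {for x, continuous psi}.
Hypothesis psiP : forall x phi, U x -> testfun U phi -> P (cone 1%:M x) phi = psi x * phi x.
Implicit Types (f : 'rV[R]_n -> R) (L : seq ('rV[R]_n * R)).

Lemma repr_lse L c : L != [::] -> 0 <= c -> repr U P MA psi (fun x => c * lse L x).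
Proof.
move=> L0 c0.
have /choice[m Hm] : forall k : nat, exists m, forall s : R, - (2 * k%:R) <= s -> s <= 0 -> `|logser m.*2.+1 s - s| < eps R k.
  by move=> k; apply: logser_approx (eps_gt0 R k); rewrite mulr_ge0.
(* Where |lse| <= k, subtracting k brings the argument into [- 2k, 0], where [logser] is close to
   the identity. [F k] is an exponential sum because exp(lse - k) is one, and convex because
   [logser] of odd order is convex and nondecreasing. *)
pose F k x := c * (k%:R + logser (m k).*2.+1 (lse L x - k%:R)).
have cF k : convex_on U (F k).
  apply: convex_onZ => //; apply: convex_onD; first exact: convex_on_cst.
  have /convex_onP cl := @lse_convex R n U L L0; apply/convex_onP => x y t Ux Uy t0 t1.
  apply: le_trans (@logser_cvx R (m k) _ _ t t0 t1); apply: logser_mono.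
  by rewrite (_ : _ + _ = t * lse L x + (1 - t) * lse L y - k%:R); [rewrite lerD2r; exact: cl|ring].
apply: (@repr_lim _ _ _ _ HP _ hMA _ psi_cont F).
- move=> k; have [L' E] : isexp (F k).
    apply/isexpZ/isexpD; first exact: isexp_cst.
    apply: isexp_logser; have := isexpZ (expR (- k%:R)) (isexp_sumexp L).
    by congr isexp; apply/funext => x; rewrite addrC expRD lnK// posrE sumexp_gt0.
  by rewrite E; apply: (expsum_repr HP hMA psi_cont psiP); rewrite -E.
- by apply: convex_onZ => //; exact: lse_convex.
move=> K cK KU e e0.
have [M HM] := maxaff_exists (head 0 L) (behead L).
have {}HM : maxaff L M by move: HM; case: L L0 {F cF} => [|l L].
have [B [B0 KB]] : exists B : R, 0 <= B /\ forall x, K x -> `|lse L x| <= B.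
  have [B1 [B10 KB1]] := compact_norm_le cK.
  pose S := \sum_(l <- L) ((\sum_i `|l.1 0 i|) * B1 + `|l.2|).
  have S0 l : l \in L -> (\sum_i `|l.1 0 i|) * B1 + `|l.2| <= S.
    move=> lL; rewrite /S (perm_big _ (perm_to_rem lL)) big_cons /= lerDl sumr_ge0// => i _.
    by rewrite addr_ge0// mulr_ge0// sumr_ge0.
  have L1 : 0 <= ln (size L)%:R :> R by rewrite ln_ge0// ler1n lt0n size_eq0.
  have Spos : 0 <= S by rewrite sumr_ge0// => i _; rewrite addr_ge0// mulr_ge0// sumr_ge0.
  exists (S + ln (size L)%:R); split; first exact: addr_ge0.
  move=> x Kx; have [h1 h2] := lse_maxaff x HM; have [[l lL Ml] _] := HM x.
  have : `|M x| <= S.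
    rewrite Ml (le_trans _ (S0 l lL))// /aff (le_trans (ler_normD _ _))// lerD2r.
    by rewrite (le_trans (dotp_le _ _))// ler_wpM2l ?KB1// sumr_ge0.
  by rewrite !ler_norml => /andP[h3 h4]; apply/andP; split; lra.
have c1 : 0 < c + 1 by rewrite ltr_wpDl.
near=> k; move=> x Kx.
have ek : eps R k < e / (c + 1) by near: k; apply: eps_lt; rewrite divr_gt0.
have Bk : B <= k%:R by near: k; exact: nbhs_infty_ger.
have := KB x Kx; rewrite ler_norml => /andP[h1 h2].
have := Hm k (lse L x - k%:R); rewrite /F -mulrBr normrM (ger0_norm c0) => H.
have {}H : `|logser (m k).*2.+1 (lse L x - k%:R) - (lse L x - k%:R)| < eps R k by apply: H; lra.
rewrite (_ : k%:R + _ - _ = logser (m k).*2.+1 (lse L x - k%:R) - (lse L x - k%:R)); last by ring.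
move: ek; rewrite ltr_pdivlMr// => ek; move: (ltW H) (eps_gt0 R k); nra.
Unshelve. all: by end_near. Qed.

Lemma repr_maxaff L M : maxaff L M -> repr U P MA psi M.
Proof.
move=> HM.
have L0 : L != [::] by have [[l lL _] _] := HM 0; apply: contraTneq lL => ->.
(* Scaling the affine functions by k + 1 and dividing the log-sum-exp by it reduces the gap to the
   maximum to ln(size L) / (k + 1). *)
pose Lk k : seq ('rV[R]_n * R) := [seq (k.+1%:R *: l.1, k.+1%:R * l.2) | l <- L].
have Lk0 k : Lk k != [::] by rewrite -size_eq0 size_map size_eq0.
have affk k l x : aff (k.+1%:R *: l.1, k.+1%:R * l.2) x = k.+1%:R * aff l x.
  by rewrite /aff /= dotpZl mulrDr.
have HMk k : maxaff (Lk k) (fun x => k.+1%:R * M x).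
  move=> x; have [[l lL Ml] H] := HM x; split.
    by exists (k.+1%:R *: l.1, k.+1%:R * l.2); rewrite ?affk ?Ml//; apply: map_f.
  by move=> _ /mapP[l' l'L ->]; rewrite affk ler_wpM2l// H.
apply: (@repr_lim _ _ _ _ HP _ hMA _ psi_cont (fun k x => eps R k * lse (Lk k) x)).
- by move=> k; apply: repr_lse; rewrite ?(ltW (eps_gt0 R k)).
- exact: maxaff_convex HM.
move=> K cK KU e e0.
have L1 : 0 <= ln (size L)%:R :> R by rewrite ln_ge0// ler1n lt0n size_eq0.
have L2 : 0 < ln (size L)%:R + 1 :> R by rewrite ltr_wpDl.
near=> k; move=> x _.
have ek : eps R k < e / (ln (size L)%:R + 1) by near: k; apply: eps_lt; rewrite divr_gt0.
move: ek; rewrite ltr_pdivlMr// => ek.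
have e1 : eps R k * k.+1%:R = 1 by rewrite /eps mulVf.
have [h1 h2] := lse_maxaff x (HMk k); rewrite size_map in h2.
have ep := eps_gt0 R k.
have := ler_wpM2l (ltW ep) h1; have := ler_wpM2l (ltW ep) h2.
rewrite mulrDr !mulrA e1 mul1r => h3 h4.
rewrite ltr_norml; apply/andP; split; lra.
Unshelve. all: by end_near. Qed.

Lemma repr_convex f : convex_on U f -> repr U P MA psi f.
Proof.
move=> cf; have [F [HF Ff]] := maxaff_cvg (lv_open HP) (lv_convex HP) cf.
apply: (repr_lim HP hMA psi_cont _ cf Ff) => k.
by have [L HL] := HF k; exact: repr_maxaff HL.
Qed.
End Density.

Lemma locval_component (R : realType) (n : nat) (U : set 'rV[R]_n) (Psi : ('rV[R]_n -> R) -> cmeas R n) (pr : R * R -> R) :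
  open U -> convex_set U -> (forall f, convex_on U f -> radon U (Psi f)) -> Psi_continuous U Psi -> valuation U Psi ->
  dually_epi_translation_invariant U Psi -> dually_simple U Psi -> locally_determined U Psi ->
  pr = fst \/ pr = snd -> locval U (fun f phi => pr (Psi f phi)).
Proof.
move=> hUo hUc hPsiM hcont hval hinv hsimple hloc prE; split => //.
- move=> f cf p1 p2 a b t1 t2; rewrite (hPsiM f cf).1//; by case: prE => ->.
- move=> f cf K cK KU; have [C HC] := (hPsiM f cf).2 K cK KU; exists C => phi tp sp p1.
  by have [] := HC phi tp sp p1; case: prE => ->.
- move=> F f cF cf Ff phi tp; have := hcont F f cF cf Ff phi tp.
  by case: prE => -> H; [apply: cvg_comp H _; exact: cvg_fst|apply: cvg_comp H _; exact: cvg_snd].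
- move=> f h cf ch cm phi tp; have := hval f h cf ch cm phi tp.
  by case: prE => -> E; [have := congr1 fst E|have := congr1 snd E].
- by move=> f l cf al phi tp; rewrite (hinv f l cf al phi tp).
- by move=> E rE f cf phi tp; rewrite (hsimple E rE f cf phi tp); case: prE => ->.
- by move=> f h V cf ch oV VU fh phi tp; rewrite (hloc f h V cf ch oV VU fh phi tp).
Qed.

Theorem theorem1p1 (R : realType) (n : nat) (U : set 'rV[R]_n)
  (hUo : open U) (hUc : convex_set U)
  (MA : ('rV[R]_n -> R) -> ('rV[R]_n -> R) -> R) (hMA : is_MongeAmpere U MA)
  (Psi : ('rV[R]_n -> R) -> cmeas R n)
  (hPsiM : forall f, convex_on U f -> radon U (Psi f))
  (hcont : Psi_continuous U Psi)
  (hval : valuation U Psi)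
  (hinv : dually_epi_translation_invariant U Psi)
  (hsimple : dually_simple U Psi)
  (hloc : locally_determined U Psi) :
  exists psi : 'rV[R]_n -> R * R,
    ((forall x, U x -> {for x, continuous psi}) /\
     (forall f, convex_on U f -> forall phi, testfun U phi ->
        Psi f phi = (MA f (fun x => (psi x).1 * phi x),
                     MA f (fun x => (psi x).2 * phi x)))) /\
    (forall psi' : 'rV[R]_n -> R * R,
       (forall x, U x -> {for x, continuous psi'}) ->
       (forall f, convex_on U f -> forall phi, testfun U phi ->
          Psi f phi = (MA f (fun x => (psi' x).1 * phi x),
                       MA f (fun x => (psi' x).2 * phi x))) ->
       forall x, U x -> psi' x = psi x).
Proof.
have H1 := locval_component hUo hUc hPsiM hcont hval hinv hsimple hloc (or_introl (erefl fst)).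
have H2 := locval_component hUo hUc hPsiM hcont hval hinv hsimple hloc (or_intror (erefl snd)).
have [psi1 [c1 E1]] := psi_exists H1.
have [psi2 [c2 E2]] := psi_exists H2.
exists (fun x => (psi1 x, psi2 x)); split; [split|].
- by move=> x Ux; exact: (cvg_pair (c1 x Ux) (c2 x Ux)).
- move=> f cf phi tp; have [_ R1] := repr_convex H1 hMA c1 E1 cf; have [_ R2] := repr_convex H2 hMA c2 E2 cf.
  by rewrite [LHS]surjective_pairing R1// R2.
move=> psi' c' E' x Ux.
have [b [tb b1]] := bump_exists hUo Ux.
(* The Monge-Ampere measure of the standard cone at [x] is the Dirac mass at [x], so evaluating
   [Psi] there on a bump reads off the density and gives uniqueness. *)
have cone_value (phi : 'rV[R]_n -> R) : testfun U phi -> MA (cone 1%:M x) phi = phi x.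
  move=> tp; rewrite /cone (MA_hs_square hMA _ tp) ?unitmx1// det1 normr1 mul1r; congr phi.
  by rewrite /vertex trmx1 invmx1 mulmx1; apply/rowP => j; rewrite mxE dotp_rowE trmx1 mulmx1.
have c1' y : U y -> {for y, continuous (fun x => (psi' x).1)}.
  by move=> Uy; apply: cvg_comp (c' y Uy) _; exact: cvg_fst.
have c2' y : U y -> {for y, continuous (fun x => (psi' x).2)}.
  by move=> Uy; apply: cvg_comp (c' y Uy) _; exact: cvg_snd.
have cc : convex_on U (cone 1%:M x) by exact: convex_on_hs.
have := E' _ cc b tb.
rewrite !cone_value; last 2 first.
- exact: testfun_psi c2' tb.
- exact: testfun_psi c1' tb.
rewrite b1 !mulr1 -surjective_pairing => <-.
by rewrite [LHS]surjective_pairing E1// E2// b1 !mulr1.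
Qed.
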